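(* Let $a_1,a_2\in\mathbb R$ with $a_1^2+a_2^2\neq0$. Then the Lie group $G(a_1,a_2,0,0)$ is locally isomorphic to $S^3\times S^3$.
   Context: For $a_1,a_2,a_3,a_4\in\mathbb R$ with $a_1a_4=a_2a_3$, $G(a_1,a_2,a_3,a_4)$ denotes a $6$-dimensional Lie group (it exists by Lie's third theorem) with a basis $e_1,\dots,e_5,A_2$ of its left invariant $1$-forms satisfying $$\begin{aligned} de_1&=A_2\wedge e_2-(2a_1+a_3)e_3\wedge e_5-(2a_2+a_4)e_4\wedge e_5,\\ de_2&=-A_2\wedge e_1+(2a_1+a_3)e_4\wedge e_5-(2a_2+a_4)e_3\wedge e_5,\\ de_3&=-A_2\wedge e_4+(2a_1+a_3)e_1\wedge e_5+(2a_2+a_4)e_2\wedge e_5,\\ de_4&=A_2\wedge e_3-(2a_1+a_3)e_2\wedge e_5+(2a_2+a_4)e_1\wedge e_5,\\ de_5&=-2(a_1-a_3)(e_1\wedge e_3-e_2\wedge e_4)-2(a_2-a_4)(e_1\wedge e_4+e_2\wedge e_3),\\ dA_2&=\alpha\,(e_1\wedge e_2-e_3\wedge e_4), \end{aligned}$$ where $\alpha:=-2\big((a_1-a_3)(2a_1+a_3)+(a_2-a_4)(2a_2+a_4)\big)$. Here $S^3$ is the Lie group of unit quaternions. *)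

(* Defs.v *)
From HB Require Import structures.
From mathcomp Require Import all_boot all_order all_algebra monoid.
From mathcomp Require Import all_classical all_reals all_analysis.
From mathcomp Require Import ring lra.
Set Implicit Arguments.
Unset Strict Implicit.
Unset Printing Implicit Defensive.
Import Order.TTheory GRing.Theory Num.Theory.
Import numFieldNormedType.Exports.
Local Open Scope classical_set_scope.
Local Open Scope ring_scope.

Section SmoothFunctions.
Context {R : realType}.

(* f is of class C^k on the open set U. *)
Fixpoint Ck (k : nat) (n : nat) (U : set 'rV[R]_n) (f : 'rV[R]_n -> R) : Prop :=
  if k is k'.+1 then
    (forall x, U x -> differentiable f x) /\
    (forall v, Ck k' U (fun x => 'd f x v))
  else forall x, U x -> {for x, continuous f}.

Definition smooth_on (m n : nat) (U : set 'rV[R]_m)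
    (f : 'rV[R]_m -> 'rV[R]_n) : Prop :=
  forall k i, Ck k U (fun x => f x 0 i).

End SmoothFunctions.

Section Calculus.
Context {R : realType}.

Lemma near_eq_diff (V W : normedModType R) (f g : V -> W) (x : V) :
  (\forall y \near x, f y = g y) -> differentiable f x ->
  differentiable g x /\ 'd g x = 'd f x :> (V -> W).
Proof.
move=> fg df.
have fgx : f x = g x by exact: nbhs_singleton fg.
have dfc : continuous ('d f x) by exact: diff_continuous.
have e : g \o shift x = cst (g x) + 'd f x +o_ 0 id.
  apply/eqaddoP => _/posnumP[e].
  have /eqaddoP /(_ _ [gt0 of e%:num]) h1 := diff_locally df.
  have fgS : \forall h \near 0, f (h + x) = g (h + x).
    by move: fg; rewrite (near_shift 0) subr0.
  move: h1 fgS; apply: filterS2 => h.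
  by rewrite !fctE /= -fgx => + fgh; rewrite fgh.
have eq := diff_unique dfc e.
by split => //; apply/diff_locallyP; rewrite eq.
Qed.

Lemma Ck_eq k n (U : set 'rV[R]_n) (f g : 'rV[R]_n -> R) :
  open U -> (forall x, U x -> f x = g x) -> Ck k U f -> Ck k U g.
Proof.
move=> oU; have nb x : U x -> \forall y \near x, U y.
  by move=> Ux; exact: open_nbhs_nbhs.
elim: k f g => [|k ih] f g fg /=.
  move=> cf x Ux.
  have fx := cf _ Ux; rewrite /prop_for /continuous_at -(fg _ Ux).
  apply: cvg_trans fx; apply: (@near_eq_cvg _ _ (nbhs x) _ f g).
  by move: (nb _ Ux); apply: filterS => y /fg.
case=> df Df; have e x : U x -> differentiable g x /\ 'd g x = 'd f x :> (_ -> _).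
  move=> Ux; apply: near_eq_diff (df _ Ux).
  by move: (nb _ Ux); apply: filterS.
split=> [x /e[]//|v]; apply: ih (Df v) => x /e[_ ->//].
Qed.

Lemma Ck_sub k n (U V : set 'rV[R]_n) (f : 'rV[R]_n -> R) :
  V `<=` U -> Ck k U f -> Ck k V f.
Proof.
move=> VU; elim: k f => [|k ih] f /=; first by move=> h x /VU/h.
by case=> h1 h2; split=> [x /VU/h1//|v]; exact: ih.
Qed.

Lemma CkS k n (U : set 'rV[R]_n) (f : 'rV[R]_n -> R) :
  Ck k.+1 U f -> Ck k U f.
Proof.
elim: k f => [|k ih] f /=.
  by case=> df _ x /df; exact: differentiable_continuous.
by case=> df Df; split=> // v; apply: ih; exact: Df.
Qed.

Lemma Ck_cst k n (U : set 'rV[R]_n) (a : R) : Ck k U (fun=> a).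
Proof.
elim: k a => [|k ih] a /=; first by move=> x _; exact: cst_continuous.
split=> [x _|v]; first exact: differentiable_cst.
rewrite (_ : (fun x => _) = fun=> 0); first exact: ih.
by apply/funext => x; rewrite diff_cst.
Qed.

Lemma Ck_linear k n (U : set 'rV[R]_n) (f : {linear 'rV[R]_n -> R}) :
  continuous f -> Ck k U f.
Proof.
move=> cf; case: k => [x _|k]; first exact: cf.
split=> [x _|v]; first exact: linear_differentiable.
rewrite (_ : (fun x => _) = fun=> f v); first exact: Ck_cst.
by apply/funext => x; rewrite diff_lin.
Qed.

Lemma Ck_coord k n (U : set 'rV[R]_n) i : Ck k U (fun x => x 0 i : R).
Proof.
have @f : {linear 'rV[R]_n -> R}.
  by exists (fun N : 'rV[R]_n => N 0 i); do 2![eexists]; do ?[constructor];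
     rewrite ?mxE// => ? *; rewrite ?mxE//; move=> ?; rewrite !mxE.
rewrite (_ : (fun _ => _) = f) //; exact/Ck_linear/coord_continuous.
Qed.

Lemma CkD k n (U : set 'rV[R]_n) (f g : 'rV[R]_n -> R) :
  open U -> Ck k U f -> Ck k U g -> Ck k U (fun x => f x + g x).
Proof.
move=> oU; elim: k f g => [|k ih] f g /=.
  by move=> cf cg x Ux; apply: continuousD; [exact: cf|exact: cg].
move=> [df Df] [dg Dg]; split=> [x Ux|v].
  exact: (differentiableD (df _ Ux) (dg _ Ux)).
apply: Ck_eq oU _ (ih _ _ (Df v) (Dg v)) => x Ux.
exact: (esym (congr1 (fun h : _ -> R => h v) (diffD (df _ Ux) (dg _ Ux)))).
Qed.

Lemma CkM k n (U : set 'rV[R]_n) (f g : 'rV[R]_n -> R) :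
  open U -> Ck k U f -> Ck k U g -> Ck k U (fun x => f x * g x).
Proof.
move=> oU; elim: k f g => [|k ih] f g.
  by move=> /= cf cg x Ux; apply: continuousM; [exact: cf|exact: cg].
move=> Cf Cg; have [df Df] := Cf; have [dg Dg] := Cg; split=> [x Ux|v].
  exact: (differentiableM (df _ Ux) (dg _ Ux)).
have h1 := ih _ _ (CkS Cf) (Dg v); have h2 := ih _ _ (CkS Cg) (Df v).
apply: Ck_eq oU _ (CkD oU h1 h2) => x Ux.
exact: (esym (congr1 (fun h : _ -> R => h v) (diffM (df _ Ux) (dg _ Ux)))).
Qed.

Lemma CkN k n (U : set 'rV[R]_n) (f : 'rV[R]_n -> R) :
  open U -> Ck k U f -> Ck k U (fun x => - f x).
Proof.
move=> oU Cf; apply: Ck_eq oU _ (CkM oU (Ck_cst k U (-1)) Cf) => x _.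
by rewrite mulN1r.
Qed.

Lemma CkV k n (U : set 'rV[R]_n) (f : 'rV[R]_n -> R) :
  open U -> (forall x, U x -> f x != 0) ->
  Ck k U f -> Ck k U (fun x => (f x)^-1).
Proof.
move=> oU f0; elim: k => [|k ih].
  by move=> /= cf x Ux; apply: continuousV; [exact: f0|exact: cf].
move=> Cf; have [df Df] := Cf; split=> [x Ux|v].
  exact: (differentiableV (df _ Ux) (f0 _ Ux)).
have i1 := ih (CkS Cf).
apply: Ck_eq oU _ (CkM oU (CkN oU (CkM oU i1 i1)) (Df v)) => x Ux.
apply: etrans (esym (congr1 (fun h : _ -> R => h v) (diffV (df _ Ux) (f0 _ Ux)))).
by rewrite /= -exprVn expr2.
Qed.

Lemma Ck_sum k n (U : set 'rV[R]_n) I (r : seq I) (f : I -> 'rV[R]_n -> R) :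
  open U -> (forall i, Ck k U (f i)) -> Ck k U (fun x => \sum_(i <- r) f i x).
Proof.
move=> oU Cf; elim: r => [|i r ih].
  by apply: Ck_eq oU _ (Ck_cst _ _ 0) => x _; rewrite big_nil.
by apply: Ck_eq oU _ (CkD oU (Cf i) ih) => x _; rewrite big_cons.
Qed.

Lemma differentiable_rV (V : normedModType R) n (g : V -> 'rV[R]_n) x :
  (forall i, differentiable (fun y => g y 0 i) x) ->
  differentiable g x /\
  forall v i, 'd g x v 0 i = 'd (fun y => g y 0 i) x v.
Proof.
move=> dg; have dG : differentiable g x.
  rewrite (_ : g = \sum_i (fun y => g y 0 i *: delta_mx 0 i)).
    by apply: differentiable_sum => i; exact: differentiableZl.
  by apply/funext => y; rewrite fct_sumE; exact: row_sum_delta.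
split=> // v i.
have @f : {linear 'rV[R]_n -> R}.
  by exists (fun N : 'rV[R]_n => N 0 i); do 2![eexists]; do ?[constructor];
     rewrite ?mxE// => ? *; rewrite ?mxE//; move=> ?; rewrite !mxE.
have cf : continuous f by exact: coord_continuous.
have -> : (fun y => g y 0 i) = f \o g by [].
have df : differentiable f (g x) by exact: linear_differentiable.
apply: etrans (esym (congr1 (fun h : _ -> R => h v) (diff_comp dG df))).
by rewrite -[RHS]/('d f (g x) ('d g x v)) (diff_lin _ cf).
Qed.

Lemma continuous_rV (T : topologicalType) n (g : T -> 'rV[R]_n) (x : T) :
  (forall i, {for x, continuous (fun y => g y 0 i)}) -> {for x, continuous g}.
Proof.
move=> cg A [P /= nP PA].
have : \forall y \near x, forall i, P 0 i (g y 0 i).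
  by apply: filter_forall => i; exact: (cg i _ (nP 0 i)).
by apply: filterS => y Py; apply: PA => i j; rewrite ord1.
Qed.

Lemma Ck_comp k m n (U : set 'rV[R]_m) (V : set 'rV[R]_n)
    (g : 'rV[R]_m -> 'rV[R]_n) (f : 'rV[R]_n -> R) :
  open U -> (forall x, U x -> V (g x)) ->
  (forall i, Ck k U (fun x => g x 0 i)) -> Ck k V f -> Ck k U (f \o g).
Proof.
move=> oU UV; elim: k f => [|k ih] f.
  move=> Cg Cf x Ux; apply: continuous_comp; last exact/Cf/UV.
  by apply: continuous_rV => i; exact: Cg.
move=> Cg Cf; have [df Df] := Cf.
have Dg x (Ux : U x) := differentiable_rV (fun i => (Cg i).1 x Ux).
split=> [x Ux|v].
  by apply: differentiable_comp; [case: (Dg _ Ux)|exact/df/UV].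
have C i : Ck k U (fun x => 'd (fun y => g y 0 i) x v * 'd f (g x) (delta_mx 0 i)).
  apply: CkM => //; first exact: (Cg i).2.
  by apply: (ih (fun y => 'd f y (delta_mx 0 i))) => [j|]; [exact: CkS|exact: Df].
apply: Ck_eq oU _ (Ck_sum (index_enum _) oU C) => x Ux.
have [dgx Dgx] := Dg _ Ux.
apply: etrans (esym (congr1 (fun h : _ -> R => h v) (diff_comp dgx (df _ (UV _ Ux))))).
rewrite /=.
rewrite [in RHS](row_sum_delta ('d g x v)) linear_sum.
by apply: eq_bigr => i _; rewrite linearZ Dgx.
Qed.

Lemma smooth_on_comp m n p (U : set 'rV[R]_m) (V : set 'rV[R]_n)
    (g : 'rV[R]_m -> 'rV[R]_n) (f : 'rV[R]_n -> 'rV[R]_p) :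
  open U -> (forall x, U x -> V (g x)) ->
  smooth_on U g -> smooth_on V f -> smooth_on U (f \o g).
Proof.
by move=> oU UV sg sf k i; apply: Ck_comp oU UV (sg k) (sf k i).
Qed.

Lemma smooth_on_eq m n (U : set 'rV[R]_m) (f g : 'rV[R]_m -> 'rV[R]_n) :
  open U -> (forall x, U x -> f x = g x) -> smooth_on U f -> smooth_on U g.
Proof.
by move=> oU fg sf k i; apply: Ck_eq oU _ (sf k i) => x /fg ->.
Qed.

Lemma smooth_on_sub m n (U V : set 'rV[R]_m) (f : 'rV[R]_m -> 'rV[R]_n) :
  V `<=` U -> smooth_on U f -> smooth_on V f.
Proof. by move=> VU sf k i; apply: Ck_sub VU _. Qed.

End Calculus.

Section Charts.
Context {R : realType}.

(* The fields of a chart are total functions: [chart_map] is meaningful on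
   [chart_dom] only, and [chart_inv] on the image of [chart_dom] only. *)
Record chart (n : nat) (M : Type) := Chart {
  chart_dom : set M;
  chart_map : M -> 'rV[R]_n;
  chart_inv : 'rV[R]_n -> M }.

Definition chart_img n M (c : chart n M) : set 'rV[R]_n :=
  chart_map c @` chart_dom c.

Definition is_chart n (M : topologicalType) (c : chart n M) : Prop :=
  [/\ open (chart_dom c),
      open (chart_img c),
      forall x, chart_dom c x -> chart_inv c (chart_map c x) = x,
      forall x, chart_dom c x -> {for x, continuous (chart_map c)} &
      forall y, chart_img c y -> {for y, continuous (chart_inv c)}].

Definition is_atlas n (M : topologicalType) (A : set (chart n M)) : Prop :=
  [/\ forall c, A c -> is_chart c,
      forall x : M, exists2 c, A c & chart_dom c x &
      forall c d, A c -> A d ->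
        smooth_on (chart_map c @` (chart_dom c `&` chart_dom d))
                  (chart_map d \o chart_inv c)].

Definition smooth_map m n (M N : topologicalType) (A : set (chart m M))
    (B : set (chart n N)) (U : set M) (f : M -> N) : Prop :=
  (forall x, U x -> {for x, continuous f}) /\
  forall c d, A c -> B d ->
    smooth_on (chart_map c @` (U `&` chart_dom c `&` f @^-1` chart_dom d))
              (chart_map d \o f \o chart_inv c).

Definition prod_chart m n M N (c : chart m M) (d : chart n N) :
    chart (m + n) (M * N) :=
  Chart (chart_dom c `*` chart_dom d)
        (fun p => row_mx (chart_map c p.1) (chart_map d p.2))
        (fun z => (chart_inv c (lsubmx z), chart_inv d (rsubmx z))).

Definition prod_atlas m n M N (A : set (chart m M)) (B : set (chart n N)) :
    set (chart (m + n) (M * N)) :=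
  [set prod_chart p.1 p.2 | p in A `*` B].

End Charts.
Arguments chart : clear implicits.

(* No compatibility between the group law and the topology is required here;
   it is part of [is_lie_group]. *)
#[short(type="preTopologicalGroupType")]
HB.structure Definition PreTopologicalGroup := {G of Group G & Topological G}.

Definition is_lie_group (R : realType) n (G : preTopologicalGroupType)
    (A : set (chart R n G)) : Prop :=
  [/\ is_atlas A,
      hausdorff_space G,
      @second_countable G,
      smooth_map (prod_atlas A A) A setT (fun p : G * G => (p.1 * p.2)%g) &
      smooth_map A A setT (fun x : G => (x^-1)%g)].

Record lieGroup (R : realType) (n : nat) := LieGroup {
  lie_sort :> preTopologicalGroupType;
  lie_atlas : set (chart R n lie_sort);
  lie_axioms : is_lie_group lie_atlas }.
Arguments lie_atlas {R n} l.

Definition locally_isomorphic (R : realType) m n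
    (G : lieGroup R m) (H : lieGroup R n) : Prop :=
  exists (U : set G) (V : set H) (f : G -> H) (h : H -> G),
    [/\ open U /\ U 1%g,
        open V /\ V 1%g,
        (forall x, U x -> V (f x) /\ h (f x) = x) /\
        (forall y, V y -> U (h y) /\ f (h y) = y),
        smooth_map (lie_atlas G) (lie_atlas H) U f /\
        smooth_map (lie_atlas H) (lie_atlas G) V h &
        (forall x y, U x -> U y -> U (x * y)%g -> f (x * y)%g = (f x * f y)%g) /\
        (forall x y, V x -> V y -> V (x * y)%g -> h (x * y)%g = (h x * h y)%g)].

Section Forms.
Context {R : realType} {n : nat} (G : lieGroup R n).

(* [w c y 0 i] is the i-th component, in the chart [c], of the form at the
   point of coordinates [y], that is w = \sum_i (w c y 0 i) dx^i; similarly a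
   2-form is \sum_(i < j) (w c y i j) dx^i /\ dx^j.  The values outside
   the atlas or outside the images of the charts are irrelevant. *)
Definition form1 := chart R n G -> 'rV[R]_n -> 'rV[R]_n.
Definition form2 := chart R n G -> 'rV[R]_n -> 'M[R]_n.

Definition form1_eq (w w' : form1) : Prop :=
  forall c y, lie_atlas G c -> chart_img c y -> w c y = w' c y.
Definition form2_eq (w w' : form2) : Prop :=
  forall c y, lie_atlas G c -> chart_img c y -> w c y = w' c y.

Definition covec_app (a v : 'rV[R]_n) : R := \sum_i a 0 i * v 0 i.

(* f^* w = w' *)
Definition pullback_eq (f : G -> G) (w w' : form1) : Prop :=
  forall c d x, lie_atlas G c -> lie_atlas G d ->
    chart_dom c x -> chart_dom d (f x) -> forall v,
      covec_app (w' c (chart_map c x)) v =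
      covec_app (w d (chart_map d (f x)))
        ('d (chart_map d \o f \o chart_inv c) (chart_map c x) v).

(* Invariance under the identity says that the local expressions of [w] in
   the various charts define the same form. *)
Definition is_form1 (w : form1) : Prop :=
  (forall c, lie_atlas G c -> smooth_on (chart_img c) (w c)) /\
  pullback_eq id w w.

Definition left_invariant (w : form1) : Prop :=
  is_form1 w /\ forall g : G, pullback_eq (fun x => g * x)%g w w.

Definition left_invariant_basis k (e : 'I_k -> form1) : Prop :=
  (forall i, left_invariant (e i)) /\
  forall w, left_invariant w ->
    exists! a : 'I_k -> R, form1_eq w (\sum_i a i *: e i).

Definition ext_d (w : form1) : form2 := fun c y =>
  \matrix_(i, j) ('D_(delta_mx 0 i) (fun z => w c z 0 j) y
                  - 'D_(delta_mx 0 j) (fun z => w c z 0 i) y).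

Definition wedge (a b : form1) : form2 := fun c y =>
  \matrix_(i, j) (a c y 0 i * b c y 0 j - a c y 0 j * b c y 0 i).

End Forms.

Local Notation "a ∧ b" := (wedge a b) (at level 40, left associativity).

(* G is a Lie group G(a1, a2, a3, a4): the group is only specified by its
   structure equations, up to (non-unique) choice. *)
Definition is_G (R : realType) (a1 a2 a3 a4 : R) (G : lieGroup R 6) : Prop :=
  a1 * a4 = a2 * a3 /\
  let b := 2 * a1 + a3 in
  let b' := 2 * a2 + a4 in
  let alpha := - 2 * ((a1 - a3) * (2 * a1 + a3) + (a2 - a4) * (2 * a2 + a4)) in
  exists e1 e2 e3 e4 e5 A2 : form1 G,
    left_invariant_basis (tnth [tuple e1; e2; e3; e4; e5; A2]) /\
    [/\ form2_eq (ext_d e1) (A2 ∧ e2 - b *: (e3 ∧ e5) - b' *: (e4 ∧ e5)),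
        form2_eq (ext_d e2) (- (A2 ∧ e1) + b *: (e4 ∧ e5) - b' *: (e3 ∧ e5)),
        form2_eq (ext_d e3) (- (A2 ∧ e4) + b *: (e1 ∧ e5) + b' *: (e2 ∧ e5)),
        form2_eq (ext_d e4) (A2 ∧ e3 - b *: (e2 ∧ e5) + b' *: (e1 ∧ e5)) &
        form2_eq (ext_d e5) (- (2 * (a1 - a3)) *: (e1 ∧ e3 - e2 ∧ e4)
                             - (2 * (a2 - a4)) *: (e1 ∧ e4 + e2 ∧ e3)) /\
        form2_eq (ext_d A2) (alpha *: (e1 ∧ e2 - e3 ∧ e4))].

Lemma open_chart_image (R : realType) n (M : topologicalType) (c : chart R n M)
    (A : set M) :
  is_chart c -> open A -> open (chart_map c @` (A `&` chart_dom c)).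
Proof.
case=> od oi K _ ci oA.
have -> : chart_map c @` (A `&` chart_dom c) =
          chart_img c `&` chart_inv c @^-1` (A `&` chart_dom c).
  apply/seteqP; split=> [_ [x [Ax dx] <-]|y [[x dx <-]]] /=.
    by rewrite K//; split => //; exists x.
  by rewrite K// => -[Ax _]; exists x.
rewrite openE => y [iy Ay].
apply: (@filterI _ (nbhs y)); first exact: open_nbhs_nbhs.
by apply: ci => //; apply: open_nbhs_nbhs; split => //; exact: openI.
Qed.

Section SmoothBlocks.
Context {R : realType}.

Lemma smooth_on_continuous m n (U : set 'rV[R]_m) (f : 'rV[R]_m -> 'rV[R]_n) x :
  smooth_on U f -> U x -> {for x, continuous f}.
Proof. by move=> sf Ux; apply: continuous_rV => i; exact: (sf 0%N i). Qed.

Lemma smooth_id m (U : set 'rV[R]_m) : smooth_on U id.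
Proof. by move=> k i; exact: Ck_coord. Qed.

Lemma smooth_lsubmx m n (U : set 'rV[R]_(m + n)) : smooth_on U lsubmx.
Proof.
move=> k i; rewrite (_ : (fun x => _) = fun x : 'rV[R]_(m + n) => x 0 (lshift n i)).
  exact: Ck_coord.
by apply/funext => x; rewrite mxE.
Qed.

Lemma smooth_rsubmx m n (U : set 'rV[R]_(m + n)) : smooth_on U rsubmx.
Proof.
move=> k i; rewrite (_ : (fun x => _) = fun x : 'rV[R]_(m + n) => x 0 (rshift m i)).
  exact: Ck_coord.
by apply/funext => x; rewrite mxE.
Qed.

Lemma smooth_row_mx p m n (U : set 'rV[R]_p) (f : 'rV[R]_p -> 'rV[R]_m)
    (g : 'rV[R]_p -> 'rV[R]_n) :
  smooth_on U f -> smooth_on U g -> smooth_on U (fun x => row_mx (f x) (g x)).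
Proof.
move=> sf sg k i; case: (split_ordP i) => j ->.
  rewrite (_ : (fun x => _) = fun x => f x 0 j); first exact: sf.
  by apply/funext => x; rewrite row_mxEl.
rewrite (_ : (fun x => _) = fun x => g x 0 j); first exact: sg.
by apply/funext => x; rewrite row_mxEr.
Qed.

End SmoothBlocks.

Lemma hausdorff_prod (S T : topologicalType) :
  hausdorff_space S -> hausdorff_space T -> hausdorff_space (S * T)%type.
Proof.
move=> hS hT [x1 x2] [y1 y2] h; congr pair.
  apply: hS => A B nA nB.
  have [||[z1 z2] [[Az _] [Bz _]]] := h (A `*` setT) (B `*` setT).
  - by exists (A, setT) => //; split => //; exact: filterT.
  - by exists (B, setT) => //; split => //; exact: filterT.
  - by exists z1.
apply: hT => A B nA nB.
have [||[z1 z2] [[_ Az] [_ Bz]]] := h (setT `*` A) (setT `*` B).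
- by exists (setT, A) => //; split => //; exact: filterT.
- by exists (setT, B) => //; split => //; exact: filterT.
- by exists z2.
Qed.

Lemma second_countable_prod (S T : topologicalType) :
  @second_countable S -> @second_countable T ->
  @second_countable (S * T)%type.
Proof.
move=> [B cB [oB bB]] [C cC [oC bC]].
exists [set p.1 `*` p.2 | p in B `*` C]; first exact/card_le_trans/countableX/cC/cB/card_image_le.
split=> [_ [[/= U V] [/oB oU /oC oV] <-]|[x y] N [[P Q] /= [nP nQ] PQN]].
  rewrite openE => -[x y] [/= Ux Vy].
  by exists (U, V) => //; split; exact: open_nbhs_nbhs.
have [U [BU Ux] UP] := bB x P nP; have [V [CV Vy] VQ] := bC y Q nQ.
exists (U `*` V); first by split => //; exists (U, V).
by move=> [a b] [/= /UP ? /VQ ?]; exact: PQN.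
Qed.

Section ProductManifold.
Context {R : realType}.

Lemma prod_chartP m n (M N : topologicalType) (c : chart R m M)
    (d : chart R n N) : is_chart c -> is_chart d -> is_chart (prod_chart c d).
Proof.
move=> [odc oic Kc cc ci] [odd oid Kd cd di].
have imgE : chart_img (prod_chart c d) =
    lsubmx @^-1` chart_img c `&` rsubmx @^-1` chart_img d.
  apply/seteqP; split=> [_ [[x y] [/= dx dy] <-]|z /= [[x dx xE] [y dy yE]]].
    by rewrite /= row_mxKl row_mxKr; split; [exists x|exists y].
  by exists (x, y) => //=; rewrite xE yE hsubmxK.
have cl (z : 'rV[R]_(m + n)) : {for z, continuous lsubmx}.
  exact: (smooth_on_continuous (@smooth_lsubmx _ m n setT)).
have cr (z : 'rV[R]_(m + n)) : {for z, continuous rsubmx}.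
  exact: (smooth_on_continuous (@smooth_rsubmx _ m n setT)).
split.
- rewrite openE => -[x y] [/= dx dy].
  by exists (chart_dom c, chart_dom d) => //; split; exact: open_nbhs_nbhs.
- rewrite imgE; apply: openI.
    by apply: open_comp => // z _; exact: cl.
  by apply: open_comp => // z _; exact: cr.
- by move=> [x y] [/= dx dy]; rewrite row_mxKl row_mxKr Kc// Kd.
- move=> [x y] [/= dx dy]; apply: continuous_rV => i.
  case: (split_ordP i) => j -> /=.
    rewrite (_ : (fun x => _) =
      (fun y : 'rV[R]_m => y 0 j) \o chart_map c \o fst); last first.
      by apply/funext => z /=; rewrite row_mxEl.
    apply: (continuous_comp (f := chart_map c \o fst)
      (g := fun y : 'rV[R]_m => y 0 j)); last exact: coord_continuous.
    by apply: (continuous_comp (f := fst)); [exact: cvg_fst|exact: cc].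
  rewrite (_ : (fun x => _) =
    (fun y : 'rV[R]_n => y 0 j) \o chart_map d \o snd); last first.
    by apply/funext => z /=; rewrite row_mxEr.
  apply: (continuous_comp (f := chart_map d \o snd)
    (g := fun y : 'rV[R]_n => y 0 j)); last exact: coord_continuous.
  by apply: (continuous_comp (f := snd)); [exact: cvg_snd|exact: cd].
- move=> z; rewrite imgE => -[/= zc zd].
  apply: (@cvg_pair _ _ _ (nbhs z) (nbhs _) (nbhs _)).
    by apply: continuous_comp; [exact: cl|exact: ci].
  by apply: continuous_comp; [exact: cr|exact: di].
Qed.

Lemma prod_atlasP m n (M N : topologicalType) (A : set (chart R m M))
    (B : set (chart R n N)) :
  is_atlas A -> is_atlas B -> is_atlas (prod_atlas A B).
Proof.
move=> [Ac Acov Acp] [Bc Bcov Bcp]; split.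
- by move=> _ [[c d] [/= /Ac ? /Bc ?] <-]; exact: prod_chartP.
- move=> [x y]; have [c Ac' cx] := Acov x; have [d Bd dy] := Bcov y.
  by exists (prod_chart c d) => //; exists (c, d).
- move=> _ _ [[c d] [/= Acc Bd] <-] [[c' d'] [/= Ac' Bd'] <-].
  set W := image _ _.
  have oW : open W.
    rewrite /W (setIC (chart_dom (prod_chart c d))); apply: open_chart_image.
      by apply: prod_chartP; [exact: Ac|exact: Bc].
    by case: (prod_chartP (Ac _ Ac') (Bc _ Bd')).
  apply: smooth_row_mx.
    apply: (smooth_on_comp oW) (smooth_lsubmx W) (Acp _ _ Acc Ac').
    by move=> _ [[x y] [[/= dx dy] [dx' dy']] <-]; rewrite row_mxKl; exists x.
  apply: (smooth_on_comp oW) (smooth_rsubmx W) (Bcp _ _ Bd Bd').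
  by move=> _ [[x y] [[/= dx dy] [dx' dy']] <-]; rewrite row_mxKr; exists y.
Qed.

End ProductManifold.

HB.instance Definition _ (G H : preTopologicalGroupType) :=
  Topological.on (G * H)%type.

Section ProductLieGroup.
Context {R : realType} {m n : nat} (G : lieGroup R m) (H : lieGroup R n).

Lemma prod_lie_axioms : @is_lie_group R (m + n) (G * H)%type
  (prod_atlas (lie_atlas G) (lie_atlas H)).
Proof.
have [aG hG sG [mG MG] [iG IG]] := lie_axioms G.
have [aH hH sH [mH MH] [iH IH]] := lie_axioms H.
have aGH := prod_atlasP aG aH.
have aGH2 := prod_atlasP aGH aGH.
split.
- exact: aGH.
- exact: hausdorff_prod.
- exact: second_countable_prod.
- have cm (x : (G * H) * (G * H)) : {for x, continuous
      (fun p : (G * H) * (G * H) => (p.1 * p.2)%g)}.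
    apply: (@cvg_pair _ _ _ (nbhs x) (nbhs _) (nbhs _)).
      apply: (continuous_comp (f := fun p => (p.1.1, p.2.1))
                              (g := fun p : G * G => (p.1 * p.2)%g)).
        apply: (@cvg_pair _ _ _ (nbhs x) (nbhs _) (nbhs _)).
          by apply: (continuous_comp (f := fst) (g := fst));
            [exact: cvg_fst|exact: cvg_fst].
        by apply: (continuous_comp (f := snd) (g := fst));
          [exact: cvg_snd|exact: cvg_fst].
      exact: mG.
    apply: (continuous_comp (f := fun p => (p.1.2, p.2.2))
                            (g := fun p : H * H => (p.1 * p.2)%g)).
      apply: (@cvg_pair _ _ _ (nbhs x) (nbhs _) (nbhs _)).
        by apply: (continuous_comp (f := fst) (g := snd));
          [exact: cvg_fst|exact: cvg_snd].
      by apply: (continuous_comp (f := snd) (g := snd));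
        [exact: cvg_snd|exact: cvg_snd].
    exact: mH.
  split=> [x _|_ e' [[_ _] [/= [[c1 d1] [/= Gc1 Hd1] <-]
                               [[c2 d2] [/= Gc2 Hd2] <-]] <-]].
    exact: cm.
  move=> [[e f] [/= Ge Hf] <-].
  set W := image _ _.
  have oW : open W.
    rewrite /W setTI (setIC (chart_dom (prod_chart (prod_chart c1 d1) (prod_chart c2 d2)))); apply: open_chart_image.
      case: aGH2 => + _ _; apply; eexists (prod_chart c1 d1, prod_chart c2 d2) => //.
      by split; [exists (c1, d1)|exists (c2, d2)].
    apply: open_comp => [x _|]; first exact: cm.
    case: aGH => + _ _ => /(_ (prod_chart e f)) [] //.
    by exists (e, f).
  apply: smooth_row_mx.
    have A : prod_atlas (lie_atlas G) (lie_atlas G) (prod_chart c1 c2).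
      by exists (c1, c2).
    have S : smooth_on W (fun z => row_mx (lsubmx (lsubmx z)) (lsubmx (rsubmx z))).
      apply: smooth_row_mx.
        exact: (smooth_on_comp oW (fun _ _ => I) (smooth_lsubmx W)
                               (@smooth_lsubmx _ _ _ setT)).
      exact: (smooth_on_comp oW (fun _ _ => I) (smooth_rsubmx W)
                             (@smooth_lsubmx _ _ _ setT)).
    apply: smooth_on_eq oW _ (smooth_on_comp oW _ S (MG (prod_chart c1 c2) e A Ge)).
      by move=> z _; rewrite /= row_mxKl row_mxKr.
    move=> _ [[[x1 y1] [x2 y2]] [[_ [[/= ? ?] [/= ? ?]]] [/= ? ?]] <-].
    by rewrite !(row_mxKl, row_mxKr); exists (x1, x2).
  have A : prod_atlas (lie_atlas H) (lie_atlas H) (prod_chart d1 d2).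
    by exists (d1, d2).
  have S : smooth_on W (fun z => row_mx (rsubmx (lsubmx z)) (rsubmx (rsubmx z))).
    apply: smooth_row_mx.
      exact: (smooth_on_comp oW (fun _ _ => I) (smooth_lsubmx W)
                             (@smooth_rsubmx _ _ _ setT)).
    exact: (smooth_on_comp oW (fun _ _ => I) (smooth_rsubmx W)
                           (@smooth_rsubmx _ _ _ setT)).
  apply: smooth_on_eq oW _ (smooth_on_comp oW _ S (MH (prod_chart d1 d2) f A Hf)).
    by move=> z _; rewrite /= row_mxKl row_mxKr.
  move=> _ [[[x1 y1] [x2 y2]] [[_ [[/= ? ?] [/= ? ?]]] [/= ? ?]] <-].
  by rewrite !(row_mxKl, row_mxKr); exists (y1, y2).
- have cv (x : G * H) : {for x, continuous (fun p : G * H => (p^-1)%g)}.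
    apply: (@cvg_pair _ _ _ (nbhs x) (nbhs _) (nbhs _)).
      by apply: (continuous_comp (f := fst) (g := fun p : G => (p^-1)%g));
        [exact: cvg_fst|exact: iG].
    by apply: (continuous_comp (f := snd) (g := fun p : H => (p^-1)%g));
      [exact: cvg_snd|exact: iH].
  split=> [x _|_ _ [[c d] [/= Gc Hd] <-] [[e f] [/= Ge Hf] <-]]; first exact: cv.
  set W := image _ _.
  have oW : open W.
    rewrite /W setTI (setIC (chart_dom (prod_chart c d))); apply: open_chart_image.
      by case: aGH => + _ _; apply; exists (c, d).
    apply: open_comp => [x _|]; first exact: cv.
    case: aGH => + _ _ => /(_ (prod_chart e f)) [] //.
    by exists (e, f).
  apply: smooth_row_mx.
    apply: (smooth_on_comp oW) (smooth_lsubmx W) (IG _ _ Gc Ge).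
    move=> _ [[x y] [[_ [/= ? ?]] [/= ? ?]] <-].
    by rewrite /= row_mxKl; exists x.
  apply: (smooth_on_comp oW) (smooth_rsubmx W) (IH _ _ Hd Hf).
  move=> _ [[x y] [[_ [/= ? ?]] [/= ? ?]] <-].
  by rewrite /= row_mxKr; exists y.
Qed.

Definition prod_lieGroup : lieGroup R (m + n) := LieGroup prod_lie_axioms.

End ProductLieGroup.

Section Quaternions.
Context {R : realType}.
Implicit Types p q : 'rV[R]_4.

Definition quat (a b c d : R) : 'rV[R]_4 := \row_(i < 4) [:: a; b; c; d]`_i.

Definition qmul p q : 'rV[R]_4 :=
  quat (p 0 0 * q 0 0 - p 0 1 * q 0 1 - p 0 2 * q 0 2 - p 0 3 * q 0 3)
       (p 0 0 * q 0 1 + p 0 1 * q 0 0 + p 0 2 * q 0 3 - p 0 3 * q 0 2)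
       (p 0 0 * q 0 2 - p 0 1 * q 0 3 + p 0 2 * q 0 0 + p 0 3 * q 0 1)
       (p 0 0 * q 0 3 + p 0 1 * q 0 2 - p 0 2 * q 0 1 + p 0 3 * q 0 0).

Definition qconj q : 'rV[R]_4 := quat (q 0 0) (- q 0 1) (- q 0 2) (- q 0 3).

Definition unit_quat : set 'rV[R]_4 := [set q | \sum_i q 0 i ^+ 2 = 1].

Lemma quat0 a b c d : quat a b c d 0 0 = a. Proof. by rewrite mxE. Qed.
Lemma quat1 a b c d : quat a b c d 0 1 = b. Proof. by rewrite mxE. Qed.
Lemma quat2 a b c d : quat a b c d 0 2 = c. Proof. by rewrite mxE. Qed.
Lemma quat3 a b c d : quat a b c d 0 3 = d. Proof. by rewrite mxE. Qed.
Definition quatE := (quat0, quat1, quat2, quat3).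

Lemma forall_ord4 (P : 'I_4 -> Prop) : P 0 -> P 1 -> P 2 -> P 3 -> forall i, P i.
Proof.
move=> P0 P1 P2 P3 [[|[|[|[|//]]]] lti].
- by rewrite (_ : Ordinal lti = 0) //; apply: val_inj.
- by rewrite (_ : Ordinal lti = 1) //; apply: val_inj.
- by rewrite (_ : Ordinal lti = 2) //; apply: val_inj.
- by rewrite (_ : Ordinal lti = 3) //; apply: val_inj.
Qed.

Lemma sum_ord4 (F : 'I_4 -> R) : \sum_i F i = F 0 + F 1 + F 2 + F 3.
Proof.
rewrite !big_ord_recr /= big_ord0 add0r.
by do !congr (_ + _); congr F; apply: val_inj.
Qed.

Lemma unit_quatE q : unit_quat q ->
  q 0 0 ^+ 2 + q 0 1 ^+ 2 + q 0 2 ^+ 2 + q 0 3 ^+ 2 = 1.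
Proof. by rewrite /unit_quat /= sum_ord4. Qed.

Lemma unit_quat1 : unit_quat (quat 1 0 0 0).
Proof. by rewrite /unit_quat /= sum_ord4 !quatE; ring. Qed.

Lemma unit_quatM p q : unit_quat p -> unit_quat q -> unit_quat (qmul p q).
Proof.
move=> /unit_quatE hp /unit_quatE hq.
rewrite /unit_quat /= sum_ord4 !quatE.
by have := congr2 *%R hp hq; rewrite mulr1 => <-; ring.
Qed.

Lemma unit_quatV p : unit_quat p -> unit_quat (qconj p).
Proof. by move=> /unit_quatE hp; rewrite /unit_quat /= sum_ord4 !quatE !sqrrN. Qed.

End Quaternions.
Arguments unit_quat : clear implicits.

(* The carrier has the topology induced by R^4. *)
Definition S3 (R : realType) : Type := set_type (unit_quat R).

Section SphereGroup.
Context {R : realType}.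
HB.instance Definition _ := Topological.on (S3 R).

Lemma S3P (x : S3 R) : unit_quat R (val x).
Proof. exact: set_mem (valP x). Qed.

Definition S3mk (q : 'rV[R]_4) (h : unit_quat R q) : S3 R :=
  exist _ q (mem_set h).

Definition S3one : S3 R := S3mk unit_quat1.
Definition S3mul (x y : S3 R) : S3 R := S3mk (unit_quatM (S3P x) (S3P y)).
Definition S3inv (x : S3 R) : S3 R := S3mk (unit_quatV (S3P x)).

Fact S3mulA : associative S3mul.
Proof.
move=> x y z; apply/val_inj/rowP; apply: forall_ord4; rewrite /= !quatE; ring.
Qed.
Fact S3mul1 : left_id S3one S3mul.
Proof.
move=> x; apply/val_inj/rowP; apply: forall_ord4; rewrite /= !quatE; ring.
Qed.
Fact S3mulr1 : right_id S3one S3mul.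
Proof.
move=> x; apply/val_inj/rowP; apply: forall_ord4; rewrite /= !quatE; ring.
Qed.
Fact S3mulV : left_inverse S3one S3inv S3mul.
Proof.
move=> x; have := unit_quatE (S3P x) => hx.
by apply/val_inj/rowP; apply: forall_ord4; rewrite /= !quatE -?[in RHS]hx; ring.
Qed.
Fact S3mulrV : right_inverse S3one S3inv S3mul.
Proof.
move=> x; have := unit_quatE (S3P x) => hx.
by apply/val_inj/rowP; apply: forall_ord4; rewrite /= !quatE -?[in RHS]hx; ring.
Qed.

HB.instance Definition _ :=
  isGroup.Build (S3 R) S3mulA S3mul1 S3mulr1 S3mulV S3mulrV.

(* Stereographic projection from (-1) ^+ b, and its inverse. *)
Definition stereo (b : bool) (q : 'rV[R]_4) : 'rV[R]_3 :=
  \row_(i < 3) (q 0 (lift 0 i) / (1 - (-1) ^+ b * q 0 0)).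

Definition stereo_inv (b : bool) (y : 'rV[R]_3) : 'rV[R]_4 :=
  let r := \sum_i y 0 i ^+ 2 in
  quat ((-1) ^+ b * ((r - 1) / (r + 1)))
       (2 * y 0 0 / (r + 1)) (2 * y 0 1 / (r + 1)) (2 * y 0 2 / (r + 1)).

End SphereGroup.

Section SphereLie.
Context {R : realType}.
Implicit Types (b : bool) (q : 'rV[R]_4).

Lemma sum_ord3 (F : 'I_3 -> R) : \sum_i F i = F 0 + F 1 + F 2.
Proof.
rewrite !big_ord_recr /= big_ord0 add0r.
by do !congr (_ + _); congr F; apply: val_inj.
Qed.

Lemma forall_ord3 (P : 'I_3 -> Prop) : P 0 -> P 1 -> P 2 -> forall i, P i.
Proof.
move=> P0 P1 P2 [[|[|[|//]]] lti].
- by rewrite (_ : Ordinal lti = 0) //; apply: val_inj.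
- by rewrite (_ : Ordinal lti = 1) //; apply: val_inj.
- by rewrite (_ : Ordinal lti = 2) //; apply: val_inj.
Qed.

Lemma lift3E : ((lift 0 (0 : 'I_3) = 1 :> 'I_4) * (lift 0 (1 : 'I_3) = 2 :> 'I_4)
  * (lift 0 (2 : 'I_3) = 3 :> 'I_4))%type.
Proof. by do !split; apply: val_inj. Qed.

Lemma sumsq_neq0 n (y : 'rV[R]_n) : \sum_i y 0 i ^+ 2 + 1 != 0.
Proof.
by rewrite gt_eqF// ltr_wpDl// sumr_ge0// => i _; exact: sqr_ge0.
Qed.

Lemma stereo_inv_unit b y : unit_quat R (stereo_inv b y).
Proof.
have := sumsq_neq0 y; rewrite /unit_quat /= sum_ord4 !quatE sum_ord3 => y0.
by case: b; rewrite ?expr1 ?expr0; field.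
Qed.

Lemma stereo_invK b (y : 'rV[R]_3) : stereo b (stereo_inv b y) = y.
Proof.
have := sumsq_neq0 y; rewrite sum_ord3 => y0.
apply/rowP; apply: forall_ord3; rewrite mxE !lift3E /stereo_inv !quatE sum_ord3;
  case: b; rewrite ?expr1 ?expr0; field; rewrite y0 /=;
  by apply/eqP => h; move: (@pnatr_eq0 R 2); rewrite -[X in X == _]subr0 -h opprD !addrA; lra.
Qed.

Lemma stereo_den b (q : 'rV[R]_4) :
  (1 - (-1) ^+ b * q 0 0 != 0) = (q 0 0 != (-1) ^+ b).
Proof.
congr (~~ _); apply/eqP/eqP; case: b; rewrite /= ?expr1 ?expr0 => h; lra.
Qed.

Lemma stereoK b q : unit_quat R q -> q 0 0 != (-1) ^+ b ->
  stereo_inv b (stereo b q) = q.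
Proof.
move=> /unit_quatE hq; rewrite -stereo_den => q0.
have hq3 : q 0 3 ^+ 2 = 1 - q 0 0 ^+ 2 - q 0 1 ^+ 2 - q 0 2 ^+ 2 by lra.
have E : \sum_i stereo b q 0 i ^+ 2 = 2 / (1 - (-1) ^+ b * q 0 0) - 1.
  rewrite sum_ord3 !mxE !lift3E !expr_div_n hq3.
  by case: b q0; rewrite /= ?expr1 ?expr0 ?mul1r => q0; field.
have E1 : \sum_i stereo b q 0 i ^+ 2 + 1 = 2 / (1 - (-1) ^+ b * q 0 0).
  by rewrite E subrK.
apply/rowP; apply: forall_ord4; rewrite /stereo_inv !quatE E1 ?E ?mxE ?lift3E;
  case: b q0 {E E1}; rewrite /= ?expr1 ?expr0 ?mul1r => q0; field; rewrite ?q0 //.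
Qed.

Lemma stereo_inv_dom b (y : 'rV[R]_3) : stereo_inv b y 0 0 != (-1) ^+ b.
Proof.
have := sumsq_neq0 y; rewrite /stereo_inv quat0; set r := \sum_i _ => y0.
rewrite -subr_eq0 (_ : _ - _ = (-1) ^+ b * (- 2 / (r + 1))); last by field.
by rewrite !mulf_neq0 ?signr_eq0 ?invr_eq0 ?oppr_eq0.
Qed.

Definition S3_chart (b : bool) : chart R 3 (S3 R) :=
  Chart [set x : S3 R | val x 0 0 != (-1) ^+ b]
        (fun x : S3 R => stereo b (val x))
        (fun y => S3mk (stereo_inv_unit b y)).

Definition S3_atlas : set (chart R 3 (S3 R)) := range S3_chart.

Lemma open_stereo_dom b : open [set q : 'rV[R]_4 | q 0 0 != (-1) ^+ b].
Proof.
apply: (@open_comp _ _ (fun q : 'rV[R]_4 => q 0 0) [set x | x != (-1) ^+ b]).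
  by move=> x _; exact: coord_continuous.
exact: open_neq.
Qed.

Lemma Ck_quat k m (U : set 'rV[R]_m) (a b c d : 'rV[R]_m -> R) :
  Ck k U a -> Ck k U b -> Ck k U c -> Ck k U d ->
  forall i, Ck k U (fun x => quat (a x) (b x) (c x) (d x) 0 i).
Proof.
move=> Ca Cb Cc Cd; apply: forall_ord4.
- by rewrite (_ : (fun x => _) = a) //; apply/funext => x; rewrite quat0.
- by rewrite (_ : (fun x => _) = b) //; apply/funext => x; rewrite quat1.
- by rewrite (_ : (fun x => _) = c) //; apply/funext => x; rewrite quat2.
- by rewrite (_ : (fun x => _) = d) //; apply/funext => x; rewrite quat3.
Qed.

Lemma smooth_stereo b :
  smooth_on [set q | q 0 0 != (-1) ^+ b] (@stereo R b).
Proof.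
move=> k i; have C1 : Ck k [set q : 'rV[R]_4 | q 0 0 != (-1) ^+ b]
    (fun q => 1 - (-1) ^+ b * q 0 0).
  apply: CkD (Ck_cst _ _ _) _; first exact: open_stereo_dom.
  apply: CkN; first exact: open_stereo_dom.
  apply: CkM (Ck_cst _ _ _) (Ck_coord _ _ _); exact: open_stereo_dom.
rewrite (_ : (fun x => _) =
    fun q : 'rV[R]_4 => q 0 (lift 0 i) * (1 - (-1) ^+ b * q 0 0)^-1).
  apply: CkM (Ck_coord _ _ _) _; first exact: open_stereo_dom.
  apply: CkV C1; first exact: open_stereo_dom.
  by move=> q /=; rewrite stereo_den.
by apply/funext => q; rewrite mxE.
Qed.

Lemma smooth_stereo_inv b : smooth_on setT (@stereo_inv R b).
Proof.
move=> k; have oT : open [set: 'rV[R]_3] by exact: openT.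
have Cr : Ck k setT (fun y : 'rV[R]_3 => \sum_i y 0 i ^+ 2).
  apply: Ck_sum => // i.
  exact: (CkM oT (Ck_coord _ _ _) (Ck_coord _ _ _)).
have Ci : Ck k setT (fun y : 'rV[R]_3 => (\sum_i y 0 i ^+ 2 + 1)^-1).
  apply: CkV => //; first by move=> y _; exact: sumsq_neq0.
  exact: (CkD oT Cr (Ck_cst _ _ _)).
have Cj j : Ck k setT (fun y : 'rV[R]_3 => 2 * y 0 j / (\sum_i y 0 i ^+ 2 + 1)).
  exact: (CkM oT (CkM oT (Ck_cst _ _ _) (Ck_coord _ _ _)) Ci).
apply: Ck_quat; [|exact: Cj|exact: Cj|exact: Cj].
exact: (CkM oT (Ck_cst _ _ _) (CkM oT (CkD oT Cr (Ck_cst _ _ _)) Ci)).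
Qed.

Lemma smooth_qmul : smooth_on setT
  (fun z : 'rV[R]_(4 + 4) => qmul (lsubmx z) (rsubmx z)).
Proof.
move=> k; have oT : open [set: 'rV[R]_(4 + 4)] by exact: openT.
have M i j : Ck k setT (fun z : 'rV[R]_(4 + 4) => lsubmx z 0 i * rsubmx z 0 j).
  exact: (CkM oT (@smooth_lsubmx _ 4 4 setT k i) (@smooth_rsubmx _ 4 4 setT k j)).
by apply: Ck_quat; repeat first [exact: M | apply: (CkD oT) | apply: (CkN oT)].
Qed.

Lemma smooth_qconj : smooth_on setT (@qconj R).
Proof.
move=> k; have oT : open [set: 'rV[R]_4] by exact: openT.
by apply: Ck_quat; first exact: Ck_coord; apply: (CkN oT); exact: Ck_coord.
Qed.

Lemma continuous_val : continuous (val : S3 R -> 'rV[R]_4).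
Proof. exact: initial_continuous. Qed.

Lemma continuous_S3 (T : topologicalType) (f : T -> S3 R) x :
  {for x, continuous (fun y => val (f y))} -> {for x, continuous f}.
Proof.
move=> cf A /= [_ [[B oB <-] /= Bfs sBA]].
by apply: filterS sBA _; apply: (cf B); exact: open_nbhs_nbhs.
Qed.

Lemma S3_hausdorff : hausdorff_space (S3 R).
Proof.
move=> x y h; apply/val_inj/norm_hausdorff => A B nA nB.
have [z [Az Bz]] := h _ _ (continuous_val nA) (continuous_val nB).
by exists (val z).
Qed.

HB.instance Definition _ := isPointed.Build (S3 R) S3one.
HB.instance Definition _ := PseudoMetric.on (S3 R).

Lemma compact_unit_quat : compact (unit_quat R).
Proof.
apply: bounded_closed_compact.
  exists 1; split; first exact: num_real.
  move=> M M1 q /= hq; rewrite /Num.Def.normr /= mx_normrE.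
  apply: bigmax_le => [|[i j] _]; first by rewrite (le_trans _ (ltW M1)).
  rewrite (le_trans _ (ltW M1))//= ord1 -(@ler_pXn2r _ 2)// ?nnegrE//.
  rewrite expr1n real_normK ?num_real// -hq (bigD1 j)//= lerDl.
  by apply: sumr_ge0 => ? _; exact: sqr_ge0.
have -> : unit_quat R = (fun q : 'rV[R]_4 => \sum_i q 0 i ^+ 2) @^-1` [set 1].
  by [].
apply: preimage_closed; last exact/accessible_closed_set1/hausdorff_accessible/Rhausdorff.
move=> q; have oT : open [set: 'rV[R]_4] by exact: openT.
have C : Ck 0 setT (fun q : 'rV[R]_4 => \sum_i q 0 i ^+ 2).
  apply: Ck_sum => // i.
  exact: (CkM oT (Ck_coord _ _ _) (Ck_coord _ _ _)).
by move=> _; exact: (C q I).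
Qed.

Lemma S3_second_countable : @second_countable (S3 R).
Proof.
apply: compact_second_countable => F FF FT.
pose v := val : S3 R -> 'rV[R]_4.
have FS : (v @ F) (unit_quat R).
  have H : F (v @^-1` unit_quat R).
    by apply: (@filterS _ F _ setT) FT => x _; exact: S3P.
  exact: H.
have [p [up cp]] := @compact_unit_quat (v @ F) _ FS.
exists (S3mk up); split=> // A B FA [_ [[C oC <-] /= Cp CB]].
have FA' : (v @ F) (v @` A).
  have H : F (v @^-1` (v @` A)) by apply: (@filterS _ F _ A) FA => z Az; exists z.
  exact: H.
have [_ [[z Az <-] Cz]] := cp _ C FA' (open_nbhs_nbhs (conj oC Cp)).
by exists z; split => //; exact: CB.
Qed.

Lemma S3_chartP b : is_chart (S3_chart b).
Proof.
have imgT : chart_img (S3_chart b) = setT.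
  apply/seteqP; split=> // y _; exists (S3mk (stereo_inv_unit b y)).
    exact: stereo_inv_dom.
  exact: stereo_invK.
split.
- apply: (@open_comp (S3 R) 'rV[R]_4 val [set q | q 0 0 != (-1) ^+ b]).
    by move=> x _; exact: continuous_val.
  exact: open_stereo_dom.
- by rewrite imgT; exact: openT.
- by move=> x dx; apply: val_inj => /=; rewrite stereoK//; exact: S3P.
- move=> x dx; apply: (@continuous_comp (S3 R) 'rV[R]_4 'rV[R]_3 val (stereo b)).
    exact: continuous_val.
  exact: (smooth_on_continuous (smooth_stereo b) dx).
- move=> y _; apply: continuous_S3.
  exact: (smooth_on_continuous (smooth_stereo_inv b)).
Qed.

Lemma S3_atlasP : is_atlas S3_atlas.
Proof.
split.
- by move=> _ [b _ <-]; exact: S3_chartP.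
- move=> x; have [h|h] := eqVneq (val x 0 0) 1.
    exists (S3_chart true); first by exists true.
    by rewrite /= h expr1; apply/eqP => ?; lra.
  by exists (S3_chart false) => //; exists false.
- move=> _ _ [b _ <-] [b' _ <-].
  set W := image _ _.
  have oW : open W.
    rewrite /W (setIC (chart_dom _)); apply: open_chart_image.
      exact: S3_chartP.
    by case: (S3_chartP b').
  apply: (smooth_on_comp oW) (smooth_on_sub _ (smooth_stereo_inv b)) (smooth_stereo b').
    by move=> _ [x [/= dx dx'] <-]; rewrite stereoK//; exact: S3P.
  by [].
Qed.

Lemma S3_lie_axioms : is_lie_group S3_atlas.
Proof.
have aS := S3_atlasP; have aS2 := prod_atlasP aS aS.
have cm (x : S3 R * S3 R) : {for x, continuous (fun p : S3 R * S3 R => (p.1 * p.2)%g)}.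
  apply: continuous_S3.
  rewrite (_ : (fun y => _) =
      (fun z : 'rV[R]_(4 + 4) => qmul (lsubmx z) (rsubmx z)) \o
      (fun p : S3 R * S3 R => row_mx (val p.1) (val p.2))); last first.
    by apply/funext => p /=; rewrite row_mxKl row_mxKr.
  apply: continuous_comp; last exact: (smooth_on_continuous smooth_qmul).
  apply: continuous_rV => i; case: (split_ordP i) => j ->.
    rewrite (_ : (fun x => _) =
        (fun q : 'rV[R]_4 => q 0 j) \o (val \o fst)); last first.
      by apply/funext => z /=; rewrite row_mxEl.
    apply: continuous_comp; last exact: coord_continuous.
    apply: (continuous_comp (f := fst)); first exact: cvg_fst.
    exact: continuous_val.
  rewrite (_ : (fun x => _) =
      (fun q : 'rV[R]_4 => q 0 j) \o (val \o snd)); last first.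
    by apply/funext => z /=; rewrite row_mxEr.
  apply: continuous_comp; last exact: coord_continuous.
  apply: (continuous_comp (f := snd)); first exact: cvg_snd.
  exact: continuous_val.
have cv (x : S3 R) : {for x, continuous (fun p : S3 R => (p^-1)%g)}.
  apply: continuous_S3.
  apply: (@continuous_comp (S3 R) 'rV[R]_4 'rV[R]_4 val (@qconj R)).
    exact: continuous_val.
  exact: (smooth_on_continuous smooth_qconj).
split.
- exact: aS.
- exact: S3_hausdorff.
- exact: S3_second_countable.
- split=> [x _|_ _ [[_ _] [/= [b1 _ <-] [b2 _ <-]] <-] [b _ <-]]; first exact: cm.
  set W := image _ _.
  have oW : open W.
    rewrite /W setTI (setIC (chart_dom (prod_chart (S3_chart b1) (S3_chart b2)))).
    apply: open_chart_image; first by apply: prod_chartP; exact: S3_chartP.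
    by apply: open_comp => [x _|]; [exact: cm|case: (S3_chartP b)].
  have S : smooth_on W (fun z : 'rV[R]_(3 + 3) =>
      row_mx (stereo_inv b1 (lsubmx z)) (stereo_inv b2 (rsubmx z))).
    apply: smooth_row_mx.
      exact: (smooth_on_comp oW (fun _ _ => I) (smooth_lsubmx W) (smooth_stereo_inv b1)).
    exact: (smooth_on_comp oW (fun _ _ => I) (smooth_rsubmx W) (smooth_stereo_inv b2)).
  have S' := smooth_on_comp oW (fun _ _ => I) S smooth_qmul.
  apply: smooth_on_eq oW _ (smooth_on_comp oW _ S' (smooth_stereo b)).
    by move=> z _; rewrite /= row_mxKl row_mxKr.
  move=> _ [[x y] [[_ [/= dx dy]] dxy] <-] /=.
  by rewrite !(row_mxKl, row_mxKr) !stereoK//; exact: S3P.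
- split=> [x _|_ _ [b _ <-] [b' _ <-]]; first exact: cv.
  set W := image _ _.
  have oW : open W.
    rewrite /W setTI (setIC (chart_dom (S3_chart b))).
    apply: open_chart_image; first exact: S3_chartP.
    by apply: open_comp => [x _|]; [exact: cv|case: (S3_chartP b')].
  have S : smooth_on W (@stereo_inv R b).
    by apply: smooth_on_sub (smooth_stereo_inv b).
  have S' := smooth_on_comp oW (fun _ _ => I) S smooth_qconj.
  apply: smooth_on_eq oW _ (smooth_on_comp oW _ S' (smooth_stereo b')) => //.
  move=> _ [x [[_ /= dx] dxy] <-] /=.
  by rewrite stereoK//; exact: S3P.
Qed.

Definition S3_lieGroup : lieGroup R 3 := LieGroup S3_lie_axioms.

End SphereLie.
Definition S3xS3 R := prod_lieGroup (@S3_lieGroup R) (@S3_lieGroup R).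

(* Main.v *)
From HB Require Import structures.
Require Import Defs.
From mathcomp Require Import all_boot all_order all_algebra monoid.
From mathcomp Require Import all_classical all_reals all_analysis.
From mathcomp Require Import ring lra.
Set Implicit Arguments.
Unset Strict Implicit.
Unset Printing Implicit Defensive.
Import Order.TTheory GRing.Theory Num.Theory.
Import numFieldNormedType.Exports.
Local Open Scope classical_set_scope.
Local Open Scope ring_scope.

(* The Lie algebra of G(a1, a2, 0, 0) is so(3) + so(3): with b = 2 a1, b' = 2 a2,
   r = sqrt (b^2 + b'^2) and s = 1 or -1, the forms X = A2 + s r e5,
   Y = r e1 + s (b e4 - b' e3), Z = r e2 + s (b e3 + b' e4) satisfy
   dX = - Y /\ Z, dY = - Z /\ X, dZ = - X /\ Y.  Since this Lie algebra has
   trivial centre, the adjoint representation integrates the isomorphism without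
   solving any differential equation: Ad preserves the bracket, so near the
   identity it is block diagonal with two blocks in SO(3), and each block lifts
   smoothly and multiplicatively to the unit quaternion of positive real part
   that it comes from.  The differential of the resulting local homomorphism
   G -> S^3 x S^3 at the identity is ad, which is injective, and the inverse
   function theorem concludes. *)

(** * Mixed partial derivatives *)

(** The structure equations contain no term A2 /\ e5, so the vectors dual to [A2] and [e5] commute
    and span a Cartan subalgebra; the two forms X are its coordinates adapted to the factors. With
    a3 = a4 = 0 the coefficient of dA2 is - (b^2 + b'^2), so r is the scale that normalises the
    equations, and r != 0 keeps the two triples independent.

    The structure equations concern exterior derivatives, Ad concerns conjugation. They are linked
    through mixed second derivatives of the multiplication, which cancel by Schwarz's theorem.

    Two ambiguities are removed near the identity. An automorphism of so(3) + so(3) may exchange the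
    factors: invertible diagonal blocks exclude this. A rotation comes from both q and -q: the bound
    3 < 1 + tr makes the real part of each lift exceed sqrt 3 / 2, so a product of two lifts still
    has positive real part and is the lift of the product. *)

Section MeanValue.
Context {R : realType}.

Lemma is_derive_line (V : normedModType R) (g : V -> R) (p u : V) (t : R) :
  differentiable g (p + t *: u) ->
  is_derive t 1 (fun s : R => g (p + s *: u)) ('d g (p + t *: u) u).
Proof.
move=> dg.
have dl : is_diff t (fun s : R => p + s *: u) (fun s => s *: u).
  have h : is_diff t (cst p + *:%R^~ u) (0 + *:%R^~ u) by exact: is_diffD.
  by rewrite add0r in h.
have dl' := @ex_diff _ _ _ _ _ _ _ dl.
have dc : differentiable (g \o (fun s : R => p + s *: u)) t.
  exact: differentiable_comp.
split; first exact/derivable1_diffP.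
rewrite deriveE// diff_comp//=.
by rewrite diff_val scale1r.
Qed.

Lemma mean_value_line (V : normedModType R) (g : V -> R) (p u : V) (s : R) :
  0 <= s -> (forall t, 0 <= t <= s -> differentiable g (p + t *: u)) ->
  exists2 t, 0 <= t <= s & g (p + s *: u) - g p = 'd g (p + t *: u) u * s.
Proof.
move=> s0 dg.
have dl t : 0 <= t <= s -> is_derive t 1 (fun s : R => g (p + s *: u)) ('d g (p + t *: u) u).
  by move=> ts; apply/is_derive_line/dg.
have [||c cs] := @MVT_segment R (fun t : R => g (p + t *: u))
    (fun t => 'd g (p + t *: u) u) 0 s s0.
- by move=> x /[!in_itv]/= /andP[x0 xs]; apply: dl; rewrite !ltW.
- apply: derivable_within_continuous => x; rewrite in_itv/= => xs.
  by have := dl x xs => -[].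
- rewrite scale0r addr0 subr0 => E.
  by exists c => //; move: cs; rewrite in_itv.
Qed.

Lemma mean_value_segment (V : normedModType R) (g : V -> R) (x y : V) :
  (forall t, 0 <= t <= 1 -> differentiable g (x + t *: (y - x))) ->
  exists2 t, 0 <= t <= 1 &
    g y - g x = 'd g (x + t *: (y - x)) (y - x).
Proof.
move=> /(mean_value_line ler01) [t t01]; rewrite scale1r mulr1 [x + (y - x)]addrC subrK => E.
by exists t.
Qed.

Lemma near_box (V : normedModType R) (a u v : V) (N : set V) :
  nbhs a N -> exists2 s : R, 0 < s &
    forall t1 t2, 0 <= t1 <= s -> 0 <= t2 <= s -> N (a + t1 *: u + t2 *: v).
Proof.
move=> /nbhs_ballP[e /= e0 aN].
(* The summand 1 covers u = v = 0 and makes the last inequality strict. *)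
have D : 0 < `|u| + `|v| + 1 by rewrite ltr_wpDl// addr_ge0.
exists (e / (`|u| + `|v| + 1)); first exact: divr_gt0.
move=> t1 t2 /andP[t10 t1s] /andP[t20 t2s]; apply: aN.
rewrite -ball_normE /= -addrA opprD addrA subrr add0r normrN.
apply: (le_lt_trans (ler_normD _ _)); rewrite !normrZ !ger0_norm//.
apply: (@le_lt_trans _ _ (e / (`|u| + `|v| + 1) * (`|u| + `|v|))).
  by rewrite mulrDr lerD// ler_wpM2r.
by rewrite mulrAC ltr_pdivrMr// ltr_pM2l// ltrDl.
Qed.

Lemma is_diff_translate (V W : normedModType R) (g : V -> W) (x c : V) :
  differentiable g (x + c) -> is_diff x (fun y => g (y + c)) ('d g (x + c)).
Proof.
move=> dg; have h : is_diff x (id + cst c : V -> V) (id + 0) by exact: is_diffD.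
have dsh : differentiable (shift c) x := @ex_diff _ _ _ _ _ _ _ h.
have vsh := @diff_val _ _ _ _ _ _ _ h.
have dc : differentiable (g \o shift c) x by exact: differentiable_comp.
split; first exact: dc.
apply: etrans (diff_comp dsh dg) _.
by apply/funext => v; rewrite /= [X in 'd g _ X](_ : _ = v)// [LHS](congr1 (@^~ v) vsh) /= addr0.
Qed.

(** [Ck k.+1] speaks of [fun x => 'd f x v], which is [pd v f] by conversion; the name allows
    iteration. *)
Definition pd n (v : 'rV[R]_n) (f : 'rV[R]_n -> R) (x : 'rV[R]_n) : R := 'd f x v.

(** The mean value theorem twice: in direction u for f(x + s v) - f(x), then in direction v for
    [pd u f]. *)
Lemma second_difference n (U : set 'rV[R]_n) (f : 'rV[R]_n -> R)
    (a u v : 'rV[R]_n) (s : R) :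
  open U -> Ck 2 U f -> 0 <= s ->
  (forall t1 t2 : R, 0 <= t1 <= s -> 0 <= t2 <= s -> U (a + t1 *: u + t2 *: v)) ->
  exists t1 t2, [/\ 0 <= t1 <= s, 0 <= t2 <= s &
    f (a + s *: u + s *: v) - f (a + s *: u) - f (a + s *: v) + f a =
    pd v (pd u f) (a + t1 *: u + t2 *: v) * s ^+ 2].
Proof.
move=> oU [df /(_ u)[ddf _]] s0 box.
have s0s : 0 <= s <= s by rewrite s0 lexx.
have z0s : 0 <= (0 : R) <= s by rewrite lexx.
pose g (x : 'rV[R]_n) : R := f (x + s *: v) - f x.
have dg (t : R) : 0 <= t <= s -> differentiable g (a + t *: u) /\
    pd u g (a + t *: u) = pd u f (a + t *: u + s *: v) - pd u f (a + t *: u).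
  move=> ts; have d0 : differentiable f (a + t *: u).
    by apply: df; have := box t 0 ts z0s; rewrite scale0r addr0.
  have d1 : differentiable f (a + t *: u + s *: v) by exact/df/box.
  have h := @is_diffB _ _ _ _ _ _ _ _ (is_diff_translate d1) (differentiableP d0).
  split; first exact: (@ex_diff _ _ _ _ _ _ _ h).
  exact: (congr1 (fun h : 'rV[R]_n -> R => h u) (@diff_val _ _ _ _ _ _ _ h)).
have [|t1 t1s] := @mean_value_line _ g a u s s0.
  by move=> t /dg[].
rewrite -/(pd u g _) (dg _ t1s).2 /g => E1.
have [|t2 t2s E2] := @mean_value_line _ (pd u f) (a + t1 *: u) v s s0.
  by move=> t ts; apply/ddf/box.
exists t1, t2; split => //; rewrite expr2 mulrA /pd -E2 -E1; ring.
Qed.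

(* Schwarz's theorem: both mixed derivatives are limits of the same second
   difference quotient. *)
Lemma pdC n (U : set 'rV[R]_n) (f : 'rV[R]_n -> R) (a u v : 'rV[R]_n) :
  open U -> Ck 2 U f -> U a -> pd v (pd u f) a = pd u (pd v f) a.
Proof.
move=> oU Cf Ua; apply/eqP; rewrite -subr_eq0 -normr_le0; apply/ler_addgt0Pl => e e0.
have c1 : {for a, continuous (pd v (pd u f))} by exact: ((Cf.2 u).2 v).
have c2 : {for a, continuous (pd u (pd v f))} by exact: ((Cf.2 v).2 u).
have nU : nbhs a U by exact: open_nbhs_nbhs.
have e2 : 0 < e / 2 by rewrite divr_gt0.
have n1 := iffLR (cvgrPdist_lt _ _) c1 _ e2.
have n2 := iffLR (cvgrPdist_lt _ _) c2 _ e2.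
have [s s0 box] := near_box u v (filterI nU (filterI (n1 _) (n2 _))).
have box' (t1 t2 : R) : 0 <= t1 <= s -> 0 <= t2 <= s -> U (a + t1 *: v + t2 *: u).
  by move=> h1 h2; rewrite addrAC; case: (box t2 t1 h2 h1).
have box1 (t1 t2 : R) : 0 <= t1 <= s -> 0 <= t2 <= s -> U (a + t1 *: u + t2 *: v).
  by move=> h1 h2; case: (box t1 t2 h1 h2).
have [t1 [t2 [h1 h2 E1]]] := second_difference oU Cf (ltW s0) box1.
have [t3 [t4 [h3 h4 E2]]] := second_difference oU Cf (ltW s0) box'.
have E : pd v (pd u f) (a + t1 *: u + t2 *: v) =
         pd u (pd v f) (a + t3 *: v + t4 *: u).
  apply: (@mulIf _ (s ^+ 2)); first by rewrite expf_neq0// gt_eqF.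
  rewrite -E1 -E2 [a + s *: v + s *: u]addrAC; ring.
have [_ [+ _]] := box t1 t2 h1 h2; have [_ [_ +]] := box t4 t3 h4 h3.
rewrite /= [a + t4 *: u + _]addrAC -E.
set x := pd v _ a; set y := pd u _ a; set z := pd v _ _ => H2 H1.
rewrite addr0 (splitr e) (le_trans (ler_distD z x y))//.
by rewrite lerD// ltW// distrC.
Qed.

End MeanValue.

(** * Directional derivatives and Jacobian matrices *)

(* Without this instance matrices are not inferred to be a completeNormedModType. *)
HB.instance Definition _ (R : realType) m n := Complete.on 'M[R]_(m, n).

Section DirectionalDerivative.
Context {R : realType}.

Lemma diff_near (V W : normedModType R) (f : V -> W) (x : V) (df : {linear V -> W}) :
  continuous df ->
  (forall e : R, 0 < e ->
    \forall h \near 0, `|f (h + x) - f x - df h| <= e * `|h|) ->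
  differentiable f x /\ 'd f x = df :> (V -> W).
Proof.
move=> cdf H; have E : f \o shift x = cst (f x) + df +o_ 0 id.
  apply/eqaddoP => e e0; apply: filterS (H e e0) => h; rewrite !fctE /=.
  by rewrite opprD addrA.
have eq := diff_unique cdf E.
by split => //; apply/diff_locallyP; rewrite eq.
Qed.

Lemma pd_near n (v : 'rV[R]_n) (f g : 'rV[R]_n -> R) x :
  differentiable f x -> (\forall y \near x, f y = g y) -> pd v g x = pd v f x.
Proof.
move=> df fg; have [_ E] := near_eq_diff fg df.
exact: (congr1 (fun h : 'rV[R]_n -> R => h v) E).
Qed.

Lemma pd_cst n (v : 'rV[R]_n) (c : R) x : pd v (fun=> c) x = 0.
Proof. exact: (congr1 (fun h : 'rV[R]_n -> R => h v) (diff_cst c x)). Qed.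

Lemma pdD n (v : 'rV[R]_n) (f g : 'rV[R]_n -> R) x :
  differentiable f x -> differentiable g x ->
  pd v (fun y => f y + g y) x = pd v f x + pd v g x.
Proof.
by move=> df dg; exact: (congr1 (fun h : 'rV[R]_n -> R => h v) (diffD df dg)).
Qed.

Lemma pdB n (v : 'rV[R]_n) (f g : 'rV[R]_n -> R) x :
  differentiable f x -> differentiable g x ->
  pd v (fun y => f y - g y) x = pd v f x - pd v g x.
Proof.
by move=> df dg; exact: (congr1 (fun h : 'rV[R]_n -> R => h v) (diffB df dg)).
Qed.

Lemma pdM n (v : 'rV[R]_n) (f g : 'rV[R]_n -> R) x :
  differentiable f x -> differentiable g x ->
  pd v (fun y => f y * g y) x = f x * pd v g x + g x * pd v f x.
Proof.
by move=> df dg; exact: (congr1 (fun h : 'rV[R]_n -> R => h v) (diffM df dg)).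
Qed.

Lemma differentiable_Rsum (V : normedModType R) I (r : seq I) (f : I -> V -> R) x :
  (forall i, differentiable (f i) x) ->
  differentiable (fun y => \sum_(i <- r) f i y) x.
Proof.
move=> df; elim: r => [|i r IH].
  rewrite (_ : (fun y => _) = cst 0); first exact: differentiable_cst.
  by apply/funext => y; rewrite big_nil.
rewrite (_ : (fun y => _) = (f i) \+ (fun y => \sum_(i <- r) f i y)).
  exact: differentiableD.
by apply/funext => y; rewrite big_cons.
Qed.

Lemma pd_sum n (v : 'rV[R]_n) I (r : seq I) (f : I -> 'rV[R]_n -> R) x :
  (forall i, differentiable (f i) x) ->
  pd v (fun y => \sum_(i <- r) f i y) x = \sum_(i <- r) pd v (f i) x.
Proof.
move=> df; elim: r => [|i r IH].
  rewrite big_nil (_ : (fun y => _) = fun=> 0) ?pd_cst//.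
  by apply/funext => y; rewrite big_nil.
rewrite big_cons -IH -(pdD v (df i) (differentiable_Rsum r df)).
by congr pd; apply/funext => y; rewrite big_cons.
Qed.

Lemma pdZ n (v : 'rV[R]_n) (f : 'rV[R]_n -> R) (c : R) x :
  differentiable f x -> pd v (fun y => f y * c) x = pd v f x * c.
Proof.
move=> df; rewrite (pdM v df (differentiable_cst c x)).
by rewrite pd_cst mulr0 add0r mulrC.
Qed.

Lemma differentiableMr n (f : 'rV[R]_n -> R) (c : R) x :
  differentiable f x -> differentiable (fun y => f y * c) x.
Proof. by move=> df; exact: (differentiableM df (differentiable_cst c x)). Qed.

Lemma pd_linear n (v : 'rV[R]_n) (f : 'rV[R]_n -> R) x :
  pd v f x = \sum_i v 0 i * pd (delta_mx 0 i) f x.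
Proof.
rewrite /pd [in LHS](row_sum_delta v) linear_sum.
by apply: eq_bigr => i _; rewrite linearZ.
Qed.

Lemma differentiable_row n i (x : 'rV[R]_n) :
  differentiable (fun y : 'rV[R]_n => y 0 i) x.
Proof. exact: differentiable_coord. Qed.

Lemma pd_row n (v : 'rV[R]_n) i x : pd v (fun y => y 0 i) x = v 0 i.
Proof.
have @f : {linear 'rV[R]_n -> R}.
  by exists (fun N : 'rV[R]_n => N 0 i); do 2![eexists]; do ?[constructor];
     rewrite ?mxE// => ? *; rewrite ?mxE//; move=> ?; rewrite !mxE.
have cf : continuous f by exact: coord_continuous.
exact: (congr1 (fun h : 'rV[R]_n -> R => h v) (diff_lin x cf)).
Qed.

(** Transpose of the usual Jacobian: tangent vectors are rows, so [v *m jac f x] is the differential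
    and the chain rule multiplies in the order of application. *)
Definition jac m n (f : 'rV[R]_m -> 'rV[R]_n) (x : 'rV[R]_m) : 'M[R]_(m, n) :=
  \matrix_(i, j) pd (delta_mx 0 i) (fun y => f y 0 j) x.

Lemma mulmx_jac m n (f : 'rV[R]_m -> 'rV[R]_n) x v j :
  (v *m jac f x) 0 j = pd v (fun y => f y 0 j) x.
Proof. by rewrite mxE pd_linear; apply: eq_bigr => i _; rewrite mxE. Qed.

Lemma pd_comp m n (v : 'rV[R]_m) (g : 'rV[R]_m -> 'rV[R]_n) (f : 'rV[R]_n -> R) x :
  (forall i, differentiable (fun y => g y 0 i) x) -> differentiable f (g x) ->
  pd v (f \o g) x = pd (v *m jac g x) f (g x).
Proof.
move=> dg df; have [dgx Dgx] := differentiable_rV dg.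
apply: etrans (congr1 (fun h : _ -> R => h v) (diff_comp dgx df)) _.
by congr ('d f (g x) _); apply/rowP => i; rewrite Dgx mulmx_jac.
Qed.

Lemma jac_comp m n p (g : 'rV[R]_m -> 'rV[R]_n) (f : 'rV[R]_n -> 'rV[R]_p) x :
  (forall i, differentiable (fun y => g y 0 i) x) ->
  (forall i, differentiable (fun y => f y 0 i) (g x)) ->
  jac (f \o g) x = jac g x *m jac f (g x).
Proof.
move=> dg df; apply/matrixP => i j; rewrite [LHS]mxE.
rewrite (pd_comp _ (f := fun y => f y 0 j) dg (df j)) -mulmx_jac.
by rewrite -mulmxA -rowE [LHS]mxE.
Qed.

Lemma jac_near m n (f g : 'rV[R]_m -> 'rV[R]_n) x :
  (forall i, differentiable (fun y => f y 0 i) x) ->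
  (\forall y \near x, f y = g y) -> jac g x = jac f x.
Proof.
move=> df fg; apply/matrixP => i j; rewrite !mxE; apply: (pd_near _ (df j)).
by apply: filterS fg => y ->.
Qed.

Lemma jac_id n (x : 'rV[R]_n) : jac id x = 1%:M.
Proof. by apply/matrixP => i j; rewrite [LHS]mxE (pd_row (delta_mx 0 i) j) !mxE eqxx eq_sym. Qed.

Lemma smooth_on_differentiable m n (U : set 'rV[R]_m)
    (f : 'rV[R]_m -> 'rV[R]_n) x i :
  smooth_on U f -> U x -> differentiable (fun y => f y 0 i) x.
Proof. by move=> sf Ux; apply: (sf 1%N i).1. Qed.

Lemma Ck_jac k m n (U : set 'rV[R]_m) (f : 'rV[R]_m -> 'rV[R]_n) i j :
  smooth_on U f -> Ck k U (fun x => jac f x i j).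
Proof.
move=> sf; rewrite (_ : (fun x => _) = pd (delta_mx 0 i) (fun y => f y 0 j)).
  exact: (sf k.+1 j).2.
by apply/funext => x; rewrite mxE.
Qed.

End DirectionalDerivative.

(** * Smooth matrix-valued functions *)

Section CkMatrix.
Context {R : realType}.

Lemma Ck_ext k n (U : set 'rV[R]_n) (f g : 'rV[R]_n -> R) :
  (forall x, f x = g x) -> Ck k U f -> Ck k U g.
Proof. by move=> /funext ->. Qed.

Lemma Ck_prod k n (U : set 'rV[R]_n) I (r : seq I) (f : I -> 'rV[R]_n -> R) :
  open U -> (forall i, Ck k U (f i)) -> Ck k U (fun x => \prod_(i <- r) f i x).
Proof.
move=> oU Cf; elim: r => [|i r ih].
  by apply: Ck_ext (Ck_cst _ _ 1) => x; rewrite big_nil.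
by apply: Ck_ext (CkM oU (Cf i) ih) => x; rewrite big_cons.
Qed.

Lemma Ck_mulmx k d m n p (U : set 'rV[R]_d) (A : 'rV[R]_d -> 'M[R]_(m, n))
    (B : 'rV[R]_d -> 'M[R]_(n, p)) i j :
  open U -> (forall i j, Ck k U (fun x => A x i j)) ->
  (forall i j, Ck k U (fun x => B x i j)) -> Ck k U (fun x => (A x *m B x) i j).
Proof.
move=> oU CA CB.
have H := Ck_sum (index_enum _) oU (fun l => CkM oU (CA i l) (CB l j)).
by apply: Ck_ext H => x; rewrite mxE.
Qed.

Lemma Ck_det k d n (U : set 'rV[R]_d) (A : 'rV[R]_d -> 'M[R]_n) :
  open U -> (forall i j, Ck k U (fun x => A x i j)) -> Ck k U (fun x => \det (A x)).
Proof.
move=> oU CA; apply: Ck_sum => // s; apply: CkM (Ck_cst _ _ _) _ => //.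
by apply: Ck_prod.
Qed.

(** Cramer's rule: the inverse is the adjugate over the determinant, both polynomial in the
    entries. *)
Lemma Ck_invmx k d n (U : set 'rV[R]_d) (A : 'rV[R]_d -> 'M[R]_n) i j :
  open U -> (forall x, U x -> A x \in unitmx) ->
  (forall i j, Ck k U (fun x => A x i j)) -> Ck k U (fun x => invmx (A x) i j).
Proof.
move=> oU uA CA.
have Cd : Ck k U (fun x => (\det (A x))^-1).
  by apply: CkV => //; [move=> x /uA; rewrite unitmxE unitfE|exact: Ck_det].
have Ca : Ck k U (fun x => \adj (A x) i j).
  apply: (Ck_ext (f := fun x => (-1) ^+ (j + i) *
      \det (\matrix_(i', j') A x (lift j i') (lift i j')))).
    by move=> x; rewrite !mxE /cofactor; congr (_ * \det _); apply/matrixP => ? ?; rewrite !mxE.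
  apply: CkM (Ck_cst _ _ _) _ => //; apply: Ck_det => // i' j'.
  by apply: Ck_ext (CA (lift j i') (lift i j')) => x; rewrite mxE.
apply: Ck_eq oU _ (CkM oU Cd Ca) => x /uA ux.
by rewrite /invmx ux !mxE.
Qed.

Lemma smooth_affine m n (U : set 'rV[R]_m) (A : 'M[R]_(m, n)) (b : 'rV[R]_n) :
  open U -> smooth_on U (fun y => y *m A + b).
Proof.
move=> oU k i.
apply: (Ck_ext (f := fun x => \sum_j x 0 j * A j i + b 0 i)).
  by move=> x; rewrite !mxE.
apply: CkD (Ck_cst _ _ _) => //; apply: Ck_sum => // j.
by apply: CkM; [|exact: Ck_coord|exact: Ck_cst].
Qed.

End CkMatrix.

(** * The inverse function theorem *)

Section InverseFunction.
Context {R : realType}.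

Lemma rV_norm_le m n (v : 'M[R]_(m, n)) (e : R) :
  0 <= e -> (forall i j, `|v i j| <= e) -> `|v| <= e.
Proof.
move=> e0 h; rewrite /Num.Def.normr /= mx_normrE.
by apply: bigmax_le => // -[i j] _; exact: h.
Qed.

Lemma le_rV_norm m n (v : 'M[R]_(m, n)) i j : `|v i j| <= `|v|.
Proof.
rewrite [leRHS]/Num.Def.normr /= mx_normrE.
exact: (le_trans _ (le_bigmax _ (fun x : 'I_m * 'I_n => `|v x.1 x.2|) (i, j))).
Qed.

Lemma mulmx_norm_le m n (v : 'rV[R]_m) (A : 'M[R]_(m, n)) (e : R) :
  0 <= e -> (forall i j, `|A i j| <= e) -> `|v *m A| <= `|v| * (m%:R * e).
Proof.
move=> e0 h; apply: rV_norm_le; first by rewrite !mulr_ge0.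
move=> i j; rewrite mxE (le_trans (ler_norm_sum _ _ _))//.
rewrite mulrCA mulr_natl -[X in _ *+ X]card_ord -sumr_const.
apply: ler_sum => k _; rewrite normrM ler_pM//.
by rewrite (ord1 i) le_rV_norm.
Qed.

Lemma closed_ball_segment (V : normedModType R) (x0 x y : V) (r t : R) :
  `|x - x0| <= r -> `|y - x0| <= r -> 0 <= t <= 1 ->
  `|x + t *: (y - x) - x0| <= r.
Proof.
move=> hx hy /andP[t0 t1].
have -> : x + t *: (y - x) - x0 = (1 - t) *: (x - x0) + t *: (y - x0).
  rewrite (_ : y - x = (y - x0) - (x - x0)); last by rewrite opprB addrA subrK.
  by rewrite addrAC scalerBr scalerBl scale1r addrCA addrC.
rewrite (le_trans (ler_normD _ _))// !normrZ !ger0_norm// ?subr_ge0//.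
rewrite (_ : r = (1 - t) * r + t * r); last by ring.
by rewrite lerD// ler_wpM2l// subr_ge0.
Qed.

Variables (n : nat) (U : set 'rV[R]_n) (f : 'rV[R]_n -> 'rV[R]_n) (x0 : 'rV[R]_n).
Hypotheses (oU : open U) (Ux0 : U x0) (sf : smooth_on U f).
Hypothesis uf : jac f x0 \in unitmx.

Let B := invmx (jac f x0).

(* Near x0 the map x |-> f x *m B is a perturbation of the identity by a
   1/2-contraction. *)
Lemma perturbation_of_id : exists2 r : R, 0 < r &
  forall x, `|x - x0| <= r ->
    [/\ U x, forall v : 'rV[R]_n, `|v - v *m jac f x *m B| <= `|v| / 2 &
     forall y, `|y - x0| <= r ->
       `|(y - x) - (f y - f x) *m B| <= `|y - x| / 2].
Proof.
(* For the sup norm, entries below e give |v C| <= n e |v| <= |v| / 2; n + 1 in place of n keeps e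
   positive when n = 0. *)
pose e : R := (2 * n.+1%:R)^-1; have e0 : 0 < e by rewrite invr_gt0 mulr_gt0.
have [C CE] : exists C : 'rV[R]_n -> 'M[R]_n, forall x, C x = 1%:M - jac f x *m B.
  by exists (fun x => 1%:M - jac f x *m B).
have cC i j : {for x0, continuous (fun x => C x i j)}.
  have H : Ck 0 U (fun x => C x i j).
    apply: (Ck_ext (f := fun x => (1%:M : 'M[R]_n) i j - (jac f x *m B) i j)).
      by move=> x; rewrite CE !mxE.
    apply: CkD (Ck_cst _ _ _) _; first exact: oU.
    apply: CkN => //; apply: Ck_mulmx => // k l; first exact: Ck_jac sf.
    exact: Ck_cst.
  exact: H.
have nC : \forall x \near x0, forall i j, `|C x i j| < e.
  have nCi i : \forall x \near x0, forall j, `|C x i j| < e.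
    have nCij j : \forall x \near x0, `|C x i j| < e.
      have H := iffLR (cvgrPdist_lt _ _) (cC i j) _ e0.
      have C0 : C x0 i j = 0 by rewrite CE mulmxV// subrr mxE.
      have {}H : \forall x \near x0, `|C x0 i j - C x i j| < e by exact: H.
      by move: H; rewrite C0; apply: filterS => x; rewrite sub0r normrN.
    exact: (filter_forall _ nCij).
  exact: (filter_forall _ nCi).
have nU : nbhs x0 U by exact: open_nbhs_nbhs.
have : nbhs x0 (U `&` [set x | forall i j, `|C x i j| < e]) by exact: filterI.
move=> /nbhs_ballP[r /= r0 rP].
exists (r / 2); first by rewrite divr_gt0.
have {}rP x : `|x - x0| <= r / 2 -> U x /\ forall i j, `|C x i j| < e.
  move=> hx; apply: rP; rewrite -ball_normE /= distrC (le_lt_trans hx)//.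
  by rewrite ltr_pdivrMr// ltr_pMr// ltr1n.
have Cv x (v : 'rV[R]_n) : `|x - x0| <= r / 2 -> `|v *m C x| <= `|v| / 2.
  move=> /rP[_ Cx].
  apply: (le_trans (mulmx_norm_le _ (ltW e0) _)); first by move=> a b; exact: ltW.
  rewrite ler_wpM2l// /e invfM mulrCA ler_piMr ?invr_ge0//.
  by rewrite ler_pdivrMr// mul1r ler_nat.
move=> x hx; split; first by have [] := rP _ hx.
  by move=> v; rewrite -mulmxA -[X in X - _]mulmx1 -mulmxBr -CE Cv.
move=> y hy; have [Ux _] := rP _ hx; have [Uy _] := rP _ hy.
apply: rV_norm_le; first by rewrite divr_ge0.
move=> i j; rewrite (ord1 i) {i}.
(* The mean value theorem is scalar, so it is applied to each coordinate; the intermediate point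
   depends on j, which the sup norm tolerates. *)
pose g (z : 'rV[R]_n) : R := z 0 j - \sum_k f z 0 k * B k j.
have df z k : U z -> differentiable (fun z => f z 0 k) z.
  by move=> Uz; exact: smooth_on_differentiable sf Uz.
have dB z k : U z -> differentiable (fun z => f z 0 k * B k j) z.
  by move=> /(df z k) d; exact: differentiableMr.
have dS z : U z -> differentiable (fun z => \sum_k f z 0 k * B k j) z.
  by move=> Uz; apply: differentiable_Rsum => k; exact: dB.
have dg z : U z -> differentiable g z.
  by move=> Uz; exact: (differentiableB (differentiable_row j z) (dS z Uz)).
have [t t01|t t01] := @mean_value_segment R _ g x y.
  by apply: dg; have [] := rP _ (closed_ball_segment hx hy t01).
set z := x + _; have [Uz Cz] := rP _ (closed_ball_segment hx hy t01).
rewrite -/(pd _ _ _) pdB; [|exact: differentiable_row|exact: dS].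
rewrite pd_row pd_sum; last by move=> k; exact: dB.
rewrite (_ : \sum_k _ = ((y - x) *m (jac f z *m B)) 0 j) => [E|]; last first.
  rewrite mulmxA mxE; apply: eq_bigr => k _.
  by rewrite mulmx_jac; apply: pdZ; exact: df.
have -> : ((y - x) - (f y - f x) *m B) 0 j = ((y - x) *m C z) 0 j.
  rewrite [RHS](_ : _ = (y - x) 0 j - ((y - x) *m (jac f z *m B)) 0 j); last first.
    by rewrite CE mulmxBr mulmx1 !mxE.
  by rewrite -E /g mulmxBl !mxE; ring.
by rewrite (le_trans (le_rV_norm _ _ _))// Cv// closed_ball_segment.
Qed.

Lemma mulmx_bounded m p (A : 'M[R]_(m, p)) :
  exists2 K : R, 0 < K & forall v : 'rV[R]_m, `|v *m A| <= K * `|v|.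
Proof.
exists (m%:R * `|A| + 1); first by rewrite ltr_wpDl// mulr_ge0.
move=> v; apply: (le_trans (mulmx_norm_le v (normr_ge0 A) (le_rV_norm A))).
by rewrite mulrC ler_wpM2r// lerDl.
Qed.

Let uB : B \in unitmx. Proof. by rewrite unitmx_inv. Qed.

Let mulmxB_inj (v w : 'rV[R]_n) : v *m B = w *m B -> v = w.
Proof. exact: (can_inj (mulmxK uB)). Qed.

(** A solution of f x = y is a fixed point of the simplified Newton step T x = x - (f x - y) B. This
    is a 1/2-contraction of the closed ball of radius r, and maps it into itself when |(y - f x0) B|
    < r / 2. The Lipschitz bound on h is what later yields its differentiability. *)
Lemma local_inverse_exists : exists U' V' h,
  [/\ open U' /\ U' x0, open V', U' `<=` U,
      (forall x, U' x -> V' (f x) /\ h (f x) = x) /\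
      (forall y, V' y -> U' (h y) /\ f (h y) = y) &
      (forall x, U' x -> jac f x \in unitmx) /\
      exists2 K : R, 0 < K & forall y y', V' y -> V' y' -> `|h y - h y'| <= K * `|y - y'|].
Proof.
have [r r0 P] := perturbation_of_id.
(* x -> f x B shrinks distances by at most a factor 2; injectivity, the Lipschitz constant and the
   strict bound on the fixed point all come from this. *)
have low x y : `|x - x0| <= r -> `|y - x0| <= r ->
    `|y - x| <= 2 * `|(f y - f x) *m B|.
  move=> /P[_ _ /(_ y) H] /H {}H.
  have : `|y - x| <= `|y - x| / 2 + `|(f y - f x) *m B|.
    by rewrite (le_trans _ (lerD H (lexx _)))// (le_trans _ (ler_normD _ _))// subrK.
  move: `|y - x| `|_ *m B| => a b; lra.
have x00 : `|x0 - x0| <= r by rewrite subrr normr0 ltW.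
pose V := [set y | `|(y - f x0) *m B| < r / 2].
pose U' := [set x | `|x - x0| < r /\ V (f x)].
have oV : open V.
  have oT : open [set: 'rV[R]_n] by exact: openT.
  apply: (@open_comp _ _ (fun y => `|(y - f x0) *m B|) [set t | t < r / 2]).
    move=> y _; apply: (@continuous_comp _ _ _ (fun y => (y - f x0) *m B) Num.norm).
      rewrite (_ : (fun y => _) = (fun y => y *m B + (- (f x0 *m B)))).
        exact: smooth_on_continuous (smooth_affine B _ oT) I.
      by apply/funext => z; rewrite mulmxBl.
    exact: norm_continuous.
  exact: open_lt.
have U'U x : U' x -> U x by move=> [/ltW/P[]].
have oU' : open U'.
  rewrite openE => x [xr Vx]; apply: filterI.
    by apply/nbhs_ballP; exists (r - `|x - x0|) => /=;
      [rewrite subr_gt0|move=> z; rewrite -ball_normE /= => zx;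
       rewrite (le_lt_trans (ler_distD x _ _))// -ltrBrDr distrC].
  have cf : {for x, continuous f} by apply: smooth_on_continuous sf _; have [] := P _ (ltW xr).
  by apply: cf; exact: open_nbhs_nbhs.
have ex y : V y -> exists x, U' x /\ f x = y.
  move=> Vy; pose T x := x - (f x - y) *m B; pose D := closed_ball_ Num.norm x0 r.
  have DE x : D x <-> `|x - x0| <= r by rewrite /D /closed_ball_ /= distrC.
  have TD : set_fun D D T.
    move=> x /DE xr; apply/DE; have [_ _ /(_ x0 x00) H] := P _ xr.
    rewrite (_ : T x - x0 = - ((x0 - x) - (f x0 - f x) *m B) + (y - f x0) *m B).
      rewrite (le_trans (ler_normD _ _))// normrN (splitr r) lerD// ?(ltW Vy)//.
      by rewrite (le_trans H)// distrC ler_pM2r// invr_gt0.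
    by rewrite /T !mulmxBl; apply/rowP => i; rewrite !mxE; ring.
  have [|||p Dp pE] := @banach_fixed_point R 'rV[R]_n D (mkfun TD).
  - exists (2^-1)%:nng; split; first by rewrite /= invf_lt1// ltr1n.
    move=> [x x'] /= [/DE xr /DE x'r]; have [_ _ /(_ x xr) H] := P _ x'r.
    rewrite (_ : _ - _ = (x - x') - (f x - f x') *m B) 1?mulrC//.
    by rewrite /= /mkfun /T !mulmxBl; apply/rowP => i; rewrite !mxE; ring.
  - exact: closed_closed_ball_.
  - by exists x0; apply/DE.
  move: pE => /= /eqP; rewrite /mkfun /T -[X in X == _]subr0 (inj_eq (addrI _)).
  rewrite eqr_opp eq_sym => /eqP; rewrite -[RHS](mul0mx _ B) => /mulmxB_inj/eqP.
  rewrite subr_eq0 => /eqP fp; move/DE in Dp.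
  exists p; split => //; split; last by rewrite fp.
  (* The fixed point theorem only places p in the closed ball; [low] puts it in the open one. *)
  rewrite (le_lt_trans (low _ _ x00 Dp))// fp.
  by rewrite mulrC -ltr_pdivlMr.
pose h y := xget x0 [set x | U' x /\ f x = y].
have hP y : V y -> U' (h y) /\ f (h y) = y.
  by move=> /ex[x xP]; apply: (@xgetPex _ x0 [set x | U' x /\ f x = y]); exists x.
have lowE x y : `|x - x0| < r -> `|y - x0| < r -> f x = f y -> x = y.
  move=> /ltW xr /ltW yr E; have := low _ _ yr xr.
  by rewrite E subrr mul0mx normr0 mulr0 normr_le0 subr_eq0 => /eqP.
have [K K0 KB] := mulmx_bounded B.
exists U', V, h; split; [|exact: oV|exact: U'U| |].
- split; first exact: oU'.
  by rewrite /U' /V /= !subrr mul0mx !normr0 divr_gt0.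
- split; last exact: hP.
  move=> x Ux; have [_ Vx] := Ux; split; first exact: Vx.
  by have [[h1 _] h2] := hP _ Vx; apply: lowE h1 _ h2; case: Ux.
- split=> [x [/ltW xr _]|].
    (* A vector v in the kernel of [jac f x] satisfies |v| <= |v| / 2. *)
    have [_ H _] := P _ xr; rewrite -row_free_unit -kermx_eq0.
    apply/rowV0P => v /sub_kermxP vJ; have := H v; rewrite vJ mul0mx subr0 => vv.
    by apply/eqP; rewrite -normr_le0; move: vv; move: `|v| => a; lra.
  exists (2 * K); first exact: mulr_gt0.
  move=> y y' /hP[[yr _] E] /hP[[yr' _] E'].
  rewrite (le_trans (low _ _ (ltW yr') (ltW yr)))// E E' -mulrA ler_pM2l//.
Qed.

End InverseFunction.

(** * Smoothness of the local inverse *)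

Section SmoothInverse.
Context {R : realType}.

Lemma mulmxr_continuous m n (A : 'M[R]_(m, n)) : continuous (fun v : 'rV[R]_m => v *m A).
Proof.
move=> v; rewrite (_ : (fun v => _) = (fun v => v *m A + 0)).
  exact: smooth_on_continuous (smooth_affine A 0 (@openT _)) I.
by apply/funext => w; rewrite addr0.
Qed.

Lemma pd_vec m n (f : 'rV[R]_m -> 'rV[R]_n) (df : {linear 'rV[R]_m -> 'rV[R]_n}) x i v :
  differentiable f x -> 'd f x = df :> (_ -> _) ->
  differentiable (fun y => f y 0 i) x /\ pd v (fun y => f y 0 i) x = df v 0 i.
Proof.
move=> dfx E; have di : differentiable (fun y => f y 0 i) x.
  exact: (differentiable_comp dfx (differentiable_row i (f x))).
split; first exact: di.
have dj j : differentiable (fun y => f y 0 j) x.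
  exact: (differentiable_comp dfx (differentiable_row j (f x))).
have [_ /(_ v i) H] := differentiable_rV dj.
exact: (etrans (esym H) (congr1 (fun h : _ -> 'rV[R]_n => h v 0 i) E)).
Qed.

Lemma jac_littleo m n (f : 'rV[R]_m -> 'rV[R]_n) x (e : R) :
  (forall i, differentiable (fun y => f y 0 i) x) -> 0 < e ->
  exists2 d : R, 0 < d & forall h, `|h| < d ->
    `|f (x + h) - f x - h *m jac f x| <= e * `|h|.
Proof.
move=> df e0; have [dfx Df] := differentiable_rV df.
have /eqaddoP /(_ _ e0) := diff_locally dfx.
move=> /nbhs_ballP[d /= d0 H]; exists d => // h hd.
have := H h; rewrite -ball_normE /= sub0r normrN => /(_ hd).
rewrite !fctE /= opprD addrA addrC [x + h]addrC.
rewrite (_ : h *m jac f x = 'd f x h); last first.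
  by apply/rowP => i; rewrite mulmx_jac Df.
by rewrite addrC.
Qed.

(** With w = h (y + k) - h y, differentiability of f gives k = w J + o(w), hence w = k J^-1 + o(w),
    and |w| <= K |k| turns o(w) into o(k). *)
Lemma diff_inverse n (f h : 'rV[R]_n -> 'rV[R]_n) (V : set 'rV[R]_n) y (K : R) :
  (forall i, differentiable (fun x => f x 0 i) (h y)) ->
  jac f (h y) \in unitmx -> open V -> V y ->
  (forall y, V y -> f (h y) = y) -> 0 < K ->
  (forall y y', V y -> V y' -> `|h y - h y'| <= K * `|y - y'|) ->
  forall i v, differentiable (fun y => h y 0 i) y /\
    pd v (fun y => h y 0 i) y = (v *m invmx (jac f (h y))) 0 i.
Proof.
move=> df uJ oV Vy fh K0 hK i v; set J := jac f (h y).
pose L : {linear 'rV[R]_n -> 'rV[R]_n} := mulmxr (invmx J).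
suff : differentiable h y /\ 'd h y = L :> ('rV[R]_n -> 'rV[R]_n).
  by move=> [dh Dh]; exact: (pd_vec i v dh Dh).
apply: diff_near; first exact: mulmxr_continuous.
move=> e e0; have [M M0 HM] := mulmx_bounded (invmx J).
(* M bounds [invmx J] and K the increments of h, so an error e / (M K) for f becomes e for h. *)
have e'0 : 0 < e / (M * K) by rewrite divr_gt0// mulr_gt0.
have [d d0 Hd] := jac_littleo df e'0.
have nV : nbhs y V by exact: open_nbhs_nbhs.
move: nV => /nbhs_ballP[d' /= d'0 Vd'].
apply/nbhs_ballP; exists (Num.min (d / K) d') => /=.
  by rewrite lt_min d'0 divr_gt0.
move=> k; rewrite -ball_normE /= sub0r normrN lt_min => /andP[kd kd'].
have Vk : V (k + y).
  by apply: Vd'; rewrite -ball_normE /= opprD addrC subrK normrN.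
have hk : `|h (k + y) - h y| <= K * `|k|.
  by rewrite (le_trans (hK _ _ Vk Vy))// addrK.
set w := h (k + y) - h y in hk *.
have wd : `|w| < d by rewrite (le_lt_trans hk)// mulrC -ltr_pdivlMr.
have := Hd w wd; rewrite {2}/w [h y + w]addrC subrK fh// fh// addrK -/J => H.
rewrite (_ : w - _ = - ((k - w *m J) *m invmx J)).
  rewrite normrN (le_trans (HM _))//.
  apply: (@le_trans _ _ (M * (e / (M * K) * (K * `|k|)))).
    by rewrite ler_pM2l// (le_trans H)// ler_pM2l.
  by rewrite le_eqVlt; apply/orP; left; apply/eqP; field; rewrite !gt_eqF.
by rewrite mulmxBl mulmxK// opprB.
Qed.

(** The differential of h is [invmx (jac f (h y))], which is of class C^k once h is: induction on k,
    for all coordinates of h at once. *)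
Theorem smooth_inverse_function n (U : set 'rV[R]_n) (f : 'rV[R]_n -> 'rV[R]_n) x0 :
  open U -> U x0 -> smooth_on U f -> jac f x0 \in unitmx ->
  exists U' V' h,
  [/\ open U' /\ U' x0, open V', U' `<=` U,
      (forall x, U' x -> V' (f x) /\ h (f x) = x) /\
      (forall y, V' y -> U' (h y) /\ f (h y) = y) &
      smooth_on V' h].
Proof.
move=> oU Ux0 sf uf.
have [U' [V [h [oU' oV U'U [fP hP] [uJ [K K0 hK]]]]]] := local_inverse_exists oU Ux0 sf uf.
exists U', V, h; split; [exact: oU'|exact: oV|exact: U'U|by split|].
have fh y : V y -> f (h y) = y by move=> /hP[].
have UJ y : V y -> jac f (h y) \in unitmx by move=> /hP[/uJ].
have D y : V y -> forall i v, differentiable (fun y => h y 0 i) y /\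
    pd v (fun y => h y 0 i) y = (v *m invmx (jac f (h y))) 0 i.
  move=> Vy; apply: (diff_inverse _ _ oV Vy fh K0 hK); last exact: UJ.
  by move=> i; apply: smooth_on_differentiable sf _; apply: U'U; have [] := hP _ Vy.
move=> k; elim: k => [|k IH] i.
  by move=> y Vy; apply: differentiable_continuous; have [] := D _ Vy i 0.
split=> [y Vy|v]; first by have [] := D _ Vy i 0.
have C : Ck k V (fun y => \sum_j v 0 j * invmx (jac f (h y)) j i).
  apply: Ck_sum => // j; apply: CkM (Ck_cst _ _ _) _ => //.
  apply: Ck_invmx => // a b.
  apply: (Ck_comp (f := fun x => jac f x a b) oV _ IH (Ck_jac k a b sf)).
  by move=> y /hP[/U'U].
apply: Ck_eq oV _ C => y Vy.
have [_ E] := D _ Vy i v; rewrite mxE in E; exact: (esym E).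
Qed.

End SmoothInverse.

(** * Local isomorphisms in charts *)

Section ChartFacts.
Context {R : realType}.

Lemma open_setI_preimage (S T : topologicalType) (U : set S) (D : set T) (f : S -> T) :
  open U -> (forall x, U x -> {for x, continuous f}) -> open D ->
  open (U `&` f @^-1` D).
Proof.
move=> oU cf oD; rewrite openE => x [Ux Dx].
apply: (@filterI _ (nbhs x)); first exact: open_nbhs_nbhs.
by apply: cf => //; exact: open_nbhs_nbhs.
Qed.

Section OneChart.
Variables (n : nat) (M : topologicalType) (c : chart R n M).
Hypothesis cc : is_chart c.

Lemma chart_mapK x : chart_dom c x -> chart_inv c (chart_map c x) = x.
Proof. by case: cc => _ _ + _ _; apply. Qed.

Lemma chart_img_map x : chart_dom c x -> chart_img c (chart_map c x).
Proof. by exists x. Qed.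

Lemma chart_dom_inv y : chart_img c y -> chart_dom c (chart_inv c y).
Proof. by move=> [x dx <-]; rewrite chart_mapK. Qed.

Lemma chart_invK y : chart_img c y -> chart_map c (chart_inv c y) = y.
Proof. by move=> [x dx <-]; rewrite chart_mapK. Qed.

Lemma open_chart_dom : open (chart_dom c). Proof. by case: cc. Qed.
Lemma open_chart_img : open (chart_img c). Proof. by case: cc. Qed.

Lemma chart_map_continuous x : chart_dom c x -> {for x, continuous (chart_map c)}.
Proof. by case: cc => _ _ _ + _; apply. Qed.

Lemma chart_inv_continuous y : chart_img c y -> {for y, continuous (chart_inv c)}.
Proof. by case: cc => _ _ _ _; apply. Qed.

Lemma open_chart_preimage (W : set 'rV[R]_n) : open W ->
  open (chart_dom c `&` chart_map c @^-1` W).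
Proof. exact: (open_setI_preimage open_chart_dom chart_map_continuous). Qed.

Lemma open_chart_inv_preimage (O : set M) : open O ->
  open (chart_img c `&` chart_inv c @^-1` O).
Proof. exact: (open_setI_preimage open_chart_img chart_inv_continuous). Qed.

End OneChart.

(** In another pair of charts the expression is [Phi] composed on both sides with transition maps,
    which are smooth. *)
Lemma smooth_map_local m n (M N : topologicalType) (A : set (chart R m M))
    (B : set (chart R n N)) c d (Phi : 'rV[R]_m -> 'rV[R]_n) W (U : set M) :
  is_atlas A -> is_atlas B -> A c -> B d -> open U -> smooth_on W Phi ->
  (forall x, U x -> [/\ chart_dom c x, W (chart_map c x) &
    chart_img d (Phi (chart_map c x))]) ->
  smooth_map A B U (chart_inv d \o Phi \o chart_map c).
Proof.
move=> aA aB Ac Bd oU sP UP; set f := _ \o chart_map c.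
have [cA _ tA] := aA; have [cB _ tB] := aB.
have cc := cA _ Ac; have cd := cB _ Bd.
have cf x : U x -> {for x, continuous f}.
  move=> /UP[dx Wx ix]; apply: continuous_comp; first exact: chart_map_continuous.
  apply: continuous_comp; first exact: smooth_on_continuous sP Wx.
  exact: chart_inv_continuous.
split; first exact: cf.
move=> c' d' Ac' Bd'; set S := image _ _.
have cc' := cA _ Ac'; have cd' := cB _ Bd'.
have oS : open S.
  rewrite /S (_ : _ `&` _ = (U `&` f @^-1` chart_dom d') `&` chart_dom c'); last first.
    by rewrite setIAC.
  apply: open_chart_image => //; apply: (open_setI_preimage oU cf).
  exact: open_chart_dom.
have s1 : smooth_on S (chart_map c \o chart_inv c').
  apply: smooth_on_sub (tA _ _ Ac' Ac).
  by move=> _ [x [[/UP[dx _ _] dx'] _] <-]; exists x.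
have s2 : smooth_on S (Phi \o (chart_map c \o chart_inv c')).
  apply: smooth_on_comp oS _ s1 sP => _ [x [[/UP[dx Wx _] dx'] _] <-] /=.
  by rewrite chart_mapK.
apply: (smooth_on_comp oS _ s2 (tB _ _ Bd Bd')).
move=> _ [x [[/UP[dx Wx ix] dx'] dfx] <-] /=; rewrite chart_mapK//.
exists (f x); last by rewrite chart_invK.
by split => //; exact: chart_dom_inv.
Qed.

End ChartFacts.

Section LieGroupFacts.
Context {R : realType} {n : nat}.
Variables (G : lieGroup R n) (c : chart R n G).
Hypothesis Gc : lie_atlas G c.

Lemma lie_atlasP : is_atlas (lie_atlas G).
Proof. by case: (lie_axioms G). Qed.

Lemma lie_chartP : is_chart c.
Proof. by case: lie_atlasP => + _ _; apply. Qed.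

Lemma mulg_continuous (x : G * G) : {for x, continuous (fun p : G * G => (p.1 * p.2)%g)}.
Proof. by case: (lie_axioms G) => _ _ _ [+ _] _; apply. Qed.

Lemma invg_continuous (x : G) : {for x, continuous (fun p : G => (p^-1)%g)}.
Proof. by case: (lie_axioms G) => _ _ _ _ [+ _]; apply. Qed.

Lemma square_nbhs1 (O : set G) : open O -> O 1%g ->
  exists U, [/\ open U, U 1%g, U `<=` O & forall x y, U x -> U y -> O (x * y)%g].
Proof.
move=> oO O1.
have : nbhs ((1%g, 1%g) : G * G) ((fun p : G * G => (p.1 * p.2)%g) @^-1` O).
  by apply: mulg_continuous; rewrite /= mulg1; exact: open_nbhs_nbhs.
move=> [[A B] /= [nA nB] AB].
exists (interior A `&` interior B `&` O); split.
- by apply: openI => //; apply: openI; exact: open_interior.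
- by split; [split; [exact: nA|exact: nB]|exact: O1].
- by move=> x [].
- move=> x y [[/interior_subset Ax _] _] [[_ /interior_subset By] _].
  exact: (AB (x, y)).
Qed.

End LieGroupFacts.

(** The inverse h must be multiplicative too, but h x * h y could leave the set U0 on which f is
    injective. Hence U is shrunk until products of two of its elements lie in U0, and V is cut out
    by the condition that h y lies in U. *)
Lemma local_isomorphism_of_charts (R : realType) n (G H : lieGroup R n)
    (c : chart R n G) (d : chart R n H) (Phi : 'rV[R]_n -> 'rV[R]_n) W (O : set G) :
  lie_atlas G c -> lie_atlas H d -> chart_dom c 1%g -> chart_dom d 1%g ->
  open W -> W (chart_map c 1%g) -> smooth_on W Phi ->
  jac Phi (chart_map c 1%g) \in unitmx ->
  Phi (chart_map c 1%g) = chart_map d 1%g ->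
  open O -> O 1%g ->
  (let f := chart_inv d \o Phi \o chart_map c in
   forall x y, O x -> O y -> O (x * y)%g -> f (x * y)%g = (f x * f y)%g) ->
  locally_isomorphic G H.
Proof.
move=> Gc Hd c1 d1 oW W1 sP uP P1 oO O1; set f := _ \o chart_map c => fM.
have cc := lie_chartP Gc; have cd := lie_chartP Hd.
have oW' : open (W `&` chart_img c) by apply: openI => //; exact: open_chart_img.
have sP' : smooth_on (W `&` chart_img c) Phi by apply: smooth_on_sub sP => ? [].
have [|U1 [V1 [h1 [[oU1 U11] oV1 U1W [hP1 hP2] sh]]]] :=
  smooth_inverse_function oW' _ sP' uP.
  by split => //; exact: chart_img_map.
pose U0 := [set x | [/\ chart_dom c x, U1 (chart_map c x),
   chart_img d (Phi (chart_map c x)) & O x]].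
have oU0 : open U0.
  have oW1 : open (U1 `&` Phi @^-1` chart_img d).
    apply: open_setI_preimage => //; last exact: open_chart_img.
    by move=> x /U1W[Wx _]; exact: smooth_on_continuous sP Wx.
  rewrite (_ : U0 = (chart_dom c `&` chart_map c @^-1` (U1 `&` Phi @^-1` chart_img d)) `&` O).
    by apply: openI => //; exact: open_chart_preimage.
  by apply/seteqP; split => x; [move=> []|move=> [[? []]]].
have U01 : U0 1%g by split => //; rewrite P1; exact: chart_img_map.
have df x : U0 x -> chart_map d (f x) = Phi (chart_map c x).
  by move=> [_ _ ix _]; rewrite /f /= chart_invK.
have finj x y : U0 x -> U0 y -> f x = f y -> x = y.
  move=> Ux Uy E; have := congr1 (chart_map d) E; rewrite !df//.
  move=> /(congr1 h1); case: Ux => dx Ux _ _; case: Uy => dy Uy _ _.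
  rewrite (hP1 _ Ux).2 (hP1 _ Uy).2 => /(congr1 (chart_inv c)).
  by rewrite !chart_mapK.
have [U [oU U1' UU0 UU]] := square_nbhs1 oU0 U01.
pose h := chart_inv c \o h1 \o chart_map d.
pose V := [set y | [/\ chart_dom d y, V1 (chart_map d y) & U (h y)]].
have hf x : U0 x -> h (f x) = x.
  by move=> Ux; rewrite /h /= df//; case: Ux => dx Ux _ _; rewrite (hP1 _ Ux).2 chart_mapK.
have fV x : U x -> V (f x).
  move=> Ux; have U0x := UU0 _ Ux; split; last by rewrite hf.
    by rewrite /f /=; apply: chart_dom_inv => //; case: U0x.
  by rewrite df//; case: U0x => _ /hP1[].
have h1img v : V1 v -> chart_img c (h1 v) by move=> /hP2[/U1W[]].
have fh y : V y -> f (h y) = y.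
  move=> [dy Vy Uy]; rewrite /f /h /= chart_invK//; last exact: h1img.
  by rewrite (hP2 _ Vy).2 chart_mapK.
have f1 : f 1%g = 1%g by rewrite /f /= P1 chart_mapK.
have oV : open V.
  have oV2 : open (chart_dom d `&` chart_map d @^-1` V1) by exact: open_chart_preimage.
  rewrite (_ : V = (chart_dom d `&` chart_map d @^-1` V1) `&` h @^-1` U).
    apply: open_setI_preimage => // y [dy Vy].
    apply: continuous_comp; first exact: chart_map_continuous.
    apply: continuous_comp; first exact: smooth_on_continuous sh Vy.
    by apply: chart_inv_continuous => //; exact: h1img.
  by apply/seteqP; split => y; [move=> []|move=> [[]]].
exists U, V, f, h; split.
- by split.
- by split; [exact: oV|rewrite -f1; exact: fV].
- split=> [x Ux|y Vy]; first by split; [exact: fV|apply: hf; exact: UU0].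
  by split; [case: Vy|exact: fh].
- split.
    apply: smooth_map_local (lie_atlasP G) (lie_atlasP H) Gc Hd oU sP _.
    by move=> x /UU0[? /U1W[? _]].
  apply: smooth_map_local (lie_atlasP H) (lie_atlasP G) Hd Gc oV sh _.
  by move=> y [? Vy _]; split => //; exact: h1img.
- split=> x y Ux Uy Uxy.
    by apply: fM; [case: (UU0 _ Ux)|case: (UU0 _ Uy)|case: (UU0 _ Uxy)].
  have [_ _ Uhx] := Ux; have [_ _ Uhy] := Uy; have [_ _ Uhxy] := Uxy.
  have U0m := UU _ _ Uhx Uhy.
  apply: finj => //; first exact: UU0.
  rewrite fh// fM ?fh//; [by case: (UU0 _ Uhx)|by case: (UU0 _ Uhy)|by case: U0m].
Qed.

(** * The adjoint representation *)

Section PartialDerivatives.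
Context {R : realType}.

Lemma smooth_cst m n (U : set 'rV[R]_m) (b : 'rV[R]_n) : smooth_on U (fun=> b).
Proof. by move=> k i; exact: Ck_cst. Qed.

Lemma smooth_row_mxl m n (U : set 'rV[R]_m) (b : 'rV[R]_n) :
  smooth_on U (fun y => row_mx y b).
Proof. exact: smooth_row_mx (smooth_id U) (smooth_cst U b). Qed.

Lemma smooth_row_mxr m n (U : set 'rV[R]_n) (a : 'rV[R]_m) :
  smooth_on U (fun y => row_mx a y).
Proof. exact: smooth_row_mx (smooth_cst U a) (smooth_id U). Qed.

Lemma mulmx_jac_row_mxl m n (x u : 'rV[R]_m) (b : 'rV[R]_n) :
  u *m jac (fun y => row_mx y b) x = row_mx u 0.
Proof.
apply/rowP => i; rewrite mulmx_jac; case: (split_ordP i) => j ->.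
  rewrite row_mxEl -[RHS](pd_row u j x); congr pd.
  by apply/funext => y; rewrite row_mxEl.
rewrite row_mxEr mxE -[RHS](pd_cst u (b 0 j) x); congr pd.
by apply/funext => y; rewrite row_mxEr.
Qed.

Lemma mulmx_jac_row_mxr m n (a : 'rV[R]_m) (x u : 'rV[R]_n) :
  u *m jac (fun y => row_mx a y) x = row_mx 0 u.
Proof.
apply/rowP => i; rewrite mulmx_jac; case: (split_ordP i) => j ->.
  rewrite row_mxEl mxE -[RHS](pd_cst u (a 0 j) x); congr pd.
  by apply/funext => y; rewrite row_mxEl.
rewrite row_mxEr -[RHS](pd_row u j x); congr pd.
by apply/funext => y; rewrite row_mxEr.
Qed.

Lemma pd_row_mxl m n (f : 'rV[R]_(m + n) -> R) (x u : 'rV[R]_m) (b : 'rV[R]_n) :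
  differentiable f (row_mx x b) ->
  pd u (fun y => f (row_mx y b)) x = pd (row_mx u 0) f (row_mx x b).
Proof.
move=> df; rewrite -(mulmx_jac_row_mxl x u b).
apply: (pd_comp u (g := fun y => row_mx y b)) => // i.
exact: smooth_on_differentiable (@smooth_row_mxl _ _ setT b) I.
Qed.

Lemma pd_row_mxr m n (f : 'rV[R]_(m + n) -> R) (a : 'rV[R]_m) (x u : 'rV[R]_n) :
  differentiable f (row_mx a x) ->
  pd u (fun y => f (row_mx a y)) x = pd (row_mx 0 u) f (row_mx a x).
Proof.
move=> df; rewrite -(mulmx_jac_row_mxr a x u).
apply: (pd_comp u (g := fun y => row_mx a y)) => // i.
exact: smooth_on_differentiable (@smooth_row_mxr _ _ setT a) I.
Qed.

Lemma pd_conj_mx d n (P Q : 'M[R]_n) (F : 'rV[R]_d -> 'M[R]_n) v x i j :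
  (forall i j, differentiable (fun y => F y i j) x) ->
  pd v (fun y => (P *m F y *m Q) i j) x =
  (P *m (\matrix_(i, j) pd v (fun y => F y i j) x) *m Q) i j.
Proof.
move=> dF.
have dPF k l : differentiable (fun y => (P *m F y) k l) x /\
    pd v (fun y => (P *m F y) k l) x =
    (P *m (\matrix_(i, j) pd v (fun y => F y i j) x)) k l.
  have E : (fun y => (P *m F y) k l) = (fun y => \sum_a F y a l * P k a).
    by apply/funext => y; rewrite mxE; apply: eq_bigr => a _; rewrite mulrC.
  rewrite E; split; first by apply: differentiable_Rsum => a; exact: differentiableMr.
  rewrite pd_sum; last by move=> a; exact: differentiableMr.
  by rewrite mxE; apply: eq_bigr => a _; rewrite pdZ// !mxE mulrC.
have E : (fun y => (P *m F y *m Q) i j) = (fun y => \sum_a (P *m F y) i a * Q a j).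
  by apply/funext => y; rewrite mxE.
rewrite E pd_sum; last by move=> a; apply: differentiableMr; case: (dPF i a).
rewrite mxE; apply: eq_bigr => a _.
by rewrite pdZ ?(dPF i a).2//; case: (dPF i a).
Qed.

End PartialDerivatives.

Section Adjoint.
Context {R : realType} {n : nat}.
Variables (G : lieGroup R n) (c : chart R n G).
Hypotheses (Gc : lie_atlas G c) (c1 : chart_dom c 1%g).

Let phi := chart_map c.
Let psi := chart_inv c.
Let D := chart_img c.
Let y0 := phi 1%g.
Let cc : is_chart c := lie_chartP Gc.

Let psi0 : psi y0 = 1%g. Proof. exact: chart_mapK. Qed.
Let Dy0 : D y0. Proof. exact: chart_img_map. Qed.
Let oD : open D. Proof. exact: open_chart_img. Qed.

Definition chart_mul (z : 'rV[R]_(n + n)) : 'rV[R]_n :=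
  chart_map c (chart_inv c (lsubmx z) * chart_inv c (rsubmx z))%g.

Definition chart_mul_dom : set 'rV[R]_(n + n) :=
  [set z | [/\ chart_img c (lsubmx z), chart_img c (rsubmx z) &
    chart_dom c (chart_inv c (lsubmx z) * chart_inv c (rsubmx z))%g]].

Let Wm := chart_mul_dom.

(** This is the shape of the domain in the smoothness axiom for the multiplication, which then
    applies directly. *)
Lemma chart_mul_domE : Wm = chart_map (prod_chart c c) @`
  (setT `&` chart_dom (prod_chart c c) `&`
   (fun p : G * G => (p.1 * p.2)%g) @^-1` chart_dom c).
Proof.
apply/seteqP; split => [z [Dl Dr Dm]|_ [[x y] [[_ [/= dx dy]] /= dxy] <-]].
  exists (psi (lsubmx z), psi (rsubmx z)) => /=.
    by split => //; split => //; split => /=; exact: chart_dom_inv.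
  by rewrite !chart_invK// hsubmxK.
by rewrite /Wm /chart_mul_dom /= row_mxKl row_mxKr !chart_mapK//; split => //; exact: chart_img_map.
Qed.

Lemma open_chart_mul_dom : open Wm.
Proof.
rewrite chart_mul_domE setTI (setIC (chart_dom _)); apply: open_chart_image.
  exact: prod_chartP.
apply: open_comp => [x _|]; first exact: mulg_continuous.
exact: open_chart_dom.
Qed.

Lemma smooth_chart_mul : smooth_on Wm chart_mul.
Proof.
rewrite chart_mul_domE; case: (lie_axioms G) => _ _ _ [_ MG] _.
apply: (MG (prod_chart c c) c _ Gc).
by exists (c, c).
Qed.

Let Wi : set 'rV[R]_n := [set y | chart_img c y /\ chart_dom c ((psi y)^-1)%g].
Let iota (y : 'rV[R]_n) : 'rV[R]_n := phi ((psi y)^-1)%g.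

Let WiE : Wi = chart_map c @`
  (setT `&` chart_dom c `&` (fun x : G => (x^-1)%g) @^-1` chart_dom c).
Proof.
apply/seteqP; split => [y [Dy Dv]|_ [x [[_ dx] /= dv] <-]].
  by exists (psi y) => //=; [split => //; split => //; exact: chart_dom_inv|rewrite chart_invK].
by split; [exact: chart_img_map|rewrite /psi chart_mapK].
Qed.

Let oWi : open Wi.
Proof.
rewrite WiE setTI (setIC (chart_dom _)); apply: open_chart_image => //.
apply: open_comp => [x _|]; first exact: invg_continuous.
exact: open_chart_dom.
Qed.

Let smooth_iota : smooth_on Wi iota.
Proof.
by rewrite WiE; case: (lie_axioms G) => _ _ _ _ [_ IG]; exact: (IG c c Gc Gc).
Qed.

(** Conjugation in coordinates, built as (x, y) -> (x^-1, y) -> (x^-1 y, x) -> x^-1 y x. It is taken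
    jointly in x and y because Ad must be differentiated in x; W1, W2, W3 keep the intermediate
    products in the chart. *)
Let k1 (z : 'rV[R]_(n + n)) := row_mx (iota (lsubmx z)) (rsubmx z).
Let k2 (z : 'rV[R]_(n + n)) := row_mx (chart_mul (k1 z)) (lsubmx z).
Let W1 : set 'rV[R]_(n + n) := setT `&` lsubmx @^-1` Wi.
Let W2 := W1 `&` k1 @^-1` Wm.
Let W3 := W2 `&` k2 @^-1` Wm.
Let Psi := chart_mul \o k2.

Let oW1 : open W1.
Proof.
apply: open_setI_preimage oWi; first exact: openT.
by move=> z _; exact: smooth_on_continuous (smooth_lsubmx setT) I.
Qed.

Let sk1 : smooth_on W1 k1.
Proof.
apply: smooth_row_mx (smooth_rsubmx _).
by apply: smooth_on_comp oW1 _ (smooth_lsubmx _) smooth_iota => z [].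
Qed.

Let oW2 : open W2.
Proof.
by apply: (open_setI_preimage oW1 _ open_chart_mul_dom) => z; exact: smooth_on_continuous sk1.
Qed.

Let sk2 : smooth_on W2 k2.
Proof.
apply: smooth_row_mx (smooth_lsubmx _).
apply: smooth_on_comp oW2 _ (smooth_on_sub _ sk1) smooth_chart_mul; first by move=> z [].
by move=> z [].
Qed.

Let oW3 : open W3.
Proof.
by apply: (open_setI_preimage oW2 _ open_chart_mul_dom) => z; exact: smooth_on_continuous sk2.
Qed.

Let sPsi : smooth_on W3 Psi.
Proof.
apply: smooth_on_comp oW3 _ (smooth_on_sub _ sk2) smooth_chart_mul; first by move=> z [].
by move=> z [].
Qed.

(** Stable under inversion, so that g and its inverse both have coordinates in the single chart
    [c]. *)
Definition adjoint_dom : set G := [set x | chart_dom c x /\ chart_dom c (x^-1)%g].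
Let O := adjoint_dom.

Let W3P (x y : G) : O x -> chart_dom c y -> chart_dom c (x^-1 * y)%g ->
  chart_dom c (x^-1 * y * x)%g -> W3 (row_mx (phi x) (phi y)) /\
  Psi (row_mx (phi x) (phi y)) = phi (x^-1 * y * x)%g.
Proof.
move=> [dx dx'] dy dxy dxyx.
have i1 : iota (phi x) = phi (x^-1)%g by rewrite /iota /psi chart_mapK.
have e1 : k1 (row_mx (phi x) (phi y)) = row_mx (phi (x^-1)%g) (phi y).
  by rewrite /k1 row_mxKl row_mxKr i1.
have mE a b : chart_dom c a -> chart_dom c b ->
    chart_mul (row_mx (phi a) (phi b)) = phi (a * b)%g.
  by move=> da db; rewrite /chart_mul row_mxKl row_mxKr !chart_mapK.
have mW a b : chart_dom c a -> chart_dom c b -> chart_dom c (a * b)%g ->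
    Wm (row_mx (phi a) (phi b)).
  by move=> da db dab; split; rewrite ?row_mxKl ?row_mxKr ?chart_mapK//; exact: chart_img_map.
have e2 : k2 (row_mx (phi x) (phi y)) = row_mx (phi (x^-1 * y)%g) (phi x).
  by rewrite /k2 e1 mE// row_mxKl.
split; last by rewrite /Psi /= e2 mE.
split; last by rewrite /= e2; exact: mW.
split; last by rewrite /= e1; exact: mW.
split; first exact: I.
by rewrite /= row_mxKl; split; [exact: chart_img_map|rewrite /psi chart_mapK].
Qed.

Definition chart_conj (g : G) (y : 'rV[R]_n) : 'rV[R]_n :=
  chart_map c (g^-1 * chart_inv c y * g)%g.

(* The matrix of Ad(g^-1) acting on row vectors, so that [adjoint] is
   multiplicative. *)
Definition adjoint (g : G) : 'M[R]_n := jac (chart_conj g) (chart_map c 1%g).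

Lemma open_adjoint_dom : open O.
Proof.
apply: open_setI_preimage (open_chart_dom cc); first exact: open_chart_dom.
by move=> x _; exact: invg_continuous.
Qed.

Let O1 : O 1%g. Proof. by rewrite /O /adjoint_dom /= invg1. Qed.

Let OV g : O g -> O (g^-1)%g. Proof. by move=> [? ?]; split; rewrite ?invgK. Qed.

Let mulg_cont (F F' : 'rV[R]_n -> G) y : {for y, continuous F} -> {for y, continuous F'} ->
  {for y, continuous (fun y => F y * F' y)%g}.
Proof.
move=> cF cF'; apply: (@continuous_comp _ _ _ (fun y => (F y, F' y)) (fun p : G * G => (p.1 * p.2)%g)).
  exact: (@cvg_pair _ _ _ (nbhs y) (nbhs _) (nbhs _)).
exact: mulg_continuous.
Qed.

Let psi_cont : {for y0, continuous psi}.
Proof. exact: chart_inv_continuous. Qed.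

Let psi_near (A : set G) : open A -> A 1%g -> \forall y \near y0, A (psi y).
Proof. by move=> oA A1; apply: psi_cont; rewrite psi0; exact: open_nbhs_nbhs. Qed.

Let mulg_near g h (A : set G) : open A -> A (g * h)%g -> \forall y \near y0, A (g * psi y * h)%g.
Proof.
move=> oA Agh.
have C : {for y0, continuous (fun y => (g * psi y) * h)%g}.
  apply: mulg_cont; last exact: cst_continuous.
  by apply: mulg_cont psi_cont; exact: cst_continuous.
by apply: C; rewrite /= psi0 mulg1; exact: open_nbhs_nbhs.
Qed.

Let D_near : \forall y \near y0, D y.
Proof. exact: open_nbhs_nbhs. Qed.

Let conj_dom_near g : O g -> \forall y \near y0,
  W3 (row_mx (phi g) y) /\ chart_conj g y = Psi (row_mx (phi g) y).
Proof.
move=> Og; have od := open_chart_dom cc.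
have n1 := mulg_near (g := (g^-1)%g) (h := 1%g) od.
have n2 := mulg_near (g := (g^-1)%g) (h := g) od.
have {}n1 : \forall y \near y0, chart_dom c (g^-1 * psi y * 1)%g.
  by apply: n1; rewrite mulg1; case: Og.
have {}n2 : \forall y \near y0, chart_dom c (g^-1 * psi y * g)%g.
  by apply: n2; rewrite mulVg.
apply: filterS2 D_near (filterI n1 n2) => y Dy [].
rewrite mulg1 => d1 d2; have dy := chart_dom_inv cc Dy.
have [h1 h2] := W3P Og dy d1 d2.
by move: h1 h2; rewrite /phi chart_invK.
Qed.

Let dPsi y i : W3 y -> differentiable (fun y => Psi y 0 i) y.
Proof. exact: smooth_on_differentiable. Qed.

Let O_W3 g : O g -> W3 (row_mx (phi g) y0).
Proof. by move=> /conj_dom_near /nbhs_singleton[]. Qed.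

Let dconj_aux g i : O g -> differentiable (fun y => chart_conj g y 0 i) y0 /\
  forall v, pd v (fun y => chart_conj g y 0 i) y0 =
            pd (row_mx 0 v) (fun z => Psi z 0 i) (row_mx (phi g) y0).
Proof.
move=> Og; have nC := conj_dom_near Og.
have dP : differentiable (fun y => Psi (row_mx (phi g) y) 0 i) y0.
  apply: (@differentiable_comp _ _ _ _ (fun y => row_mx (phi g) y) (fun z => Psi z 0 i)).
    by apply: (differentiable_rV _).1 => j; exact: smooth_on_differentiable (@smooth_row_mxr _ _ _ setT _) I.
  by apply: dPsi; exact: O_W3.
have nE : \forall y \near y0, Psi (row_mx (phi g) y) 0 i = chart_conj g y 0 i.
  by apply: filterS nC => y [_ ->].
split; first by have [] := near_eq_diff nE dP.
move=> v; rewrite (pd_near v dP nE).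
by apply: (pd_row_mxr (f := fun z => Psi z 0 i)); apply: dPsi; exact: O_W3.
Qed.

Let dconj g i : O g -> differentiable (fun y => chart_conj g y 0 i) y0.
Proof. by move=> /(dconj_aux i)[]. Qed.

Let conj0 g : chart_conj g y0 = y0.
Proof. by rewrite /chart_conj -/psi psi0 mulg1 mulVg. Qed.

(** Conjugation by g h is conjugation by g followed by conjugation by h, both fixing the identity;
    the chain rule for rows keeps this order. *)
Lemma adjointM g h : O g -> O h -> adjoint (g * h)%g = adjoint g *m adjoint h.
Proof.
move=> Og Oh.
have dh i : differentiable (fun y => chart_conj h y 0 i) (chart_conj g y0).
  by rewrite conj0; exact: dconj.
have -> : adjoint h = jac (chart_conj h) (chart_conj g y0) by rewrite conj0.
rewrite /adjoint -(jac_comp (fun i => dconj i Og) dh).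
apply: jac_near => [i|].
  rewrite (_ : (fun y => _) = (fun y => chart_conj h y 0 i) \o chart_conj g)//.
  by apply: differentiable_comp => //; apply: (differentiable_rV _).1 => j; exact: dconj.
have nC : \forall y \near y0, chart_dom c (g^-1 * psi y * g)%g.
  by apply: mulg_near; [exact: open_chart_dom|rewrite mulVg].
apply: filterS nC => y dy; rewrite /chart_conj /= chart_mapK// invgM.
by rewrite !mulgA.
Qed.

Lemma adjoint1 : adjoint 1%g = 1%:M.
Proof.
rewrite -(jac_id y0); apply: jac_near => [i|]; first exact: differentiable_row.
by apply: filterS D_near => y Dy; rewrite /chart_conj invg1 mulg1 mul1g chart_invK.
Qed.

Lemma adjointVM g : O g -> adjoint (g^-1)%g *m adjoint g = 1%:M.
Proof. by move=> Og; rewrite -adjointM ?mulVg ?adjoint1//; exact: OV. Qed.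

Let oOD : open (D `&` psi @^-1` O).
Proof. by apply: open_chart_inv_preimage => //; exact: open_adjoint_dom. Qed.

(** The entries are derivatives of the joint map [Psi] in its second argument at the identity, hence
    smooth in the first. *)
Lemma Ck_adjoint k i j :
  Ck k (chart_img c `&` chart_inv c @^-1` O) (fun y => adjoint (chart_inv c y) i j).
Proof.
have C : Ck k (D `&` psi @^-1` O)
    (pd (row_mx 0 (delta_mx 0 i)) (fun z => Psi z 0 j) \o (fun y => row_mx y y0)).
  apply: (Ck_comp (V := W3)) => //.
  - by move=> y [Dy /O_W3]; rewrite /phi /psi chart_invK.
  - exact: (smooth_row_mxl _ y0 k).
  - exact: (sPsi k.+1 j).2.
apply: Ck_eq oOD _ C => y [Dy Oy].
by rewrite [RHS]mxE (dconj_aux j Oy).2 /phi /psi chart_invK.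
Qed.

(** The Lie bracket: [u *m dadjoint v] is [u, v], the sign being due to the inverse in [adjoint]. *)
Definition dadjoint (v : 'rV[R]_n) : 'M[R]_n :=
  \matrix_(i, j) pd v (fun y => adjoint (chart_inv c y) i j) (chart_map c 1%g).

Let OD0 : (D `&` psi @^-1` O) y0.
Proof. by split => //; rewrite /= psi0. Qed.

Let dAd i j : differentiable (fun y => adjoint (psi y) i j) y0.
Proof. exact: (Ck_adjoint 1 i j).1. Qed.

(** Differentiate [adjoint] of g^-1 x g, a product of three matrices, at x = 1: this is the
    invariance of the bracket under Ad. *)
Lemma dadjoint_adjoint g v : O g ->
  dadjoint (v *m adjoint g) = adjoint (g^-1)%g *m dadjoint v *m adjoint g.
Proof.
move=> Og; apply/matrixP => i j.
rewrite -(pd_conj_mx (F := fun y => adjoint (psi y)) _ _ v i j dAd) [LHS]mxE.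
have := pd_comp v (g := chart_conj g) (f := fun y => adjoint (psi y) i j) (x := y0).
rewrite conj0 => <-; [|by move=> k; exact: dconj|exact: dAd].
have dF : differentiable (fun y => (adjoint (g^-1)%g *m adjoint (psi y) *m adjoint g) i j) y0.
  rewrite (_ : (fun y => _) = fun y => \sum_b (\sum_a adjoint (psi y) a b * adjoint (g^-1)%g i a) * adjoint g b j).
    apply: differentiable_Rsum => b; apply: differentiableMr.
    by apply: differentiable_Rsum => a; exact: differentiableMr.
  apply/funext => y; rewrite mxE; apply: eq_bigr => b _; rewrite mxE.
  by congr (_ * _); apply: eq_bigr => a _; rewrite mulrC.
apply: pd_near dF _.
have n1 : \forall y \near y0, O (psi y).
  by apply: psi_near => //; exact: open_adjoint_dom.
have n2 : \forall y \near y0, O (g^-1 * psi y * 1)%g.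
  by apply: mulg_near; [exact: open_adjoint_dom|rewrite mulg1; exact: OV].
have n3 : \forall y \near y0, chart_dom c (g^-1 * psi y * g)%g.
  by apply: mulg_near; [exact: open_chart_dom|rewrite mulVg].
apply: filterS2 n1 (filterI n2 n3) => y Oy []; rewrite mulg1 => Ogy dy.
rewrite /= /chart_conj /psi chart_mapK// adjointM// adjointM//.
exact: OV.
Qed.

(** The differential of left translation by g at the identity is the derivative of [chart_mul] in
    its second argument. *)
Lemma covec_left_invariant (w : form1 G) g v : left_invariant w -> chart_dom c g ->
  covec_app (w c y0) v = covec_app (w c (phi g))
    (\row_i pd (row_mx 0 v) (fun z => chart_mul z 0 i) (row_mx (phi g) y0)).
Proof.
move=> [_ /(_ g) H] dg; rewrite (H c c 1%g)//; last by rewrite mulg1.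
rewrite /= mulg1; congr covec_app; apply/rowP => i; rewrite mxE.
have W : Wm (row_mx (phi g) y0).
  split; rewrite ?row_mxKl ?row_mxKr//; first exact: chart_img_map.
  by rewrite -/psi psi0 mulg1 /psi chart_mapK.
have dm j : differentiable (fun z => chart_mul z 0 j) (row_mx (phi g) y0).
  exact: smooth_on_differentiable smooth_chart_mul W.
have E : phi \o (fun x => g * x)%g \o psi = fun y => chart_mul (row_mx (phi g) y).
  by apply/funext => y; rewrite /chart_mul row_mxKl row_mxKr /= chart_mapK.
rewrite -/phi -/psi -/y0 E -(pd_row_mxr (f := fun z => chart_mul z 0 i))//.
have dg' j : differentiable (fun y => chart_mul (row_mx (phi g) y) 0 j) y0.
  apply: (@differentiable_comp _ _ _ _ (fun y => row_mx (phi g) y) (fun z => chart_mul z 0 j)) => //.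
  apply: (differentiable_rV _).1 => l; exact: smooth_on_differentiable (@smooth_row_mxr _ _ _ setT _) I.
exact: (differentiable_rV dg').2.
Qed.

Let W00 : Wm (row_mx y0 y0).
Proof. by split; rewrite ?row_mxKl ?row_mxKr// -/psi psi0 mulg1. Qed.

Let Wy0 y : D y -> Wm (row_mx y y0) /\ Wm (row_mx y0 y).
Proof.
move=> Dy; split; split; rewrite ?row_mxKl ?row_mxKr// -/psi psi0 ?mulg1 ?mul1g; exact: chart_dom_inv.
Qed.

Let dmul z i : Wm z -> differentiable (fun z => chart_mul z 0 i) z.
Proof. exact: smooth_on_differentiable smooth_chart_mul. Qed.

(** Right translation by y is a conjugation followed by left translation by y, x y = y (y^-1 x y),
    and w absorbs the left translation. *)
Lemma covec_adjoint (w : form1 G) u y : left_invariant w -> D y -> O (psi y) ->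
  covec_app (w c y) (\row_i pd (row_mx u 0) (fun z => chart_mul z 0 i) (row_mx y0 y)) =
  covec_app (w c y0) (u *m adjoint (psi y)).
Proof.
move=> lw Dy Oy; have [dy _] := Oy.
rewrite (covec_left_invariant (u *m adjoint (psi y)) lw dy) /phi /psi chart_invK//.
congr covec_app; apply/rowP => i; rewrite !mxE.
have [Wy Wy'] := Wy0 Dy.
rewrite -(pd_row_mxl (f := fun z => chart_mul z 0 i)); last exact: dmul.
rewrite -(pd_row_mxr (f := fun z => chart_mul z 0 i)); last exact: dmul.
have dL : differentiable (fun y' => chart_mul (row_mx y y') 0 i) (chart_conj (psi y) y0).
  rewrite conj0.
  apply: (@differentiable_comp _ _ _ _ (fun y' => row_mx y y') (fun z => chart_mul z 0 i)); last exact: dmul.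
  by apply: (differentiable_rV _).1 => l; exact: smooth_on_differentiable (@smooth_row_mxr _ _ _ setT _) I.
have dC j : differentiable (fun y' => chart_conj (psi y) y' 0 j) y0 by exact: dconj.
rewrite -[X in pd _ _ X = _]/y0 -[X in _ = pd _ _ X](conj0 (psi y)).
rewrite -(pd_comp u (g := chart_conj (psi y)) (f := fun y' => chart_mul (row_mx y y') 0 i) dC dL).
apply: pd_near.
  apply: differentiable_comp dL.
  by apply: (differentiable_rV _).1 => j; exact: dC.
have nC : \forall y' \near y0, chart_dom c ((psi y)^-1 * psi y' * psi y)%g.
  by apply: mulg_near; [exact: open_chart_dom|rewrite mulVg].
apply: filterS nC => y' dy'; rewrite /= /chart_mul !row_mxKl !row_mxKr /chart_conj.
by rewrite chart_mapK// !mulgA mulgV mul1g.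
Qed.

(** Write dL and dR for the differentials of translations. Differentiate along u the constant w(dL_y
    v), and along v the function w(dR_y u) given by [covec_adjoint]. Both contain the same mixed
    second derivative of the multiplication, which cancels by [pdC] in the difference. *)
Lemma covec_dadjoint (w : form1 G) u v : left_invariant w ->
  covec_app (w c y0) (u *m dadjoint v) =
  \sum_i (u 0 i * pd v (fun y => w c y 0 i) y0 - v 0 i * pd u (fun y => w c y 0 i) y0).
Proof.
move=> lw; pose wc i y := w c y 0 i.
have sw : smooth_on D (w c) by case: lw => [[H _] _]; exact: H.
have dw i : differentiable (wc i) y0 by exact: smooth_on_differentiable sw Dy0.
have Cm i : Ck 2 Wm (fun z => chart_mul z 0 i) by exact: smooth_chart_mul.
have dpd (a : 'rV[R]_(n + n)) i : differentiable (pd a (fun z => chart_mul z 0 i)) (row_mx y0 y0).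
  by apply: ((Cm i).2 a).1; exact: W00.
(* a is the left invariant vector field through v, and b the right invariant one through u. *)
pose a i y := pd (row_mx 0 v) (fun z => chart_mul z 0 i) (row_mx y y0).
pose b i y := pd (row_mx u 0) (fun z => chart_mul z 0 i) (row_mx y0 y).
have [da Da] : (forall i, differentiable (a i) y0) /\ forall i, pd u (a i) y0 =
    pd (row_mx u 0) (pd (row_mx 0 v) (fun z => chart_mul z 0 i)) (row_mx y0 y0).
  split=> i; last exact: (pd_row_mxl (f := pd (row_mx 0 v) (fun z => chart_mul z 0 i))).
  apply: (@differentiable_comp _ _ _ _ (fun y => row_mx y y0) (pd (row_mx 0 v) (fun z => chart_mul z 0 i))) => //.
  by apply: (differentiable_rV _).1 => l; exact: smooth_on_differentiable (@smooth_row_mxl _ _ _ setT _) I.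
have [db Db] : (forall i, differentiable (b i) y0) /\ forall i, pd v (b i) y0 =
    pd (row_mx 0 v) (pd (row_mx u 0) (fun z => chart_mul z 0 i)) (row_mx y0 y0).
  split=> i; last exact: (pd_row_mxr (f := pd (row_mx u 0) (fun z => chart_mul z 0 i))).
  apply: (@differentiable_comp _ _ _ _ (fun y => row_mx y0 y) (pd (row_mx u 0) (fun z => chart_mul z 0 i))) => //.
  by apply: (differentiable_rV _).1 => l; exact: smooth_on_differentiable (@smooth_row_mxr _ _ _ setT _) I.
have a0 i : a i y0 = v 0 i.
  rewrite /a -(pd_row_mxr (f := fun z => chart_mul z 0 i)); last exact: dmul.
  rewrite -[RHS](pd_row v i y0); apply: pd_near; first exact: differentiable_row.
  apply: filterS D_near => y Dy.
  by rewrite /chart_mul row_mxKl row_mxKr -/psi psi0 mul1g /psi chart_invK.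
have b0 i : b i y0 = u 0 i.
  rewrite /b -(pd_row_mxl (f := fun z => chart_mul z 0 i)); last exact: dmul.
  rewrite -[RHS](pd_row u i y0); apply: pd_near; first exact: differentiable_row.
  apply: filterS D_near => y Dy.
  by rewrite /chart_mul row_mxKl row_mxKr -/psi psi0 mulg1 /psi chart_invK.
have pd_pair x (e : 'I_n -> 'rV[R]_n -> R) : (forall i, differentiable (e i) y0) ->
    pd x (fun y => \sum_i wc i y * e i y) y0 =
    \sum_i (wc i y0 * pd x (e i) y0 + e i y0 * pd x (wc i) y0).
  move=> de; rewrite pd_sum; last by move=> i; exact: (differentiableM (dw i) (de i)).
  by apply: eq_bigr => i _; rewrite pdM.
have E1 : \sum_i (wc i y0 * pd u (a i) y0 + a i y0 * pd u (wc i) y0) = 0.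
  rewrite -(pd_pair u a da) -[RHS](pd_cst u (covec_app (w c y0) v) y0).
  apply: pd_near; first exact: differentiable_cst.
  apply: filterS D_near => y Dy; have dy := chart_dom_inv cc Dy.
  rewrite (covec_left_invariant v lw dy) /phi chart_invK//.
  by apply: eq_bigr => i _; rewrite mxE.
have E2 : \sum_i (wc i y0 * pd v (b i) y0 + b i y0 * pd v (wc i) y0) =
    covec_app (w c y0) (u *m dadjoint v).
  have dA i : differentiable (fun y => \sum_k adjoint (psi y) k i * u 0 k) y0.
    by apply: differentiable_Rsum => k; exact: differentiableMr.
  rewrite -(pd_pair v b db).
  transitivity (pd v (fun y => \sum_i (\sum_k adjoint (psi y) k i * u 0 k) * wc i y0) y0).
    apply: pd_near.
      by apply: differentiable_Rsum => i; exact: differentiableMr.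
    have n1 : \forall y \near y0, O (psi y).
      by apply: psi_near => //; exact: open_adjoint_dom.
    apply: filterS2 D_near n1 => y Dy Oy.
    transitivity (covec_app (w c y0) (u *m adjoint (psi y))).
      apply: eq_bigr => i _; rewrite mxE mulrC; congr (_ * _).
      by apply: eq_bigr => k _; rewrite mulrC.
    rewrite -(covec_adjoint u lw Dy Oy).
    by apply: eq_bigr => i _; rewrite mxE.
  rewrite pd_sum; last by move=> i; exact: differentiableMr.
  apply: eq_bigr => i _; rewrite pdZ// mulrC pd_sum; last by move=> k; exact: differentiableMr.
  rewrite mxE; congr (_ * _); apply: eq_bigr => k _.
  by rewrite pdZ// mxE mulrC.
rewrite -E2 -[LHS]subr0 -[X in _ - X]E1 -sumrB; apply: eq_bigr => i _.
rewrite Da Db a0 b0 (pdC (row_mx u 0) (row_mx 0 v) open_chart_mul_dom (Cm i) W00).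
rewrite -/(wc i); ring.
Qed.

(** The Maurer-Cartan formula dw(v, u) = - w([v, u]) at the identity; it converts structure
    equations into brackets. *)
Lemma ext_d_dadjoint (w : form1 G) u v : left_invariant w ->
  covec_app (w c y0) (u *m dadjoint v) = (v *m ext_d w c y0 *m u^T) 0 0.
Proof.
move=> lw; rewrite covec_dadjoint//; pose wc i y := w c y 0 i.
have sw : smooth_on D (w c) by case: lw => [[H _] _]; exact: H.
have dw i : differentiable (wc i) y0 by exact: smooth_on_differentiable sw Dy0.
have E i j : ext_d w c y0 i j = pd (delta_mx 0 i) (wc j) y0 - pd (delta_mx 0 j) (wc i) y0.
  by rewrite mxE !deriveE//; exact: dw.
rewrite mxE.
under [RHS]eq_bigr => j _.
  rewrite !mxE.
  under eq_bigr => i _ do rewrite E mulrBr.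
  rewrite sumrB -pd_linear mulrBl.
  over.
rewrite [LHS]sumrB [RHS]sumrB; congr (_ - _).
  by apply: eq_bigr => j _; rewrite mulrC.
under eq_bigr => i _ do rewrite pd_linear mulr_sumr.
rewrite exchange_big /=; apply: eq_bigr => j _.
rewrite mulr_suml; apply: eq_bigr => i _; ring.
Qed.

End Adjoint.

(** * Rotations and quaternions *)

Section CrossProduct.
Context {R : realType}.
Implicit Types (x y z : 'rV[R]_3) (P : 'M[R]_3).

Definition row3 (a b c : R) : 'rV[R]_3 := \row_(i < 3) [:: a; b; c]`_i.

Lemma row3_0 a b c : row3 a b c 0 0 = a. Proof. by rewrite mxE. Qed.
Lemma row3_1 a b c : row3 a b c 0 1 = b. Proof. by rewrite mxE. Qed.
Lemma row3_2 a b c : row3 a b c 0 2 = c. Proof. by rewrite mxE. Qed.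
Definition row3E := (row3_0, row3_1, row3_2).

Definition cross x y : 'rV[R]_3 :=
  row3 (x 0 1 * y 0 2 - x 0 2 * y 0 1) (x 0 2 * y 0 0 - x 0 0 * y 0 2)
       (x 0 0 * y 0 1 - x 0 1 * y 0 0).

Lemma cross0r x : cross x 0 = 0.
Proof. by apply/rowP; apply: forall_ord3; rewrite !row3E !mxE; ring. Qed.

Lemma cross0l x : cross 0 x = 0.
Proof. by apply/rowP; apply: forall_ord3; rewrite !row3E !mxE; ring. Qed.

Lemma cross_eq0 x : (forall z, cross z x = 0) -> x = 0.
Proof.
move=> H; have h0 := H (row3 1 0 0); have h1 := H (row3 0 1 0).
have e i := congr1 (fun v : 'rV[R]_3 => v 0 i) h0.
have e' i := congr1 (fun v : 'rV[R]_3 => v 0 i) h1.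
move: (e 1) (e 2) (e' 2); rewrite /= !row3E !mxE => a b d.
by apply/rowP; apply: forall_ord3; rewrite mxE; lra.
Qed.

Lemma row3_mulmx a b c P : row3 a b c *m P =
  row3 (a * P 0 0 + b * P 1 0 + c * P 2 0) (a * P 0 1 + b * P 1 1 + c * P 2 1)
       (a * P 0 2 + b * P 1 2 + c * P 2 2).
Proof. by apply/rowP; apply: forall_ord3; rewrite mxE sum_ord3 !row3E. Qed.

Definition cross_preserving P := forall x y, cross (x *m P) (y *m P) = cross x y *m P.

(** As for the standard basis, each row of P is the cross product of the next two in cyclic order: P
    is its own cofactor matrix. *)
Lemma cross_preserving_cofactor P : cross_preserving P ->
  [/\ [/\ P 0 0 = P 1 1 * P 2 2 - P 1 2 * P 2 1, P 0 1 = P 1 2 * P 2 0 - P 1 0 * P 2 2 &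
      P 0 2 = P 1 0 * P 2 1 - P 1 1 * P 2 0],
   [/\ P 1 0 = P 2 1 * P 0 2 - P 2 2 * P 0 1, P 1 1 = P 2 2 * P 0 0 - P 2 0 * P 0 2 &
      P 1 2 = P 2 0 * P 0 1 - P 2 1 * P 0 0] &
   [/\ P 2 0 = P 0 1 * P 1 2 - P 0 2 * P 1 1, P 2 1 = P 0 2 * P 1 0 - P 0 0 * P 1 2 &
      P 2 2 = P 0 0 * P 1 1 - P 0 1 * P 1 0]].
Proof.
move=> H.
have e x y i := congr1 (fun v : 'rV[R]_3 => v 0 i) (H x y).
have e0 i := e (row3 0 1 0) (row3 0 0 1) i.
have e1 i := e (row3 0 0 1) (row3 1 0 0) i.
have e2 i := e (row3 1 0 0) (row3 0 1 0) i.
rewrite /= /cross !row3_mulmx !row3E in e0 e1 e2.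
split; split.
- by move: (e0 0); rewrite !row3E; lra.
- by move: (e0 1); rewrite !row3E; lra.
- by move: (e0 2); rewrite !row3E; lra.
- by move: (e1 0); rewrite !row3E; lra.
- by move: (e1 1); rewrite !row3E; lra.
- by move: (e1 2); rewrite !row3E; lra.
- by move: (e2 0); rewrite !row3E; lra.
- by move: (e2 1); rewrite !row3E; lra.
- by move: (e2 2); rewrite !row3E; lra.
Qed.

(** The rows are cross products of one another, hence orthogonal, with squared norms all equal to
    the determinant N. Then N = N^2, and invertibility excludes N = 0. *)
Lemma cross_preserving_orthogonal P : P \in unitmx -> cross_preserving P ->
  P *m P^T = 1%:M.
Proof.
move=> uP /cross_preserving_cofactor[[a00 a01 a02] [a10 a11 a12] [a20 a21 a22]].
pose N i := P i 0 * P i 0 + P i 1 * P i 1 + P i 2 * P i 2.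
pose S i j := P i 0 * P j 0 + P i 1 * P j 1 + P i 2 * P j 2.
have SC i j : S i j = S j i by rewrite /S; ring.
have S01 : S 0 1 = 0 by rewrite /S a10 a11 a12; ring.
have S02 : S 0 2 = 0 by rewrite /S a20 a21 a22; ring.
have S12 : S 1 2 = 0 by rewrite /S a20 a21 a22; ring.
have N0d : S 0 0 = P 0 0 * (P 1 1 * P 2 2 - P 1 2 * P 2 1) +
    P 0 1 * (P 1 2 * P 2 0 - P 1 0 * P 2 2) + P 0 2 * (P 1 0 * P 2 1 - P 1 1 * P 2 0).
  by rewrite -a00 -a01 -a02.
have N01 : S 0 0 = S 1 1.
  rewrite N0d [RHS](_ : _ = P 1 0 * (P 2 1 * P 0 2 - P 2 2 * P 0 1) +
    P 1 1 * (P 2 2 * P 0 0 - P 2 0 * P 0 2) + P 1 2 * (P 2 0 * P 0 1 - P 2 1 * P 0 0)).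
    by ring.
  by rewrite -a10 -a11 -a12.
have N02 : S 0 0 = S 2 2.
  rewrite N0d [RHS](_ : _ = P 2 0 * (P 0 1 * P 1 2 - P 0 2 * P 1 1) +
    P 2 1 * (P 0 2 * P 1 0 - P 0 0 * P 1 2) + P 2 2 * (P 0 0 * P 1 1 - P 0 1 * P 1 0)).
    by ring.
  by rewrite -a20 -a21 -a22.
(* Lagrange's identity for row 0 as the cross product of rows 1 and 2 *)
have NN : S 0 0 = S 1 1 * S 2 2 - S 1 2 ^+ 2.
  by rewrite {1}/S a00 a01 a02 /S; ring.
have N0 : S 0 0 != 0.
  apply/eqP => E; move: uP; rewrite -row_free_unit -kermx_eq0 => /eqP K.
  have : row3 1 0 0 *m P = 0.
    have sq j : 0 <= P 0 j * P 0 j by rewrite -expr2 sqr_ge0.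
    have s0 := sq 0; have s1 := sq 1; have s2 := sq 2; rewrite /S in E.
    have z (u : R) : u * u = 0 -> u = 0.
      by move=> /eqP; rewrite mulf_eq0 orbb => /eqP.
    have h0 : P 0 0 = 0 by apply: z; lra.
    have h1 : P 0 1 = 0 by apply: z; lra.
    have h2 : P 0 2 = 0 by apply: z; lra.
    rewrite row3_mulmx h0 h1 h2; apply/rowP; apply: forall_ord3; rewrite row3E mxE; ring.
  move=> /sub_kermxP; rewrite K submx0 => /eqP/(congr1 (fun v : 'rV[R]_3 => v 0 0)).
  by rewrite row3E mxE; lra.
have N1 : S 0 0 = 1.
  by apply: (mulfI N0); rewrite mulr1 [RHS]NN S12 -N01 -N02; ring.
have PE i j : (P *m P^T) i j = S i j.
  by rewrite mxE sum_ord3 !mxE.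
apply/matrixP => i j; rewrite PE [RHS]mxE.
move: i j; apply: forall_ord3; apply: forall_ord3 => /=.
- by rewrite N1.
- by rewrite S01.
- by rewrite S02.
- by rewrite SC S01.
- by rewrite -N01 N1.
- by rewrite S12.
- by rewrite SC S02.
- by rewrite SC S12.
- by rewrite -N02 N1.
Qed.

End CrossProduct.

Section RotationQuaternion.
Context {R : realType}.
Implicit Types (p q : 'rV[R]_4) (P : 'M[R]_3).

(* The matrix of x |-> q x q^-1 on columns; on rows it acts as x |-> q^-1 x q. *)
Definition rot_rows q : seq (seq R) :=
  let: (a, b, c, d) := (q 0 0, q 0 1, q 0 2, q 0 3) in
  [:: [:: a ^+ 2 + b ^+ 2 - c ^+ 2 - d ^+ 2; 2 * (b * c - a * d); 2 * (b * d + a * c)];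
      [:: 2 * (b * c + a * d); a ^+ 2 - b ^+ 2 + c ^+ 2 - d ^+ 2; 2 * (c * d - a * b)];
      [:: 2 * (b * d - a * c); 2 * (c * d + a * b); a ^+ 2 - b ^+ 2 - c ^+ 2 + d ^+ 2]].

Definition rot q : 'M[R]_3 := \matrix_(i, j) (nth [::] (rot_rows q) i)`_j.

Lemma rotM p q : rot (qmul p q) = rot p *m rot q.
Proof.
apply/matrixP; apply: forall_ord3; apply: forall_ord3;
  rewrite mxE [RHS]mxE sum_ord3 !mxE /= !quatE; ring.
Qed.

Lemma trace3 P : \tr P = P 0 0 + P 1 1 + P 2 2.
Proof. by rewrite /mxtrace sum_ord3. Qed.

(** If P = [rot q] with q = (a, b, c, d) a unit quaternion, then 1 + tr P = 4 a^2 and the three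
    differences of entries are 4ab, 4ac, 4ad. So t = 2a when a > 0: the square root selects one of q
    and -q. *)
Definition quat_of P : 'rV[R]_4 :=
  let t := Num.sqrt (1 + \tr P) in
  quat (t / 2) ((P 2 1 - P 1 2) / (2 * t)) ((P 0 2 - P 2 0) / (2 * t))
    ((P 1 0 - P 0 1) / (2 * t)).

Lemma quat_of_rot q : unit_quat R q -> 0 < q 0 0 -> quat_of (rot q) = q.
Proof.
move=> /unit_quatE hq q0; rewrite /quat_of trace3.
have -> : 1 + (rot q 0 0 + rot q 1 1 + rot q 2 2) = (2 * q 0 0) ^+ 2.
  by rewrite !mxE /= -[X in X + _]hq; ring.
rewrite sqrtr_sqr ger0_norm; last by rewrite mulr_ge0// ltW.
have q00 : q 0 0 != 0 by rewrite gt_eqF.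
by apply/rowP; apply: forall_ord4; rewrite !quatE ?mxE /=; field.
Qed.

(** The entries of [rot q] are linear in the ten products of two components of q, so these are
    expressed through P: those with a by definition, the others by orthogonality and the cofactor
    relations after multiplication by 4 t^2. *)
Lemma rot_quat_of P : P \in unitmx -> cross_preserving P -> 0 < 1 + \tr P ->
  unit_quat R (quat_of P) /\ rot (quat_of P) = P.
Proof.
move=> uP cP sP; have PT := cross_preserving_orthogonal uP cP.
have TP : P^T *m P = 1%:M by exact: mulmx1C.
have r i j : P i 0 * P j 0 + P i 1 * P j 1 + P i 2 * P j 2 = (i == j)%:R.
  by move/matrixP: PT => /(_ i j); rewrite mxE sum_ord3 !mxE.
have cl i j : P 0 i * P 0 j + P 1 i * P 1 j + P 2 i * P 2 j = (i == j)%:R.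
  by move/matrixP: TP => /(_ i j); rewrite mxE sum_ord3 !mxE.
have [[a00 a01 a02] [a10 a11 a12] [a20 a21 a22]] := cross_preserving_cofactor cP.
set t := Num.sqrt (1 + \tr P); have t0 : 0 < t by rewrite sqrtr_gt0.
have t2 : t ^+ 2 = 1 + P 0 0 + P 1 1 + P 2 2.
  by rewrite sqr_sqrtr ?ltW// trace3 !addrA.
have tn : t != 0 by rewrite gt_eqF.
pose b := (P 2 1 - P 1 2) / (2 * t); pose c := (P 0 2 - P 2 0) / (2 * t).
pose d := (P 1 0 - P 0 1) / (2 * t); pose a := t / 2.
have ab : a * b = (P 2 1 - P 1 2) / 4 by rewrite /a /b; field.
have ac : a * c = (P 0 2 - P 2 0) / 4 by rewrite /a /c; field.
have ad : a * d = (P 1 0 - P 0 1) / 4 by rewrite /a /d; field.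
have aa : a ^+ 2 = (1 + P 0 0 + P 1 1 + P 2 2) / 4 by rewrite -t2 /a; field.
have tt : 4 * t ^+ 2 != 0 by rewrite mulf_neq0 ?expf_neq0.
have r01 := r 0 1; have r02 := r 0 2; have r12 := r 1 2.
have r00 := r 0 0; have r11 := r 1 1; have r22 := r 2 2.
have c01 := cl 0 1; have c02 := cl 0 2; have c12 := cl 1 2.
have c00 := cl 0 0; have c11 := cl 1 1; have c22 := cl 2 2.
rewrite /= in r00 r11 r22 r01 r02 r12 c00 c11 c22 c01 c02 c12.
have bb : b ^+ 2 = (1 + P 0 0 - P 1 1 - P 2 2) / 4.
  apply: (mulfI tt); rewrite [LHS](_ : _ = (P 2 1 - P 1 2) ^+ 2); last by rewrite /b; field.
  by rewrite t2; clear -a00 r11 r22 c00; lra.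
have ee : c ^+ 2 = (1 - P 0 0 + P 1 1 - P 2 2) / 4.
  apply: (mulfI tt); rewrite [LHS](_ : _ = (P 0 2 - P 2 0) ^+ 2); last by rewrite /c; field.
  by rewrite t2; clear -a11 r00 r22 c11; lra.
have dd : d ^+ 2 = (1 - P 0 0 - P 1 1 + P 2 2) / 4.
  apply: (mulfI tt); rewrite [LHS](_ : _ = (P 1 0 - P 0 1) ^+ 2); last by rewrite /d; field.
  by rewrite t2; clear -a22 r00 r11 c22; lra.
have bc : b * c = (P 0 1 + P 1 0) / 4.
  apply: (mulfI tt); rewrite [LHS](_ : _ = (P 2 1 - P 1 2) * (P 0 2 - P 2 0)); last by rewrite /b /c; field.
  by rewrite t2; clear -a01 a10 r01 c01; lra.
have bd : b * d = (P 0 2 + P 2 0) / 4.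
  apply: (mulfI tt); rewrite [LHS](_ : _ = (P 2 1 - P 1 2) * (P 1 0 - P 0 1)); last by rewrite /b /d; field.
  by rewrite t2; clear -a02 a20 r02 c02; lra.
have cd : c * d = (P 1 2 + P 2 1) / 4.
  apply: (mulfI tt); rewrite [LHS](_ : _ = (P 0 2 - P 2 0) * (P 1 0 - P 0 1)); last by rewrite /c /d; field.
  by rewrite t2; clear -a12 a21 r12 c12; lra.
have qE : quat_of P = quat a b c d by [].
(* With the ten products as atoms, everything left is linear. *)
rewrite qE; clearbody a b c d; clear -aa ab ac ad bb bc bd ee cd dd; split.
  by rewrite /unit_quat /= sum_ord4 !quatE; lra.
by apply/matrixP; apply: forall_ord3; apply: forall_ord3; rewrite mxE /= !quatE; lra.
Qed.

(** By [rotM] the product of the lifts is sent to P Q, so only the positivity of its real part is at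
    stake. The trace bounds give both lifts a real part above 4/5, which suffices. *)
Lemma quat_ofM P Q : P \in unitmx -> Q \in unitmx ->
  cross_preserving P -> cross_preserving Q -> 3 < 1 + \tr P -> 3 < 1 + \tr Q ->
  quat_of (P *m Q) = qmul (quat_of P) (quat_of Q).
Proof.
move=> uP uQ cP cQ tP tQ.
have sP : 0 < 1 + \tr P by lra.
have sQ : 0 < 1 + \tr Q by lra.
have [u1 r1] := rot_quat_of uP cP sP; have [u2 r2] := rot_quat_of uQ cQ sQ.
rewrite -{1}r1 -{1}r2 -rotM quat_of_rot//; first exact: unit_quatM.
have big (M : 'M[R]_3) : 3 < 1 + \tr M -> 4 / 5 < quat_of M 0 0.
  move=> h; rewrite quatE; have s0 : 0 <= 1 + \tr M by lra.
  move: (sqr_sqrtr s0) (sqrtr_ge0 (1 + \tr M)); set a := Num.sqrt _ => a2 a0.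
  by rewrite -a2 in h; nra.
have := big _ tP; have := big _ tQ; move/unit_quatE: u1; move/unit_quatE: u2.
rewrite [qmul _ _ 0 0]quat0; move: (quat_of P) (quat_of Q) => p q.
move: (p 0 0) (p 0 1) (p 0 2) (p 0 3) (q 0 0) (q 0 1) (q 0 2) (q 0 3).
move=> p0 p1 p2 p3 q0 q1 q2 q3 hq hp h1 h2.
(* Since 2 p_i q_i <= p_i^2 + q_i^2, the real part of the product is at least (p0 + q0)^2 / 2 - 1,
   positive because p0 + q0 > 8/5. *)
have e1 : 0 <= (p1 - q1) ^+ 2 by exact: sqr_ge0.
have e2 : 0 <= (p2 - q2) ^+ 2 by exact: sqr_ge0.
have e3 : 0 <= (p3 - q3) ^+ 2 by exact: sqr_ge0.
have e4 : 0 <= (p0 - 4 / 5) * (q0 - 4 / 5) by rewrite mulr_ge0// subr_ge0 ltW.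
have e5 : 0 <= (p0 - 4 / 5) ^+ 2 by exact: sqr_ge0.
have e6 : 0 <= (q0 - 4 / 5) ^+ 2 by exact: sqr_ge0.
lra.
Qed.

End RotationQuaternion.

(** * Smoothness of square roots *)

Section CkSqrt.
Context {R : realType}.

(** Differentiating sqrt f * sqrt f = f gives df / (2 sqrt f), of class C^k if sqrt f is: induction
    on k. *)
Lemma Ck_sqrt k n (U : set 'rV[R]_n) (f : 'rV[R]_n -> R) :
  open U -> (forall x, U x -> 0 < f x) -> Ck k U f ->
  Ck k U (fun x => Num.sqrt (f x)).
Proof.
move=> oU f0; elim: k => [|k IH] Cf.
  by move=> x Ux; apply: continuous_comp; [exact: Cf|exact: sqrt_continuous].
have [df Df] := Cf.
have ds x : U x -> differentiable (fun x => Num.sqrt (f x)) x.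
  move=> Ux; apply: (@differentiable_comp _ _ _ _ f Num.sqrt); first exact: df.
  by apply/derivable1_diffP; have [] := is_derive1_sqrt (f0 _ Ux).
split=> [|v]; first exact: ds.
have s0 x : U x -> 2 * Num.sqrt (f x) != 0.
  by move=> Ux; rewrite mulf_neq0// gt_eqF// sqrtr_gt0 f0.
have C1 := CkV oU s0 (CkM oU (Ck_cst k U 2) (IH (CkS Cf))).
apply: (Ck_eq oU _ (CkM oU (Df v) C1)) => x Ux.
have near_sq : \forall y \near x, Num.sqrt (f y) * Num.sqrt (f y) = f y.
  have nU : \forall y \near x, U y by exact: (open_nbhs_nbhs (conj oU Ux)).
  by apply: filterS nU => y Uy; rewrite -expr2; exact: (sqr_sqrtr (ltW (f0 _ Uy))).
have dss := differentiableM (ds _ Ux) (ds _ Ux).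
have E := pd_near v dss near_sq.
rewrite (pdM v (ds _ Ux) (ds _ Ux)) in E.
rewrite -/(pd v f x) E -/(pd v (fun x => Num.sqrt (f x)) x).
have sx : Num.sqrt (f x) != 0 by rewrite gt_eqF// sqrtr_gt0 f0.
by field.
Qed.

End CkSqrt.

(** * Automorphisms of so(3) + so(3) *)

Section TwoBlocks.
Context {R : realType}.
Implicit Types (x y : 'rV[R]_(3 + 3)) (K : 'M[R]_(3 + 3)).

(* The bracket of so(3) + so(3). *)
Definition cross2 x y : 'rV[R]_(3 + 3) :=
  row_mx (cross (lsubmx x) (lsubmx y)) (cross (rsubmx x) (rsubmx y)).

(** The two factors commute, hence so do their images. In each component an invertible diagonal
    block is onto so(3), so the off-diagonal block takes values in the centre of so(3), which is
    zero. *)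
Lemma cross2_preserving_block K :
  (forall x y, cross2 (x *m K) (y *m K) = cross2 x y *m K) ->
  ulsubmx K \in unitmx -> drsubmx K \in unitmx ->
  [/\ ursubmx K = 0, dlsubmx K = 0, cross_preserving (ulsubmx K) &
      cross_preserving (drsubmx K)].
Proof.
move=> H uP uT.
have mE (a b : 'rV[R]_3) : row_mx a b *m K =
    row_mx (a *m ulsubmx K + b *m dlsubmx K) (a *m ursubmx K + b *m drsubmx K).
  by rewrite -[X in _ *m X]submxK mul_row_block.
have cE (a b a' b' : 'rV[R]_3) : cross2 (row_mx a b) (row_mx a' b') =
    row_mx (cross a a') (cross b b').
  by rewrite /cross2 !row_mxKl !row_mxKr.
have H' (a b a' b' : 'rV[R]_3) :
    cross2 (row_mx a b *m K) (row_mx a' b' *m K) = row_mx (cross a a') (cross b b') *m K.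
  by rewrite -cE H.
have eq0 (a b : 'rV[R]_3) : cross (a *m ulsubmx K) (b *m dlsubmx K) = 0 /\
    cross (a *m ursubmx K) (b *m drsubmx K) = 0.
  have := H' a 0 0 b.
  rewrite !mE cE cross0l cross0r !mul0mx !addr0 !add0r.
  by move=> /eq_row_mx [] -> ->.
have dl0 : dlsubmx K = 0.
  apply/row_matrixP => i; rewrite row0 rowE; apply: cross_eq0 => z.
  by rewrite -[z](mulmxKV uP); exact: (eq0 _ _).1.
have ur0 : ursubmx K = 0.
  apply/row_matrixP => i; rewrite row0 rowE; apply: cross_eq0 => z.
  rewrite -[z](mulmxKV uT); have := (eq0 (delta_mx 0 i) (z *m invmx (drsubmx K))).2.
  move: (_ *m ursubmx K) (_ *m drsubmx K) => a b ab.
  have -> : cross b a = - cross a b.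
    by apply/rowP; apply: forall_ord3; rewrite [RHS]mxE !row3E; ring.
  by rewrite ab oppr0.
split => // a a'.
  by have := H' a 0 a' 0; rewrite !mE cE cross0l !mul0mx !addr0 => /eq_row_mx [].
by have := H' 0 a 0 a'; rewrite !mE cE cross0l !mul0mx !add0r => /eq_row_mx [].
Qed.

End TwoBlocks.

(** * The quaternion lift in stereographic coordinates *)

Section StereoQuaternion.
Context {R : realType}.

(** The real part is half a square root, hence nonnegative, so projection from -1 is defined at
    every lift. *)
Lemma quat_of_dom (P : 'M[R]_3) : quat_of P 0 0 != (-1) ^+ true.
Proof.
have : 0 <= quat_of P 0 0 by rewrite quat0 divr_ge0// sqrtr_ge0.
by move=> h; apply/eqP => E; move: h; rewrite E expr1; lra.
Qed.

Lemma smooth_stereo_quat_of n (U : set 'rV[R]_n) (P : 'rV[R]_n -> 'M[R]_3) :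
  open U -> (forall x, U x -> 0 < 1 + \tr (P x)) ->
  (forall k i j, Ck k U (fun x => P x i j)) ->
  smooth_on U (fun x => stereo true (quat_of (P x))).
Proof.
move=> oU tP CP.
have sq : smooth_on U (fun x => quat_of (P x)).
  move=> k.
  have Ct : Ck k U (fun x => 1 + \tr (P x)).
    apply: CkD (Ck_cst _ _ _) _ => //; apply: Ck_sum => // i; exact: CP.
  have Cs := Ck_sqrt oU tP Ct.
  have C2 : Ck k U (fun x => (2 * Num.sqrt (1 + \tr (P x)))^-1).
    apply: CkV => //; last exact: CkM (Ck_cst _ _ _) Cs.
    by move=> x Ux; rewrite mulf_neq0// gt_eqF// sqrtr_gt0 tP.
  have Cd i j i' j' : Ck k U (fun x => (P x i j - P x i' j') / (2 * Num.sqrt (1 + \tr (P x)))).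
    by apply: CkM C2 => //; apply: CkD; [|exact: CP|apply: CkN; [|exact: CP]].
  apply: Ck_quat; [|exact: Cd|exact: Cd|exact: Cd].
  exact: CkM Cs (Ck_cst _ _ _).
apply: (smooth_on_comp oU _ sq (smooth_stereo true)).
by move=> x _; exact: quat_of_dom.
Qed.

(** A scalar factor times the antisymmetric part of P, which vanishes at P = 1: the derivative of
    the factor does not contribute there. *)
Lemma stereo_quat_of (P : 'M[R]_3) :
  stereo true (quat_of P) =
  (2 * Num.sqrt (1 + \tr P) * (1 + Num.sqrt (1 + \tr P) / 2))^-1 *:
  row3 (P 2 1 - P 1 2) (P 0 2 - P 2 0) (P 1 0 - P 0 1).
Proof.
apply/rowP; apply: forall_ord3; rewrite [RHS]mxE row3E mxE lift3E /quat_of !quatE;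
  rewrite expr1 mulN1r opprK -mulrA -invfM mulrC; reflexivity.
Qed.

Lemma stereo_quat_of1 : stereo true (quat_of 1%:M) = 0 :> 'rV[R]_3.
Proof.
by rewrite stereo_quat_of !mxE /=; apply/rowP; apply: forall_ord3; rewrite mxE row3E mxE; ring.
Qed.

(** By the product rule on [stereo_quat_of], the kernel of the differential of the lift at P = 1 is
    read off the antisymmetric part of dP. *)
Lemma pd_stereo_quat_of n (U : set 'rV[R]_n) (P : 'rV[R]_n -> 'M[R]_3) x v :
  open U -> U x -> (forall x, U x -> 0 < 1 + \tr (P x)) ->
  (forall k i j, Ck k U (fun x => P x i j)) -> P x = 1%:M ->
  (forall i, pd v (fun y => stereo true (quat_of (P y)) 0 i) x = 0) ->
  [/\ pd v (fun y => P y 2 1 - P y 1 2) x = 0, pd v (fun y => P y 0 2 - P y 2 0) x = 0 &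
      pd v (fun y => P y 1 0 - P y 0 1) x = 0].
Proof.
move=> oU Ux tP CP P1 H.
pose r y := (2 * Num.sqrt (1 + \tr (P y)) * (1 + Num.sqrt (1 + \tr (P y)) / 2))^-1.
have s0 y : U y -> 0 < Num.sqrt (1 + \tr (P y)) by move=> Uy; rewrite sqrtr_gt0 tP.
have r0 : r x != 0.
  have := s0 _ Ux; rewrite /r; set s := Num.sqrt _ => sx.
  by rewrite invr_eq0 mulf_neq0 ?mulf_neq0// gt_eqF// addr_gt0// divr_gt0.
have Cs : Ck 1 U (fun y => Num.sqrt (1 + \tr (P y))).
  apply: Ck_sqrt => //.
  apply: CkD (Ck_cst _ _ _) _ => //; apply: Ck_sum => // i; exact: CP.
have dr : differentiable r x.
  have C : Ck 1 U r.
    apply: CkV; first exact: oU.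
      move=> y /s0; set s := Num.sqrt _ => sy.
      by rewrite mulf_neq0 ?mulf_neq0// gt_eqF// addr_gt0// divr_gt0.
    apply: CkM; first exact: oU.
      exact: CkM (Ck_cst _ _ _) Cs.
    apply: CkD (Ck_cst _ _ _) _; first exact: oU.
    exact: CkM Cs (Ck_cst _ _ _).
  exact: (C.1 x Ux).
have key i j i' j' k : (i != j) -> (i' != j') ->
    (forall y, stereo true (quat_of (P y)) 0 k = r y * (P y i j - P y i' j')) ->
    pd v (fun y => P y i j - P y i' j') x = 0.
  move=> ij ij' E.
  have dP : differentiable (fun y => P y i j - P y i' j') x.
    by apply: (differentiableB (f := fun y => P y i j)); exact: (CP 1%N _ _).1.
  have := H k; rewrite (_ : (fun y => _) = (fun y => r y * (P y i j - P y i' j'))).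
    rewrite pdM// P1 !mxE (negbTE ij) (negbTE ij') subrr mul0r addr0 => /eqP.
    by rewrite mulf_eq0 (negbTE r0) => /eqP.
  by apply/funext => y.
split; [apply: (key 2 1 1 2 0)|apply: (key 0 2 2 0 1)|apply: (key 1 0 0 1 2)] => //;
  by move=> y; rewrite stereo_quat_of mxE row3E.
Qed.

End StereoQuaternion.

(** * Lie groups with an so(3) + so(3) coframe *)

Lemma ulsubmx_mulmx (R : pzRingType) m n (A B : 'M[R]_(m + n)) : ursubmx A = 0 ->
  ulsubmx (A *m B) = ulsubmx A *m ulsubmx B.
Proof.
by move=> A0; rewrite -{1}[A]submxK -{1}[B]submxK mulmx_block block_mxKul A0 mul0mx addr0.
Qed.

Lemma drsubmx_mulmx (R : pzRingType) m n (A B : 'M[R]_(m + n)) : dlsubmx A = 0 ->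
  drsubmx (A *m B) = drsubmx A *m drsubmx B.
Proof.
by move=> A0; rewrite -{1}[A]submxK -{1}[B]submxK mulmx_block block_mxKdr A0 mul0mx add0r.
Qed.

Section So4.
Context {R : realType}.
Variables (G : lieGroup R (3 + 3)) (c : chart R (3 + 3) G).
Hypotheses (Gc : lie_atlas G c) (c1 : chart_dom c 1%g).
Variable L : 'M[R]_(3 + 3).
Hypothesis uL : L \in unitmx.
(** As [u *m dadjoint c v] is [u, v], this makes L an isomorphism from the Lie algebra of G to so(3)
    + so(3). *)
Hypothesis dL : forall u v : 'rV[R]_(3 + 3),
  u *m dadjoint c v *m L = - cross2 (v *m L) (u *m L).

Let O := adjoint_dom c.
Let y0 := chart_map c 1%g.
Let cc : is_chart c := lie_chartP Gc.
Let OD := chart_img c `&` chart_inv c @^-1` O.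

(* The adjoint representation in the coframe [L]. *)
Definition frame_adjoint (g : G) : 'M[R]_(3 + 3) := invmx L *m adjoint c g *m L.
Let K := frame_adjoint.

Lemma frame_adjoint1 : K 1%g = 1%:M.
Proof. by rewrite /K /frame_adjoint adjoint1// mulmx1 mulVmx. Qed.

Lemma frame_adjointM g h : O g -> O h -> K (g * h)%g = K g *m K h.
Proof.
move=> Og Oh; rewrite /K /frame_adjoint adjointM//.
by rewrite !mulmxA; congr (_ *m _ *m _); rewrite -!mulmxA mulmxV// mulmx1.
Qed.

Lemma frame_adjoint_cross2 g x y : O g -> cross2 (x *m K g) (y *m K g) = cross2 x y *m K g.
Proof.
move=> Og; pose v := x *m invmx L; pose u := y *m invmx L.
have xE : x = v *m L by rewrite /v mulmxKV.
have yE : y = u *m L by rewrite /u mulmxKV.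
have KE (z : 'rV[R]_(3 + 3)) : z *m L *m K g = z *m adjoint c g *m L.
  by rewrite /K /frame_adjoint !mulmxA mulmxK.
have AV : adjoint c g *m adjoint c (g^-1)%g = 1%:M.
  by apply: mulmx1C; exact: adjointVM.
apply: oppr_inj; rewrite xE yE !KE -dL dadjoint_adjoint//.
rewrite -mulNmx -dL KE !mulmxA; congr (_ *m _ *m _ *m _).
by rewrite -!mulmxA AV mulmx1.
Qed.

Lemma Ck_frame_adjoint k i j : Ck k OD (fun y => K (chart_inv c y) i j).
Proof.
have oOD : open OD by apply: open_chart_inv_preimage => //; exact: open_adjoint_dom.
apply: Ck_mulmx => //; last by move=> a b; exact: Ck_cst.
move=> a b; apply: Ck_mulmx => //; first by move=> a' b'; exact: Ck_cst.
by move=> a' b'; exact: Ck_adjoint.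
Qed.

Lemma pd_frame_adjoint v i j :
  pd v (fun y => K (chart_inv c y) i j) y0 = (- cross2 (v *m L) (delta_mx 0 i)) 0 j.
Proof.
have dA a b : differentiable (fun y => adjoint c (chart_inv c y) a b) y0.
  apply: (Ck_adjoint Gc c1 1 a b).1; split; first exact: chart_img_map.
  by rewrite /= /y0 chart_mapK//; split; rewrite ?invg1.
rewrite /K /frame_adjoint.
rewrite (pd_conj_mx (F := fun y => adjoint c (chart_inv c y)) _ _ v i j dA).
have -> : delta_mx 0 i = (delta_mx 0 i *m invmx L) *m L :> 'rV[R]_(3 + 3).
  by rewrite mulmxKV.
by rewrite -dL -/(dadjoint c v) -!mulmxA -rowE [RHS]mxE.
Qed.

Let P (y : 'rV[R]_(3 + 3)) : 'M[R]_3 := ulsubmx (K (chart_inv c y)).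
Let T (y : 'rV[R]_(3 + 3)) : 'M[R]_3 := drsubmx (K (chart_inv c y)).

Let CP k i j : Ck k OD (fun y => P y i j).
Proof.
by apply: Ck_ext (Ck_frame_adjoint k (lshift 3 i) (lshift 3 j)) => y; rewrite !mxE.
Qed.

Let CT k i j : Ck k OD (fun y => T y i j).
Proof.
by apply: Ck_ext (Ck_frame_adjoint k (rshift 3 i) (rshift 3 j)) => y; rewrite !mxE.
Qed.

(** Invertibility serves the block decomposition, the trace bound serves [quat_ofM]; both are open
    conditions and hold at 1, where 1 + tr is 4. *)
Let good (M : 'M[R]_3) := M \in unitmx /\ 3 < 1 + \tr M.

Let good_near (M : 'rV[R]_(3 + 3) -> 'M[R]_3) U : open U ->
  (forall k i j, Ck k U (fun y => M y i j)) -> open (U `&` [set y | good (M y)]).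
Proof.
move=> oU CM.
have o1 : open (U `&` (fun y => \det (M y)) @^-1` [set d | d != 0]).
  by apply: open_setI_preimage (@open_neq _ _) => //; exact: (Ck_det (k := 0) oU (CM 0%N)).
have o2 : open (U `&` (fun y => 1 + \tr (M y)) @^-1` [set t | 3 < t]).
  apply: open_setI_preimage (@open_gt _ _) => //.
  have : Ck 0 U (fun y => 1 + \tr (M y)).
    exact: (CkD oU (Ck_cst _ _ _) (Ck_sum _ oU (fun i => CM 0%N i i))).
  by [].
rewrite (_ : _ `&` _ = (U `&` (fun y => \det (M y)) @^-1` [set d | d != 0]) `&`
  (U `&` (fun y => 1 + \tr (M y)) @^-1` [set t | 3 < t])); first exact: openI.
apply/seteqP; split => [y [Uy [h1 h2]]|y [[Uy h1] [_ h2]]].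
  by split; split => //=; rewrite -unitfE -unitmxE.
by split => //; split => //; rewrite unitmxE unitfE.
Qed.

Let W := (OD `&` [set y | good (P y)]) `&` [set y | good (T y)].
Let Phi (y : 'rV[R]_(3 + 3)) : 'rV[R]_(3 + 3) :=
  row_mx (stereo true (quat_of (P y))) (stereo true (quat_of (T y))).

Let oOD : open OD.
Proof. by apply: open_chart_inv_preimage => //; exact: open_adjoint_dom. Qed.

Let oW1 : open (OD `&` [set y | good (P y)]).
Proof. by apply: good_near. Qed.

Let oW : open W.
Proof.
apply: good_near; first exact: oW1.
by move=> k i j; apply: Ck_sub (CT k i j) => y [].
Qed.

Let P0 : P y0 = 1%:M.
Proof. by rewrite /P /y0 chart_mapK// frame_adjoint1 scalar_mx_block block_mxKul. Qed.

Let T0 : T y0 = 1%:M.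
Proof. by rewrite /T /y0 chart_mapK// frame_adjoint1 scalar_mx_block block_mxKdr. Qed.

Let good1 : good 1%:M.
Proof. by split; [exact: unitmx1|rewrite mxtrace1; lra]. Qed.

Let W0 : W y0.
Proof.
split; last by rewrite /= T0.
split; last by rewrite /= P0.
split; first exact: chart_img_map.
by rewrite /= /y0 chart_mapK//; split; rewrite ?invg1.
Qed.

Let trP y : W y -> 0 < 1 + \tr (P y).
Proof. by move=> [[_ [_ h]] _]; apply: lt_trans h. Qed.

Let trT y : W y -> 0 < 1 + \tr (T y).
Proof. by move=> [_ [_ h]]; apply: lt_trans h. Qed.

Let CPW k i j : Ck k W (fun y => P y i j).
Proof. by apply: Ck_sub (CP k i j) => y [[]]. Qed.

Let CTW k i j : Ck k W (fun y => T y i j).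
Proof. by apply: Ck_sub (CT k i j) => y [[]]. Qed.

Let sPhi : smooth_on W Phi.
Proof. by apply: smooth_row_mx; apply: smooth_stereo_quat_of. Qed.

Let dP i j : differentiable (fun y => P y i j) y0.
Proof. exact: (CPW 1 i j).1. Qed.

Let dT i j : differentiable (fun y => T y i j) y0.
Proof. exact: (CTW 1 i j).1. Qed.

Let lsub_delta i : lsubmx (delta_mx 0 (lshift 3 i)) = delta_mx 0 i :> 'rV[R]_3.
Proof. by apply/rowP => j; rewrite !mxE /= (inj_eq (@lshift_inj _ _)). Qed.

Let rsub_delta i : rsubmx (delta_mx 0 (rshift 3 i)) = delta_mx 0 i :> 'rV[R]_3.
Proof. by apply/rowP => j; rewrite !mxE /= (inj_eq (@rshift_inj _ _)). Qed.

Let pdP v i j : pd v (fun y => P y i j) y0 = - cross (lsubmx (v *m L)) (delta_mx 0 i) 0 j.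
Proof.
transitivity (pd v (fun y => K (chart_inv c y) (lshift 3 i) (lshift 3 j)) y0).
  by congr pd; apply/funext => y; rewrite !mxE.
by rewrite pd_frame_adjoint mxE /cross2 row_mxEl lsub_delta.
Qed.

Let pdT v i j : pd v (fun y => T y i j) y0 = - cross (rsubmx (v *m L)) (delta_mx 0 i) 0 j.
Proof.
transitivity (pd v (fun y => K (chart_inv c y) (rshift 3 i) (rshift 3 j)) y0).
  by congr pd; apply/funext => y; rewrite !mxE.
by rewrite pd_frame_adjoint mxE /cross2 row_mxEr rsub_delta.
Qed.

(** For x either half of [v *m L], the derivative of the corresponding block along v is, up to sign,
    the matrix of the cross product with x, and its antisymmetric part determines x. So v L = 0 for
    v in the kernel. *)
Let jac_Phi_unit : jac Phi y0 \in unitmx.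
Proof.
rewrite -row_free_unit -kermx_eq0; apply/rowV0P => v /sub_kermxP vJ.
have HP i : pd v (fun y => stereo true (quat_of (P y)) 0 i) y0 = 0.
  transitivity ((v *m jac Phi y0) 0 (lshift 3 i)); last by rewrite vJ mxE.
  by rewrite mulmx_jac; congr pd; apply/funext => y; rewrite row_mxEl.
have HT i : pd v (fun y => stereo true (quat_of (T y)) 0 i) y0 = 0.
  transitivity ((v *m jac Phi y0) 0 (rshift 3 i)); last by rewrite vJ mxE.
  by rewrite mulmx_jac; congr pd; apply/funext => y; rewrite row_mxEr.
have [p0 p1 p2] := pd_stereo_quat_of oW W0 trP CPW P0 HP.
have [t0 t1 t2] := pd_stereo_quat_of oW W0 trT CTW T0 HT.
rewrite !pdB// !pdP in p0 p1 p2; rewrite !pdB// !pdT in t0 t1 t2.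
apply: (can_inj (mulmxK uL)); rewrite mul0mx -[v *m L]hsubmxK.
rewrite (_ : lsubmx (v *m L) = 0) 1?(_ : rsubmx (v *m L) = 0) ?row_mx0//.
  move: t0 t1 t2; move: (rsubmx _) => x; rewrite !row3E !mxE /= => h0 h1 h2.
  by apply/rowP; apply: forall_ord3; rewrite mxE; lra.
move: p0 p1 p2; move: (lsubmx _) => x; rewrite !row3E !mxE /= => h0 h1 h2.
by apply/rowP; apply: forall_ord3; rewrite mxE; lra.
Qed.

Let d : chart R (3 + 3) (S3xS3 R) := prod_chart (S3_chart true) (S3_chart true).

Let Hd : lie_atlas (S3xS3 R) d.
Proof. by exists (S3_chart true, S3_chart true) => //; split; exists true. Qed.

Let d1 : chart_dom d 1%g.
Proof. by split; rewrite /= quat0 expr1; apply/eqP; lra. Qed.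

Let Phi1 : Phi y0 = chart_map d 1%g.
Proof.
have s1 : stereo true (quat (1 : R) 0 0 0) = 0.
  by apply/rowP; apply: forall_ord3; rewrite !mxE /= !mul0r.
by rewrite /Phi P0 T0 stereo_quat_of1 /= s1.
Qed.

Theorem local_isomorphism_of_coframe : locally_isomorphic G (S3xS3 R).
Proof.
have PE x : chart_dom c x -> P (chart_map c x) = ulsubmx (K x).
  by move=> dx; rewrite /P (chart_mapK cc dx).
have TE x : chart_dom c x -> T (chart_map c x) = drsubmx (K x).
  by move=> dx; rewrite /T (chart_mapK cc dx).
pose O' := chart_dom c `&` chart_map c @^-1` W.
have oO' : open O' by exact: open_chart_preimage.
have O'P x : O' x -> [/\ O x, cross_preserving (ulsubmx (K x)), cross_preserving (drsubmx (K x)),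
    ursubmx (K x) = 0 & dlsubmx (K x) = 0] /\ good (ulsubmx (K x)) /\ good (drsubmx (K x)).
  move=> [dx [[[_ Ox'] gP] gT]].
  have Ox : O x by move: Ox'; rewrite /preimage /= (chart_mapK cc dx).
  have {}gP : good (ulsubmx (K x)) by rewrite -(PE _ dx).
  have {}gT : good (drsubmx (K x)) by rewrite -(TE _ dx).
  have [ur dl cP cT] := cross2_preserving_block (fun a b => frame_adjoint_cross2 a b Ox) gP.1 gT.1.
  exact: (conj (And5 Ox cP cT ur dl) (conj gP gT)).
apply: (local_isomorphism_of_charts Gc Hd c1 d1 oW W0 sPhi jac_Phi_unit Phi1 oO').
  by split => //; exact: W0.
move=> f x y Ox Oy Oxy.
have fE (M : 'M[R]_3) : good M -> cross_preserving M ->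
    stereo_inv true (stereo true (quat_of M)) = quat_of M.
  move=> [uM tM] cM; apply: stereoK; last exact: quat_of_dom.
  by apply: (rot_quat_of uM cM _).1; apply: lt_trans tM.
have fV z : O' z -> val (f z).1 = quat_of (ulsubmx (K z)) /\ val (f z).2 = quat_of (drsubmx (K z)).
  move=> Oz; have [[_ cP cT _ _] [gP gT]] := O'P z Oz; have [dz _] := Oz.
  by rewrite /f /= /Phi row_mxKl row_mxKr (PE _ dz) (TE _ dz) (fE _ gP cP) (fE _ gT cT).
have [[Oax cPx cTx urx dlx] [gPx gTx]] := O'P _ Ox.
have [[Oay cPy cTy ury dly] [gPy gTy]] := O'P _ Oy.
have KM := frame_adjointM Oax Oay.
(* The off-diagonal blocks vanish, so each diagonal block is multiplicative by itself. *)
have E1 : ulsubmx (K (x * y)%g) = ulsubmx (K x) *m ulsubmx (K y).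
  by rewrite KM (ulsubmx_mulmx _ urx).
have E2 : drsubmx (K (x * y)%g) = drsubmx (K x) *m drsubmx (K y).
  by rewrite KM (drsubmx_mulmx _ dlx).
have [v1 v2] := fV _ Oxy; have [x1 x2] := fV _ Ox; have [z1 z2] := fV _ Oy.
case: gPx gTx gPy gTy => [uPx tPx] [uTx tTx] [uPy tPy] [uTy tTy].
have F1 : (f (x * y)%g).1 = ((f x).1 * (f y).1)%g.
  apply: val_inj; apply: (etrans v1); rewrite E1 (quat_ofM uPx uPy cPx cPy tPx tPy).
  exact: (esym (congr2 (@qmul R) x1 z1)).
have F2 : (f (x * y)%g).2 = ((f x).2 * (f y).2)%g.
  apply: val_inj; apply: (etrans v2); rewrite E2 (quat_ofM uTx uTy cTx cTy tTx tTy).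
  exact: (esym (congr2 (@qmul R) x2 z2)).
by rewrite [LHS]surjective_pairing F1 F2.
Qed.

End So4.

(** * The structure equations *)

Section Coframe.
Context {R : realType} {n : nat}.
Variables (G : lieGroup R n) (c : chart R n G).
Hypotheses (Gc : lie_atlas G c) (c1 : chart_dom c 1%g).
Let y0 := chart_map c 1%g.

Lemma covec_appE (a v : 'rV[R]_n) : covec_app a v = (v *m a^T) 0 0.
Proof. by rewrite mxE; apply: eq_bigr => i _; rewrite mxE mulrC. Qed.

Lemma covec_app0 (v : 'rV[R]_n) : covec_app 0 v = 0.
Proof. by rewrite covec_appE trmx0 mulmx0 mxE. Qed.

Lemma covec_appD (p q v : 'rV[R]_n) : covec_app (p + q) v = covec_app p v + covec_app q v.
Proof. by rewrite !covec_appE linearD mulmxDr mxE. Qed.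

Lemma covec_appZ x (p v : 'rV[R]_n) : covec_app (x *: p) v = x * covec_app p v.
Proof. by rewrite !covec_appE linearZ /= -scalemxAr mxE. Qed.

Lemma covec_appB (p q v : 'rV[R]_n) : covec_app (p - q) v = covec_app p v - covec_app q v.
Proof. by rewrite -scaleN1r covec_appD covec_appZ mulN1r. Qed.

Lemma covec_app_comb k (a : 'I_k -> R) (e : 'I_k -> 'rV[R]_n) v :
  covec_app (\sum_i a i *: e i) v = \sum_i a i * covec_app (e i) v.
Proof.
rewrite covec_appE linear_sum mulmx_sumr summxE; apply: eq_bigr => i _.
by rewrite linearZ /= -scalemxAr mxE covec_appE.
Qed.

Lemma covec_app_eq0 (a : 'rV[R]_n) : (forall v, covec_app a v = 0) -> a = 0.
Proof.
move=> H; apply/rowP => i; have := H (delta_mx 0 i).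
by rewrite covec_appE -rowE !mxE.
Qed.

Lemma form1_combE k (a : 'I_k -> R) (e : 'I_k -> form1 G) d y :
  (\sum_i a i *: e i) d y = \sum_i a i *: e i d y.
Proof. by rewrite fct_sumE fct_sumE. Qed.

Lemma left_invariant0 : left_invariant (0 : form1 G).
Proof.
have P f : pullback_eq f (0 : form1 G) 0.
  by move=> d d' x _ _ _ _ v; rewrite !covec_app0.
by split; [split|] => // d _ k i; exact: Ck_cst.
Qed.

(** A linear relation at the identity spreads over G by left translation; its coefficients then
    represent the zero form, and uniqueness of coordinates makes them vanish. *)
Lemma left_invariant_basis_unitmx (e : 'I_n -> form1 G) : left_invariant_basis e ->
  (\matrix_k e k c y0) \in unitmx.
Proof.
move=> [le ue]; rewrite -row_free_unit -kermx_eq0; apply/rowV0P => a /sub_kermxP aM.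
have comb0 : \sum_k a 0 k *: e k c y0 = 0.
  rewrite -[RHS]aM mulmx_sum_row; apply: eq_bigr => k _; congr (_ *: _).
  by apply/rowP => j; rewrite !mxE.
have [b [_ ub]] := ue _ left_invariant0.
suff aE : b = (fun k => a 0 k).
  have bE : b = (fun=> 0).
    apply: ub => d y _ _; rewrite form1_combE big1// => k _; exact: scale0r.
  by apply/rowP => k; rewrite mxE -[LHS]/((fun k => a 0 k) k) -aE bE.
apply: ub => d y Gd [x dx <-]; rewrite form1_combE.
apply/esym/covec_app_eq0 => v; rewrite covec_app_comb.
(* Left translation by x^-1 carries x to the identity and v to V. *)
pose V := 'd (chart_map c \o (fun z => x^-1 * z)%g \o chart_inv d) (chart_map d x) v.
have E k : covec_app (e k d (chart_map d x)) v = covec_app (e k c y0) V.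
  have [_ /(_ x^-1%g) H] := le k.
  by rewrite (H d c x Gd Gc dx) ?mulVg.
under eq_bigr => k _ do rewrite E.
by rewrite -covec_app_comb comb0 covec_app0.
Qed.

Lemma wedge_app (a b : form1 G) d y (v u : 'rV[R]_n) :
  (v *m wedge a b d y *m u^T) 0 0 =
  covec_app (a d y) v * covec_app (b d y) u - covec_app (a d y) u * covec_app (b d y) v.
Proof.
have -> : wedge a b d y = (a d y)^T *m b d y - (b d y)^T *m a d y.
  by apply/matrixP => i j; rewrite !mxE !big_ord1 !mxE; congr (_ - _); rewrite mulrC.
rewrite mulmxBr mulmxBl !mulmxA.
have E (p q : 'rV[R]_n) : (v *m p^T *m q *m u^T) 0 0 = covec_app p v * covec_app q u.
  rewrite -mulmxA mxE big_ord1 -covec_appE; congr (_ * _).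
  by rewrite mxE; apply: eq_bigr => i _; rewrite mxE.
by rewrite mxE [X in _ + X]mxE !E; congr (_ - _); rewrite mulrC.
Qed.

End Coframe.

(** * The coframe splitting the Lie algebra into two factors *)

Section AdaptedCoframe.
Context {R : realType}.
Variables (b b' r : R) (e1 e2 e3 e4 e5 A : 'rV[R]_6).

(* Columns: X, Y, Z for s = 1, then for s = -1, where
   X = A + s r e5, Y = r e1 + s (b e4 - b' e3), Z = r e2 + s (b e3 + b' e4);
   the structure equations become dX = - Y /\ Z, dY = - Z /\ X, dZ = - X /\ Y. *)
Definition adapted_form (s : R) (i : 'I_3) : 'rV[R]_6 :=
  [:: A + (s * r) *: e5; r *: e1 + s *: (b *: e4 - b' *: e3);
      r *: e2 + s *: (b *: e3 + b' *: e4)]`_i.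

Definition adapted_coframe : 'M[R]_(3 + 3) :=
  row_mx (\matrix_(j, i) adapted_form 1 i 0 j) (\matrix_(j, i) adapted_form (-1) i 0 j).

Lemma mulmx_adapted_coframe (v : 'rV[R]_6) :
  let w s := row3 (covec_app A v + s * r * covec_app e5 v)
     (r * covec_app e1 v + s * (b * covec_app e4 v - b' * covec_app e3 v))
     (r * covec_app e2 v + s * (b * covec_app e3 v + b' * covec_app e4 v)) in
  v *m adapted_coframe = row_mx (w 1) (w (-1)).
Proof.
move=> w.
have E s : v *m (\matrix_(j, i) adapted_form s i 0 j) = w s.
  apply/rowP => i.
  have -> : (v *m (\matrix_(j, i) adapted_form s i 0 j)) 0 i = covec_app (adapted_form s i) v.
    by rewrite covec_appE !mxE; apply: eq_bigr => j _; rewrite !mxE.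
  by move: i; apply: forall_ord3;
    rewrite row3E /adapted_form /= !(covec_appB, covec_appD, covec_appZ).
by rewrite /adapted_coframe mul_mx_row !E.
Qed.

(** Sums and differences over s = 1 and s = -1 recover A, e5, e1, e2 and the pair b e4 - b' e3, b e3
    + b' e4, a system in e3, e4 of determinant - (b^2 + b'^2). *)
Lemma adapted_coframe_unitmx : b ^+ 2 + b' ^+ 2 != 0 -> r != 0 ->
  (forall v, covec_app e1 v = 0 -> covec_app e2 v = 0 -> covec_app e3 v = 0 ->
    covec_app e4 v = 0 -> covec_app e5 v = 0 -> covec_app A v = 0 -> v = 0) ->
  adapted_coframe \in unitmx.
Proof.
move=> bb r0 inj; rewrite -row_free_unit -kermx_eq0; apply/rowV0P => v /sub_kermxP.
rewrite (mulmx_adapted_coframe v) -[X in _ = X -> _]row_mx0 => /eq_row_mx[E1 E2].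
have h i := congr1 (fun x : 'rV[R]_3 => x 0 i) E1.
have h' i := congr1 (fun x : 'rV[R]_3 => x 0 i) E2.
move: (h 0) (h 1) (h 2) (h' 0) (h' 1) (h' 2); rewrite /= !row3E !mxE.
move: (inj v); move: (covec_app e1 v) (covec_app e2 v) (covec_app e3 v)
  (covec_app e4 v) (covec_app e5 v) (covec_app A v) => x1 x2 x3 x4 x5 xA {}inj.
move=> X Y Z X' Y' Z'.
have rz x : r * x = 0 -> x = 0 by move=> /eqP; rewrite mulf_eq0 (negbTE r0) => /eqP.
have bz x : (b ^+ 2 + b' ^+ 2) * x = 0 -> x = 0.
  by move=> /eqP; rewrite mulf_eq0 (negbTE bb) => /eqP.
have p : b * x4 - b' * x3 = 0 by lra.
have q : b * x3 + b' * x4 = 0 by lra.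
apply: inj; [apply: rz; lra|apply: rz; lra| | |apply: rz; lra|lra]; apply: bz.
  rewrite (_ : _ * x3 = b * (b * x3 + b' * x4) - b' * (b * x4 - b' * x3)); last by ring.
  by rewrite p q; ring.
rewrite (_ : _ * x4 = b' * (b * x3 + b' * x4) + b * (b * x4 - b' * x3)); last by ring.
by rewrite p q; ring.
Qed.

(** M will be [dadjoint c v]: the hypotheses are the structure equations evaluated on (v, u), with
    left-hand sides rewritten by [ext_d_dadjoint]. *)
Lemma adapted_coframe_bracket (M : 'M[R]_6) (v u : 'rV[R]_6) :
  let w x y := covec_app x v * covec_app y u - covec_app x u * covec_app y v in
  r ^+ 2 = b ^+ 2 + b' ^+ 2 ->
  covec_app e1 (u *m M) = w A e2 - b * w e3 e5 - b' * w e4 e5 ->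
  covec_app e2 (u *m M) = - w A e1 + b * w e4 e5 - b' * w e3 e5 ->
  covec_app e3 (u *m M) = - w A e4 + b * w e1 e5 + b' * w e2 e5 ->
  covec_app e4 (u *m M) = w A e3 - b * w e2 e5 + b' * w e1 e5 ->
  covec_app e5 (u *m M) = - b * (w e1 e3 - w e2 e4) - b' * (w e1 e4 + w e2 e3) ->
  covec_app A (u *m M) = - (b ^+ 2 + b' ^+ 2) * (w e1 e2 - w e3 e4) ->
  u *m M *m adapted_coframe = - cross2 (v *m adapted_coframe) (u *m adapted_coframe).
Proof.
move=> w r2 d1 d2 d3 d4 d5 dA.
rewrite [LHS](mulmx_adapted_coframe (u *m M)) (mulmx_adapted_coframe u) (mulmx_adapted_coframe v).
rewrite d1 d2 d3 d4 d5 dA /w /cross2 !row_mxKl !row_mxKr opp_row_mx.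
move: (covec_app e1 v) (covec_app e2 v) (covec_app e3 v)
  (covec_app e4 v) (covec_app e5 v) (covec_app A v) => v1 v2 v3 v4 v5 vA.
move: (covec_app e1 u) (covec_app e2 u) (covec_app e3 u)
  (covec_app e4 u) (covec_app e5 u) (covec_app A u) => u1 u2 u3 u4 u5 uA.
(* Each coordinate is a polynomial identity modulo r^2 = b^2 + b'^2, and m is the cofactor of this
   relation. *)
have key (x y m : R) : x - y = (r ^+ 2 - (b ^+ 2 + b' ^+ 2)) * m -> x = y.
  by rewrite r2 subrr mul0r => /eqP; rewrite subr_eq0 => /eqP.
congr row_mx; apply/rowP; apply: forall_ord3; rewrite [RHS]mxE !row3E.
- by apply: (key _ _ (v1 * u2 - v2 * u1)); ring.
- by apply: (key _ _ (v2 * u5 - v5 * u2)); ring.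
- by apply: (key _ _ (v5 * u1 - v1 * u5)); ring.
- by apply: (key _ _ (v1 * u2 - v2 * u1)); ring.
- by apply: (key _ _ (v5 * u2 - v2 * u5)); ring.
- by apply: (key _ _ (v1 * u5 - v5 * u1)); ring.
Qed.

End AdaptedCoframe.

Theorem proposition5p2 (R : realType) (a1 a2 : R) (G : lieGroup R 6) :
  a1 ^+ 2 + a2 ^+ 2 != 0 -> is_G a1 a2 0 0 G ->
  locally_isomorphic G (S3xS3 R).
Proof.
move=> a0 [_ [e1 [e2 [e3 [e4 [e5 [A2 [basis [D1 D2 D3 D4 [D5 DA]]]]]]]]]].
have [_ cov _] := lie_atlasP G; have [c Gc c1] := cov 1%g.
set y0 := chart_map c 1%g.
have Dy0 : chart_img c y0 by exact: chart_img_map.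
pose b := 2 * a1; pose b' := 2 * a2; pose r := Num.sqrt (b ^+ 2 + b' ^+ 2).
have bb0 : 0 <= b ^+ 2 + b' ^+ 2 by rewrite addr_ge0// sqr_ge0.
have bb : b ^+ 2 + b' ^+ 2 != 0.
  by rewrite /b /b' (_ : _ + _ = 4 * (a1 ^+ 2 + a2 ^+ 2)) ?mulf_neq0//; ring.
have r0 : r != 0 by rewrite gt_eqF// sqrtr_gt0 lt_neqAle eq_sym bb.
have uM := left_invariant_basis_unitmx Gc c1 basis.
have le i : left_invariant (tnth [tuple e1; e2; e3; e4; e5; A2] i) by case: basis.
have l1 : left_invariant e1 by exact: (le (Ordinal (isT : 0 < 6)%N)).
have l2 : left_invariant e2 by exact: (le (Ordinal (isT : 1 < 6)%N)).
have l3 : left_invariant e3 by exact: (le (Ordinal (isT : 2 < 6)%N)).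
have l4 : left_invariant e4 by exact: (le (Ordinal (isT : 3 < 6)%N)).
have l5 : left_invariant e5 by exact: (le (Ordinal (isT : 4 < 6)%N)).
have lA : left_invariant A2 by exact: (le (Ordinal (isT : 5 < 6)%N)).
have inj v : covec_app (e1 c y0) v = 0 -> covec_app (e2 c y0) v = 0 ->
    covec_app (e3 c y0) v = 0 -> covec_app (e4 c y0) v = 0 ->
    covec_app (e5 c y0) v = 0 -> covec_app (A2 c y0) v = 0 -> v = 0.
  move=> h1 h2 h3 h4 h5 hA; apply: trmx_inj; apply: (can_inj (mulKmx uM)).
  rewrite trmx0 mulmx0; apply/colP => i; rewrite [RHS]mxE.
  transitivity (covec_app (tnth [tuple e1; e2; e3; e4; e5; A2] i c y0) v).
    by rewrite mxE; apply: eq_bigr => j _; rewrite !mxE.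
  by case: i => [[|[|[|[|[|[|//]]]]]] lt6]; rewrite (tnth_nth e1).
pose L := adapted_coframe b b' r (e1 c y0) (e2 c y0) (e3 c y0) (e4 c y0) (e5 c y0) (A2 c y0).
have uL : L \in unitmx by exact: adapted_coframe_unitmx.
apply: (local_isomorphism_of_coframe Gc c1 uL) => u v.
(* q stays abstract, so the structure equations expand by linearity alone. *)
have [q qE] : exists q : form2 G -> R, forall F, q F = (v *m F c y0 *m u^T) 0 0.
  by exists (fun F => (v *m F c y0 *m u^T) 0 0).
have app (w : form1 G) F : left_invariant w -> form2_eq (ext_d w) F ->
    covec_app (w c y0) (u *m dadjoint c v) = q F.
  by move=> lw Dw; rewrite qE (ext_d_dadjoint Gc c1 u v lw) Dw.
have appD (F F' : form2 G) : q (F + F') = q F + q F'.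
  by rewrite !qE -[(F + F') c y0]/(F c y0 + F' c y0) mulmxDr mulmxDl mxE.
have appZ x (F : form2 G) : q (x *: F) = x * q F.
  by rewrite !qE -[(x *: F) c y0]/(x *: F c y0) -scalemxAr -scalemxAl mxE.
have appN (F : form2 G) : q (- F) = - q F.
  by rewrite !qE -[(- F) c y0]/(- F c y0) mulmxN mulNmx mxE.
have appW (w w' : form1 G) : q (wedge w w') =
    covec_app (w c y0) v * covec_app (w' c y0) u - covec_app (w c y0) u * covec_app (w' c y0) v.
  by rewrite qE wedge_app.
have appE := (appD, appN, appZ, appW).
apply: adapted_coframe_bracket.
- by rewrite sqr_sqrtr.
- by rewrite (app _ _ l1 D1) !appE /b /b'; ring.
- by rewrite (app _ _ l2 D2) !appE /b /b'; ring.
- by rewrite (app _ _ l3 D3) !appE /b /b'; ring.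
- by rewrite (app _ _ l4 D4) !appE /b /b'; ring.
- by rewrite (app _ _ l5 D5) !appE /b /b'; ring.
(* For a3 = a4 = 0, alpha is - 4 (a1^2 + a2^2) = - (b^2 + b'^2). *)
- by rewrite (app _ _ lA DA) !appE /b /b'; ring.
Qed.
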